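(* For every $N\geq 1$, the annular Jones polynomial detects $K_N$ among braid-oriented braid closures in $A\times I$, where $K_N\subset A\times I$ is the braid-oriented closure of $(\sigma_1\sigma_2^{-1})^N\in B_3$. That is, if $n\geq 1$, $\alpha\in B_n$, and the braid-oriented closure $\widehat\alpha\subset A\times I$ satisfies $\mathcal J_A(\widehat\alpha;q,z)=\mathcal J_A(K_N;q,z)$, then $\widehat\alpha$ is isotopic to $K_N$ in $A\times I$ as an oriented link.
   Context: $A=S^1\times[0,1]$ is the annulus and $I=[0,1]$; an annular link is a link in $A\times I$, and isotopy means ambient isotopy in $A\times I$. $B_n$ is the braid group on $n$ strands with standard generators $\sigma_1,\dots,\sigma_{n-1}$. The closure $\widehat\alpha$ of $\alpha\in B_n$ is regarded as a link in $A\times I$; its braid orientation orients all strands in parallel in the direction of the braid, and then each $\sigma_i$ contributes a positive crossing and each $\sigma_i^{-1}$ a negative crossing. The annular Jones polynomial of an oriented annular link $L$ is $$\mathcal J_A(L;q,z)=\sum_{i,j,k}(-1)^i q^jz^k\dim_{\mathbb F_2}\operatorname{AKh}^{i,j,k}(L;\mathbb F_2),$$ where $\operatorname{AKh}$ is annular Khovanov homology, defined as follows. Let $D\subset A$ be a diagram of $L$ with $c$ crossings, of which $n_+$ are positive and $n_-$ negative. Each crossing has a $0$-smoothing and a $1$-smoothing in the usual Khovanov convention (the oriented smoothing is the $0$-smoothing at a positive crossing and the $1$-smoothing at a negative crossing). For $v\in\{0,1\}^c$ let $D_v\subset A$ be the resulting complete resolution, a collection of disjoint circles, and $|v|$ the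 number of $1$'s in $v$. The complex is generated over $\mathbb F_2$ by labelled resolutions $x$: a vertex $v$ together with a labelling of each circle of $D_v$ by $v_+$ or $v_-$. Let $\deg(x)$ be the number of $v_+$ labels minus the number of $v_-$ labels. The gradings are: homological $i(x)=|v|-n_-$; quantum $j(x)=\deg(x)+|v|+n_+-2n_-$; annular $k(x)$ = number of essential (homotopically nontrivial in $A$) circles labelled $v_+$ minus number of essential circles labelled $v_-$. The Khovanov differential is the sum over edges of the cube of the maps: merge $v_+\otimes v_+\mapsto v_+$, $v_+\otimes v_-,\,v_-\otimes v_+\mapsto v_-$, $v_-\otimes v_-\mapsto 0$; split $v_+\mapsto v_+\otimes v_-+v_-\otimes v_+$, $v_-\mapsto v_-\otimes v_-$. It does not increase $k$; its $k$-preserving part is the annular differential, and $\operatorname{AKh}^{i,j,k}(L;\mathbb F_2)$ is the triply graded homology with respect to this annular differential. *)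

(* Defs.v *)
From HB Require Import structures.
From mathcomp Require Import all_boot all_order all_fingroup all_algebra.
From mathcomp Require Import all_classical all_reals all_analysis.

Set Implicit Arguments.
Unset Strict Implicit.
Unset Printing Implicit Defensive.

Import Order.TTheory GRing.Theory Num.Theory.
Import numFieldNormedType.Exports.

Local Open Scope ring_scope.

(** * Braid words *)

(* The letter (i, true) is sigma_(i+1) and (i, false) is its inverse.  Strands
   are numbered from 0.  Elements of the braid group B_n are given by the words
   representing them. *)
Definition braid_letter (n : nat) : Type := ('I_n.-1 * bool)%type.
Definition braid_word (n : nat) : Type := seq (braid_letter n).

Lemma succ_strand_subproof (n : nat) (i : 'I_n.-1) : (i.+1 < n)%N.
Proof. by case: n i => [[]//|n] i; rewrite /= ltnS ltn_ord. Qed.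

Definition left_strand (n : nat) (i : 'I_n.-1) : 'I_n :=
  widen_ord (leq_pred n) i.
Definition right_strand (n : nat) (i : 'I_n.-1) : 'I_n :=
  Ordinal (succ_strand_subproof i).

(* (sigma_1 sigma_2^-1)^N in B_3 *)
Definition KN_word (N : nat) : braid_word 3 :=
  flatten (nseq N [:: (ord0, true); (ord_max, false)]).

(** * Annular Khovanov homology of the closure of a braid word

    The standard annular diagram of the closure of w, with c = size w, is cut
    into c slabs, the l-th of which contains the crossing of the l-th letter,
    and one last crossingless slab containing the closing arcs, which go from
    level c back to level 0.  The point (l, p) is the one in position p on
    the radial segment at level l. *)
Section AnnularKhovanov.
Variables (n : nat) (w : braid_word n).

Definition diagram_point : finType := ('I_(size w).+1 * 'I_n)%type.

Definition letter_at (l : 'I_(size w)) : braid_letter n := tnth (in_tuple w) l.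
Definition pos_at (l : 'I_(size w)) : bool := (letter_at l).2.
Definition left_at (l : 'I_(size w)) : 'I_n := left_strand (letter_at l).1.
Definition right_at (l : 'I_(size w)) : 'I_n := right_strand (letter_at l).1.

Definition lower_level (l : 'I_(size w)) : 'I_(size w).+1 :=
  widen_ord (leqnSn (size w)) l.
Definition upper_level (l : 'I_(size w)) : 'I_(size w).+1 := lift ord0 l.

(* In the braid orientation the sign of a crossing is that of its letter. *)
Definition n_plus : nat := #|[pred l | pos_at l]|.
Definition n_minus : nat := #|[pred l | ~~ pos_at l]|.

Definition vertex : finType := {ffun 'I_(size w) -> bool}.

Definition weight (v : vertex) : nat := #|[pred l | v l]|.

(* The oriented smoothing, which is vertical, is the 0-smoothing of a positive
   crossing and the 1-smoothing of a negative one. *)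
Definition vertical (v : vertex) (l : 'I_(size w)) : bool :=
  v l == ~~ pos_at l.

(* The arcs of the resolution D_v in slab l: the other smoothing consists of the
   two turnbacks joining the positions of the crossing strands. *)
Definition slab_arc (v : vertex) (l : 'I_(size w)) : rel diagram_point :=
  fun x y =>
  if vertical v l || (x.2 \notin [:: left_at l; right_at l])
  then [&& x.1 == lower_level l, y.1 == upper_level l & x.2 == y.2]
  else [&& x.1 == y.1, x.1 \in [:: lower_level l; upper_level l],
           x.2 == left_at l & y.2 == right_at l].

Definition closing_arc : rel diagram_point := fun x y =>
  [&& x.1 == ord_max, y.1 == ord0 & x.2 == y.2].

Definition resolution_arc (v : vertex) : rel diagram_point := fun x y =>
  closing_arc x y || [exists l, slab_arc v l x y].

Definition adjacent (v : vertex) : rel diagram_point := fun x y =>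
  resolution_arc v x y || resolution_arc v y x.

Definition same_circle (v : vertex) : rel diagram_point := connect (adjacent v).

Definition circles (v : vertex) : {set {set diagram_point}} :=
  equivalence_partition (same_circle v) [set: diagram_point].

(* Orienting the arcs through even positions along the braid and those through
   odd positions against it is consistent, because turnbacks join consecutive
   positions.  The sum below is the resulting algebraic intersection number of
   the circle with the radial segment at level c, that is, its class in
   pi_1(A) = Z. *)
Definition winding (C : {set diagram_point}) : int :=
  \sum_(p < n | (ord_max, p) \in C) (-1) ^+ p.

Definition essential (C : {set diagram_point}) : bool := winding C != 0.

(* A labelled resolution: a vertex, and a labelling of the points (true for v_+,
   false for v_-) that is constant on each circle. *)
Definition state : finType := (vertex * {ffun diagram_point -> bool})%type.

Definition is_labelled_resolution (x : state) : bool :=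
  [forall p, forall q, same_circle x.1 p q ==> (x.2 p == x.2 q)].

Definition label_sign (x : state) (C : {set diagram_point}) : int :=
  if [forall p in C, x.2 p] then 1 else -1.

Definition deg (x : state) : int := \sum_(C in circles x.1) label_sign x C.

Definition hgrading (x : state) : int := (weight x.1)%:Z - n_minus%:Z.
Definition qgrading (x : state) : int :=
  deg x + (weight x.1)%:Z + n_plus%:Z - n_minus%:Z *+ 2.
Definition kgrading (x : state) : int :=
  \sum_(C in circles x.1 | essential C) label_sign x C.

Definition generators (i j k : int) : {set state} :=
  [set x : state | [&& is_labelled_resolution x,
     hgrading x == i, qgrading x == j & kgrading x == k]]%SET.

(* Coefficient of c in the image of a (x) b under the merge map. *)
Definition merge_coef (a b c : bool) : bool :=
  match a, b with
  | true, true => c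
  | true, false | false, true => ~~ c
  | false, false => false
  end.

(* Coefficient of b (x) c in the image of a under the split map. *)
Definition split_coef (a b c : bool) : bool :=
  if a then b (+) c else ~~ b && ~~ c.

(* Coefficient of y in the image of x under the edge map at the crossing l.  In
   either smoothing of this crossing, the two arcs pass through the corners a
   and d respectively; the edge map merges the circles through a and d if they
   are distinct in the resolution of x, and otherwise splits the circle through
   a and d. *)
Definition edge_coef (x y : state) (l : 'I_(size w)) : bool :=
  let a : diagram_point := (lower_level l, left_at l) in
  let d : diagram_point := (upper_level l, right_at l) in
  [&& ~~ x.1 l,
      [forall m, y.1 m == ((m == l) || x.1 m)],
      [forall p, ~~ same_circle x.1 a p && ~~ same_circle x.1 d p
                 ==> (y.2 p == x.2 p)]
    & if same_circle x.1 a d then split_coef (x.2 a) (y.2 a) (y.2 d)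
      else merge_coef (x.2 a) (x.2 d) (y.2 a)].

(* At most one l contributes, so that this is the coefficient in F_2. *)
Definition khovanov_coef (x y : state) : bool := [exists l, edge_coef x y l].

(* The component C^{i,j,k} -> C^{i+1,j,k} of the Khovanov differential, acting
   on row vectors. *)
Definition annular_diff (i j k : int) :
    'M['F_2]_(#|generators i j k|, #|generators (i + 1) j k|) :=
  \matrix_(r, s) (khovanov_coef (enum_val r) (enum_val s))%:R.

Definition dim_AKh (i j k : int) : nat :=
  (\rank (kermx (annular_diff i j k)) - \rank (annular_diff (i - 1) j k))%N.

(* The annular Jones polynomial, a Laurent polynomial, is given by its
   coefficients: this is the one of q^j z^k.  The sum runs over all
   homological degrees i = m - n_- in which the complex is nonzero. *)
Definition annular_jones (j k : int) : int :=
  \sum_(m < (size w).+1)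
    (-1) ^ (m%:Z - n_minus%:Z) * (dim_AKh (m%:Z - n_minus%:Z) j k)%:Z.

End AnnularKhovanov.

(** * Links in the thickened annulus *)

Local Open Scope classical_set_scope.

Section ThickenedAnnulus.
Variable R : realType.

(* ((x, y), r, h) with (x, y) in S^1, r in [0,1] the radial coordinate of the
   annulus and h in I the height. *)
Definition space4 : Type := (R * R * R * R)%type.

Definition thickened_annulus : set space4 :=
  [set P | [/\ P.1.1.1 ^+ 2 + P.1.1.2 ^+ 2 = 1, 0 <= P.1.2 <= 1
             & 0 <= P.2 <= 1]].

Definition self_homeomorphism (M : set space4) (f : space4 -> space4) : Prop :=
  exists g : space4 -> space4,
    [/\ {within M, continuous f}, {within M, continuous g},
        (forall x, M x -> M (f x)), (forall x, M x -> M (g x))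
      & forall x, M x -> g (f x) = x /\ f (g x) = x].

Definition ambient_isotopy (M : set space4) (H : R -> space4 -> space4) : Prop :=
  [/\ {within [set tx : R * space4 | 0 <= tx.1 <= 1 /\ M tx.2],
         continuous (fun tx : R * space4 => H tx.1 tx.2)},
      forall t, 0 <= t <= 1 -> self_homeomorphism M (H t)
    & forall x, M x -> H 0 x = x].

(* An oriented link is given by a finite family of curves [0, +oo) -> M, each
   running periodically, in the positive direction, along a whole component;
   every component is the image of at least one of them. *)
Definition link_support (I : finType) (L : I -> R -> space4) : set space4 :=
  [set x | exists i u, 0 <= u /\ L i u = x].

(* The final map takes one link onto the other and each oriented component to an
   oriented component: on parameters it is given by an increasing map rho. *)
Definition oriented_isotopic (M : set space4) (I J : finType)
    (L : I -> R -> space4) (L' : J -> R -> space4) : Prop :=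
  exists H : R -> space4 -> space4,
    [/\ ambient_isotopy M H,
        [set H 1 x | x in link_support L] = link_support L'
      & forall i, exists j (rho : R -> R),
          [/\ {within [set u | 0 <= u], continuous rho},
              0 <= rho 0,
              (forall u u', 0 <= u -> u < u' -> rho u < rho u')
            & forall u, 0 <= u -> H 1 (L i u) = L' j (rho u)]].

End ThickenedAnnulus.

Arguments thickened_annulus R : clear implicits.

(** * The closure of a braid word as an oriented link *)

Section Closure.
Variables (R : realType) (n : nat) (w : braid_word n).

(* The circle is divided into size w + 1 sectors: one for each letter, and a
   last one, without crossing, for which the letter is None. *)
Definition sectors : nat := (size w).+1.

Definition sector_letter (m : nat) : option (braid_letter n) :=
  onth w (m %% sectors).

Definition next_position (a : option (braid_letter n)) (p : 'I_n) : 'I_n :=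
  if a is Some (i, _) then tperm (left_strand i) (right_strand i) p else p.

(* Position, at the beginning of the m-th sector met, of the strand starting at
   position p; m is not bounded, as the strand may go round several times. *)
Fixpoint position (p : 'I_n) (m : nat) : 'I_n :=
  if m is m'.+1 then next_position (sector_letter m') (position p m') else p.

Definition strand_radius (p : 'I_n) : R := p.+1%:R / n.+1%:R.

Definition letter_sign (a : option (braid_letter n)) : R :=
  if a is Some (_, false) then -1 else 1.

(* Radial and height coordinates, at time s in [0,1], of the strand at position
   p in a sector with letter a.  At a crossing the two strands make a half turn
   about their midpoint.  At a positive crossing the strand moving outwards
   passes over: with the annulus oriented by (radial, angular) directions, this
   is the right-handed crossing. *)
Definition strand_arc (a : option (braid_letter n)) (p : 'I_n) (s : R) :
    R * R :=
  let p' := next_position a p in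
  let mid := (strand_radius p + strand_radius p') / 2 in
  let half := (strand_radius p' - strand_radius p) / 2 in
  (mid - half * cos (pi * s), 1 / 2 + letter_sign a * half * sin (pi * s)).

(* The strand starting at position p, followed in the direction of the braid;
   the m-th sector met corresponds to the parameters u in [m, m + 1). *)
Definition braid_closure (p : 'I_n) (u : R) : space4 R :=
  let m := Num.truncn u in
  let theta := 2 * pi * u / sectors%:R in
  let rh := strand_arc (sector_letter m) (position p m) (u - m%:R) in
  (cos theta, sin theta, rh.1, rh.2).

End Closure.

Arguments braid_closure R {n} w p u.

(* Main.v *)
(* The Euler characteristic turns the annular Jones polynomial into a signed count
   of labelled resolutions.  Its top annular degree comes from the braid-like
   resolution alone and determines the number of strands and the writhe.  For
   three strands, the coefficient of z is q (q^writhe + T), where T is the trace of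
   the braid in the Temperley-Lieb module of diagrams with one through strand,
   which is the reduced Burau module up to a scalar, with s = - q^2.

   Modulo its centre, B_3 is PSL(2, Z) = Z/2 * Z/3, so that, up to full twists,
   every braid is conjugate to a positive word in A = sigma_1 and B = sigma_2^-1
   or to a torsion element; the latter are excluded by the exponent sum modulo 6.
   The lowest term of the Burau trace fixes the number of full twists and the
   length 2 N of the positive word, and the next coefficient is the number of
   cyclic occurrences of BA, which is N only for (BA)^N.

   The relations of B_3 and conjugation are realized by ambient isotopies: a
   homotopy through embedded closed curves is cut into steps so small that adding
   cones around the points of the moving strands to the identity of each page of
   the annulus gives Lipschitz-small perturbations of the identity, which are
   homeomorphisms. *)

From HB Require Import structures.
Require Import Defs.
From mathcomp Require Import all_boot all_order all_fingroup all_algebra.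
From mathcomp Require Import all_classical all_reals all_analysis.
From mathcomp Require Import ring lra zify.
From Stdlib Require Setoid.

Set Implicit Arguments.
Unset Strict Implicit.
Unset Printing Implicit Defensive.

Import Order.TTheory GRing.Theory Num.Theory.
Import numFieldNormedType.Exports.

Local Open Scope ring_scope.

(** * Circles of a resolution *)

(** The circles are defined combinatorially, so the one topological fact needed about smoothings,
    that switching one always merges two circles or splits one, has to come from orientability: the
    parity orientation makes each resolution a permutation of the diagram points, and switching a
    smoothing multiplies it by a transposition. The behaviour of the gradings and the vanishing of
    the square of the differential rest on this; the latter is what makes the Euler characteristic
    of homology a count of generators.

    Restricting to the annular part of the differential also takes the bound 1 on windings, a
    property of simple closed curves in an annulus. It is proved for three strands, which suffices:
    in the top annular degree the complex has a single generator, and that degree already yields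
    [n = 3].

    Traces are compared at rational [q] only, infinitely many values being enough for polynomial
    identities. Words are compared up to twists added on either side, so that negative powers of the
    centre are never written; the numbers of twists remain unknowns until the constant term 1 of the
    trace polynomials makes the power of [s] readable. *)

Section SwappedPermutation.
Variable T : finType.
Implicit Types (s : {perm T}) (x y p q : T).

Lemma porbit_sub s (r : rel T) p q : reflexive r -> transitive r ->
  (forall z, r z (s z)) -> q \in porbit s p -> r p q.
Proof.
move=> rr rt rs /porbitP[i ->]; elim: i => [|i IH]; first by rewrite expg0 perm1.
by rewrite expgSr permM; exact: rt IH (rs _).
Qed.

Lemma porbit_trans s p q z : q \in porbit s p -> z \in porbit s q -> z \in porbit s p.
Proof. by rewrite -!eq_porbit_mem => /eqP -> /eqP ->. Qed.

Lemma porbit_step s p : s p \in porbit s p.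
Proof. by have := mem_porbit s 1 p; rewrite expg1. Qed.

(** [porbits_mul_tperm] tells in which direction the number of cycles changes by one. Applied to [s]
    and to the swapped permutation, whose own swap is [s] again, it gives opposite directions. *)
Lemma porbit_swap s x y : x != y ->
  (y \in porbit (tperm x y * s)%g x) = (y \notin porbit s x).
Proof.
move=> nxy; have /= := porbits_mul_tperm s x y.
have /= := porbits_mul_tperm (tperm x y * s)%g x y.
rewrite mulgA tperm2 mul1g nxy ![x \in _]porbit_sym.
by case: (y \in porbit s x); case: (y \in _); lia.
Qed.

(** One step of the swapped permutation stays within a cycle of [s] or within the union of the
    cycles of [x] and [y]; conversely [porbit_swap] connects [x] to [y]. *)
Lemma porbit_join s x y p q : y \notin porbit s x -> x != y ->
  (q \in porbit (tperm x y * s)%g p) =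
  (q \in porbit s p) ||
  ((p \in porbit s x) || (p \in porbit s y)) && ((q \in porbit s x) || (q \in porbit s y)).
Proof.
move=> nxy xy; set s' := (tperm x y * s)%g.
have xy' : y \in porbit s' x by rewrite porbit_swap.
have s'E z : s' z = s (tperm x y z) by rewrite permM.
have sub : forall p q, q \in porbit s p -> q \in porbit s' p.
  move=> p' q'; apply: (@porbit_sub s (fun p q => q \in porbit s' p)) => [z|b a c|z].
  - exact: porbit_id.
  - exact: porbit_trans.
  have [->|nzx] := eqVneq z x.
    apply: porbit_trans xy' _; rewrite (_ : s x = s' y) ?porbit_step//.
    by rewrite s'E tpermR.
  have [->|nzy] := eqVneq z y.
    rewrite porbit_sym in xy'; apply: porbit_trans xy' _.
    by rewrite (_ : s y = s' x) ?porbit_step// s'E tpermL.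
  by rewrite (_ : s z = s' z) ?porbit_step// s'E tpermD// eq_sym.
apply/idP/idP => [|/orP[]].
- pose r p q := (q \in porbit s p) || ((p \in porbit s x) || (p \in porbit s y)) &&
     ((q \in porbit s x) || (q \in porbit s y)).
  apply: (@porbit_sub s' r) => [z|b a c|z].
  + by rewrite /r porbit_id.
  + have mono a' b' : b' \in porbit s a' ->
      ((a' \in porbit s x) || (a' \in porbit s y)) = ((b' \in porbit s x) || (b' \in porbit s y)).
      rewrite -eq_porbit_mem => /eqP e.
      by rewrite ![a' \in _]porbit_sym ![b' \in _]porbit_sym e.
    rewrite /r => /orP[ab|/andP[ha hb]] /orP[bc|/andP[hb' hc]].
    * by rewrite (porbit_trans ab bc).
    * by rewrite (mono _ _ ab) hb' hc orbT.
    * by rewrite ha -(mono _ _ bc) hb orbT.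
    * by rewrite ha hc orbT.
  + rewrite /r s'E; case: tpermP => [->|->|_ _].
    * by rewrite porbit_id porbit_step !orbT.
    * by rewrite porbit_id porbit_step !orbT.
    * by rewrite porbit_step.
- exact: sub.
- have toX z : (z \in porbit s x) || (z \in porbit s y) -> z \in porbit s' x.
    by case/orP => /sub // h; exact: porbit_trans xy' h.
  move=> /andP[/toX pX /toX qX]; rewrite porbit_sym in pX.
  exact: porbit_trans pX qX.
Qed.

End SwappedPermutation.

(** * Circles as the cycles of a permutation *)

Section Orientation.
Variables (n : nat) (w : braid_word n).
Local Notation point := (diagram_point w).
Local Notation slab := 'I_(size w).
Implicit Types (v : vertex w) (l m : slab) (p q : point).

Definition toggle v l : vertex w := [ffun m => if m == l then ~~ v l else v m].

Definition corner_a l : point := (lower_level l, left_at l).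
Definition corner_d l : point := (upper_level l, right_at l).

(* Circles are oriented upwards at even positions, downwards at odd ones. The
   arcs of either smoothing of slab [l] start at the points [source1 l] and
   [source2 l], and toggling the smoothing exchanges their targets. *)
Definition source1 l : point :=
  if odd (left_at l) then (upper_level l, left_at l) else corner_a l.
Definition source2 l : point :=
  if odd (left_at l) then (lower_level l, right_at l) else corner_d l.

(** [ordS] and [ord_pred] are cyclic, which accounts for the closing arcs. *)
Definition straight_next p : point :=
  ((if odd p.2 then ord_pred p.1 else ordS p.1), p.2).

Lemma straight_next_inj : injective straight_next.
Proof.
move=> [k i] [k' i'] [e1 e2]; subst i'; congr pair.
by move: e1; case: ifP => _; [exact: ord_pred_inj|exact: ordS_inj].
Qed.

Definition is_source l p := (p == source1 l) || (p == source2 l).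

Definition reconnect v p : point :=
  if [pick l | ~~ vertical v l && is_source l p] is Some l
  then tperm (source1 l) (source2 l) p else p.

(** A source at an even position is at the bottom of its slab and one at an odd position at the top,
    so removing the parity leaves the number of the slab. Hence no point is a source of two
    slabs. *)
Lemma source_level l p : is_source l p -> (p.1 - odd p.2)%N = l.
Proof.
rewrite /is_source /source1 /source2; case: ifP => oi /orP[] /eqP -> /=.
- by rewrite oi /bump /= add1n subn1.
- by rewrite oi subn0.
- by rewrite oi subn0.
- by rewrite oi /bump /= add1n subn1.
Qed.

Lemma is_source_uniq l m p : is_source l p -> is_source m p -> l = m.
Proof.
by move=> /source_level e1 /source_level e2; apply: val_inj; rewrite /= -e1 -e2.
Qed.

Lemma is_source_position l p : is_source l p -> p.2 \in [:: left_at l; right_at l].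
Proof.
rewrite /is_source /source1 /source2 !inE.
by case: ifP => _ /orP[] /eqP ->; rewrite eqxx ?orbT.
Qed.

Lemma left_right_neq l : left_at l != right_at l.
Proof. by rewrite -val_eqE /= ltn_eqF. Qed.

Lemma corner_neq l : corner_a l != corner_d l.
Proof. by rewrite /corner_a /corner_d xpair_eqE negb_and left_right_neq orbT. Qed.

Lemma source_neq l : source1 l != source2 l.
Proof.
rewrite /source1 /source2; case: ifP => _; last exact: corner_neq.
by rewrite xpair_eqE negb_and left_right_neq orbT.
Qed.

Lemma is_source_tperm l p :
  is_source l (tperm (source1 l) (source2 l) p) = is_source l p.
Proof.
rewrite /is_source; case: tpermP => [->|->|_ _ //];
  by rewrite !eqxx /= orbT.
Qed.

Lemma vertical_toggle v l m :
  vertical (toggle v l) m = if m == l then ~~ vertical v l else vertical v m.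
Proof.
rewrite /vertical ffunE; case: (eqVneq m l) => [->|//].
by case: (v l); case: (pos_at l).
Qed.

Lemma reconnect_horizontal v l p : ~~ vertical v l -> is_source l p ->
  reconnect v p = tperm (source1 l) (source2 l) p.
Proof.
move=> vl lp; rewrite /reconnect; case: pickP => [m /andP[_ mp]|/(_ l)].
  by rewrite (is_source_uniq mp lp).
by rewrite vl lp.
Qed.

Lemma reconnect_id v p :
  (forall l, is_source l p -> vertical v l) -> reconnect v p = p.
Proof.
by move=> h; rewrite /reconnect; case: pickP => // l /andP[/negP nv /h].
Qed.

Lemma reconnectP v p :
  (exists l, [/\ ~~ vertical v l, is_source l p &
     reconnect v p = tperm (source1 l) (source2 l) p]) \/
  ((forall l, is_source l p -> vertical v l) /\ reconnect v p = p).
Proof.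
case: (pickP (fun l => ~~ vertical v l && is_source l p)) => [l /andP[vl lp]|h].
  by left; exists l; split => //; exact: reconnect_horizontal.
right; have h' l : is_source l p -> vertical v l.
  by move=> lp; move: (h l); rewrite lp andbT => /negbFE.
by split=> //; exact: reconnect_id.
Qed.

Lemma reconnect_invol v : involutive (reconnect v).
Proof.
move=> p; case: (reconnectP v p) => [[l [vl lp ->]]|[_ e]]; last by rewrite !e.
by rewrite (reconnect_horizontal vl) ?is_source_tperm// tpermK.
Qed.

Lemma orient_inj v : injective (fun p => straight_next (reconnect v p)).
Proof. by move=> p q /straight_next_inj /(inv_inj (reconnect_invol v)). Qed.

Definition orient v : {perm point} := perm (@orient_inj v).

Lemma orientE v p : orient v p = straight_next (reconnect v p).
Proof. by rewrite permE. Qed.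

(** Only the steps from the two sources of slab [l] depend on its smoothing. This single
    transposition replaces planar arguments about smoothings. *)
Lemma orient_toggle v l :
  orient (toggle v l) = (tperm (source1 l) (source2 l) * orient v)%g.
Proof.
apply/permP => p; rewrite permM !orientE; congr straight_next.
have [lp|nlp] := boolP (is_source l p).
  have [vl|vl] := boolP (vertical v l).
    rewrite (@reconnect_horizontal _ l) ?vertical_toggle ?eqxx ?negbK//.
    rewrite [RHS]reconnect_id// => m; rewrite -(is_source_tperm l) in lp.
    by move=> mp; rewrite -(is_source_uniq lp mp).
  rewrite [RHS](@reconnect_horizontal _ l) ?is_source_tperm// tpermK.
  rewrite reconnect_id// => m mp; rewrite -(is_source_uniq lp mp).
  by rewrite vertical_toggle eqxx.
have [p1 p2] : source1 l != p /\ source2 l != p.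
  by move: nlp; rewrite /is_source negb_or ![p == _]eq_sym => /andP.
rewrite tpermD// /reconnect.
rewrite (@eq_pick _ _ (fun m => ~~ vertical v m && is_source m p))// => m.
rewrite /= vertical_toggle; case: (eqVneq m l) => // ->.
by rewrite (negPf nlp) !andbF.
Qed.

Lemma ordS_lower l : ordS (lower_level l) = upper_level l.
Proof. by apply: val_inj; rewrite /= /bump /= add1n modn_small// ltnS. Qed.

Lemma ord_pred_upper l : ord_pred (upper_level l) = lower_level l.
Proof. by rewrite -ordS_lower ordSK. Qed.

Lemma ordS_max : ordS (ord_max : 'I_(size w).+1) = ord0.
Proof. by apply: val_inj; rewrite /= modnn. Qed.

Lemma ord_pred0 : ord_pred (ord0 : 'I_(size w).+1) = ord_max.
Proof. by rewrite -ordS_max ordSK. Qed.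

Lemma right_odd l : odd (right_at l) = ~~ odd (left_at l).
Proof. by []. Qed.

Lemma source_bottom l (i : 'I_n) : odd i -> ~~ is_source l (ord0, i).
Proof.
move=> oi; rewrite /is_source /source1 /source2 /corner_a /corner_d.
have nu : (ord0 == upper_level l) = false by [].
case: ifP => ol; rewrite !xpair_eqE !nu ?orbF /=.
  by rewrite negb_and orbC; apply/orP; left; apply: contraTneq oi => ->; rewrite right_odd ol.
by rewrite negb_and orbC; apply/orP; left; apply: contraTneq oi => ->; rewrite ol.
Qed.

Lemma orient_straight v p :
  (forall l, is_source l p -> vertical v l) -> orient v p = straight_next p.
Proof. by move=> h; rewrite orientE reconnect_id. Qed.

Lemma resolution_arc_orient v p q : resolution_arc v p q ->
  (orient v p == q) || (orient v q == p).
Proof.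
case: p q => [k i] [k' i'] /orP[/and3P[/= /eqP -> /eqP -> /eqP <-]|/existsP[l]].
  have [oi|oi] := boolP (odd i).
    rewrite [X in _ || X](_ : _ = true) ?orbT// orient_straight => [|l lp].
      by rewrite /straight_next /= oi ord_pred0 eqxx.
    by have := source_bottom l oi; rewrite lp.
  rewrite [X in X || _](_ : _ = true)// orient_straight => [|l lp].
    by rewrite /straight_next /= (negPf oi) ordS_max eqxx.
  have := source_level lp; rewrite /= (negPf oi) subn0 => e.
  by have := ltn_ord l; rewrite -e ltnn.
rewrite /slab_arc; case: ifP => [vi /and3P[/= /eqP -> /eqP -> /eqP <-]|].
  have straight p : p.2 = i -> (p.1 - odd p.2)%N = l -> forall m, is_source m p -> vertical v m.
    move=> pi pl m mp; have ml : m = l.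
      by apply: val_inj; rewrite /= -pl (source_level mp).
    by move: vi; rewrite -ml /= -pi (is_source_position mp) orbF.
  have [oi|oi] := boolP (odd i).
    rewrite [X in _ || X](_ : _ = true) ?orbT// orient_straight; last first.
      by apply: straight; rewrite //= oi /bump /= add1n subn1.
    by rewrite /straight_next /= oi ord_pred_upper eqxx.
  rewrite [X in X || _](_ : _ = true)// orient_straight; last first.
    by apply: straight; rewrite //= (negPf oi) subn0.
  by rewrite /straight_next /= (negPf oi) ordS_lower eqxx.
move=> /negbT; rewrite negb_or => /andP[vl _] /and4P[/= /eqP <- kl /eqP -> /eqP ->].
have s1 : is_source l (source1 l) by rewrite /is_source eqxx.
have s2 : is_source l (source2 l) by rewrite /is_source eqxx orbT.
have e1 : orient v (source1 l) = straight_next (source2 l).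
  by rewrite orientE (reconnect_horizontal vl)// tpermL.
have e2 : orient v (source2 l) = straight_next (source1 l).
  by rewrite orientE (reconnect_horizontal vl)// tpermR.
move: e1 e2; rewrite /source1 /source2 /straight_next /= -/(nat_of_ord (left_at l)).
move: kl; rewrite !inE -[odd (letter_at l).1]/(odd (left_at l)).
have oE : odd (letter_at l).1 = odd (left_at l) by [].
case: (boolP (odd (left_at l))) => ol /orP[]/eqP -> /=;
  rewrite oE ?ol ?(negPf ol) /= ?ordS_lower ?ord_pred_upper /corner_a /corner_d;
  by move=> e1 e2; rewrite ?e1 ?e2 ?eqxx ?orbT.
Qed.

Lemma adjacent_sym v : symmetric (Defs.adjacent v).
Proof. by move=> p q; rewrite /Defs.adjacent orbC. Qed.

Lemma slab_arc_adjacent v l p q : slab_arc v l p q -> Defs.adjacent v p q.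
Proof.
by move=> h; rewrite /Defs.adjacent /resolution_arc; apply/orP; left; apply/orP; right;
  apply/existsP; exists l.
Qed.

Lemma orient_adjacent v p : Defs.adjacent v p (orient v p).
Proof.
rewrite orientE; have [[l [vl lp ->]]|[h ->]] := reconnectP v p.
  have turn k : k \in [:: lower_level l; upper_level l] ->
      Defs.adjacent v (k, left_at l) (k, right_at l).
    move=> kl; apply: (@slab_arc_adjacent _ l).
    by move: kl; rewrite /slab_arc (negPf vl) /= !inE !eqxx /= => ->.
  have turn' k : k \in [:: lower_level l; upper_level l] ->
      Defs.adjacent v (k, right_at l) (k, left_at l).
    by rewrite adjacent_sym; exact: turn.
  have lo : lower_level l \in [:: lower_level l; upper_level l] by rewrite inE eqxx.
  have up : upper_level l \in [:: lower_level l; upper_level l].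
    by rewrite !inE eqxx orbT.
  case/orP: lp => /eqP ->; rewrite ?tpermL ?tpermR /source1 /source2 /straight_next.
    case: ifP => ol /=.
      by rewrite -[odd (letter_at l).1]/(odd (left_at l)) ol ordS_lower; exact: turn.
    by rewrite -[odd (letter_at l).1]/(odd (left_at l)) ol ord_pred_upper; exact: turn.
  case: ifP => ol /=.
    by rewrite -[odd (letter_at l).1]/(odd (left_at l)) ol ord_pred_upper; exact: turn'.
  by rewrite -[odd (letter_at l).1]/(odd (left_at l)) ol ordS_lower; exact: turn'.
case: p h => [k i] h; rewrite /straight_next /=; case: ifP => oi.
  have [k0|k0] := posnP k.
    have -> : k = ord0 by exact: val_inj.
    rewrite ord_pred0 adjacent_sym; apply/orP; left; apply/orP; left.
    by rewrite /closing_arc /= !eqxx.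
  have lk : (k.-1 < size w)%N by rewrite -ltnS prednK.
  pose l := Ordinal lk.
  have kE : k = upper_level l by apply: val_inj; rewrite /= /bump /= add1n prednK.
  rewrite kE ord_pred_upper adjacent_sym; apply: (@slab_arc_adjacent _ l).
  rewrite /slab_arc ifT /= ?eqxx//; apply: contraT; rewrite negb_or negbK => /andP[nv].
  rewrite !inE => il; move: nv; rewrite h// /is_source /source1 /source2.
  case: ifP => ol; rewrite kE /= !xpair_eqE !eqxx /=.
    case/orP: il => /eqP iE; first by rewrite iE eqxx.
    by move: oi; rewrite iE right_odd ol.
  by case/orP: il => /eqP iE; [move: oi; rewrite iE ol|rewrite iE eqxx orbT].
have [kc|kc] := eqVneq k ord_max.
  rewrite kc ordS_max; apply/orP; left; apply/orP; left.
  by rewrite /closing_arc /= !eqxx.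
have lk : (k < size w)%N.
  by have := ltn_ord k; rewrite ltnS leq_eqVlt => /orP[/eqP e|//]; case/eqP: kc; exact: val_inj.
pose l := Ordinal lk.
have kE : k = lower_level l by exact: val_inj.
rewrite kE ordS_lower; apply: (@slab_arc_adjacent _ l).
rewrite /slab_arc ifT /= ?eqxx//; apply: contraT; rewrite negb_or negbK => /andP[nv].
rewrite !inE => il; move: nv; rewrite h// /is_source /source1 /source2.
case: ifP => ol; rewrite kE /= !xpair_eqE !eqxx /=.
  by case/orP: il => /eqP iE; [move: oi; rewrite iE ol|rewrite iE eqxx orbT].
case/orP: il => /eqP iE; first by rewrite iE eqxx.
by move: oi; rewrite iE right_odd ol.
Qed.

(** Every arc is a step of [orient v] in one direction or the other, and every step runs along an
    arc. *)
Lemma same_circleE v p q : same_circle v p q = (q \in porbit (orient v) p).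
Proof.
apply/idP/idP.
  case/connectP => s; elim: s p => [|z s IH] p /=; first by move=> _ ->; exact: porbit_id.
  move=> /andP[pz /IH h] /h; apply: porbit_trans.
  move: pz; rewrite /Defs.adjacent => /orP[] /resolution_arc_orient /orP[] /eqP <-;
    by rewrite ?porbit_step// porbit_sym porbit_step.
apply: (@porbit_sub _ _ (same_circle v)) => [z|a b c|z].
- exact: connect0.
- exact: connect_trans.
- exact/connect1/orient_adjacent.
Qed.

End Orientation.

(** * Merging and splitting circles *)

Section Surgery.
Variables (n : nat) (w : braid_word n).
Local Notation point := (diagram_point w).
Local Notation slab := 'I_(size w).
Implicit Types (v : vertex w) (l m : slab) (p q z : point) (x y : state w).

Lemma same_circle_refl v p : same_circle v p p.
Proof. exact: connect0. Qed.

Lemma same_circle_sym v p q : same_circle v p q = same_circle v q p.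
Proof. by rewrite !same_circleE porbit_sym. Qed.

Lemma same_circle_trans v p q z :
  same_circle v p q -> same_circle v q z -> same_circle v p z.
Proof. exact: connect_trans. Qed.

Lemma same_circle_equiv v p q : same_circle v p q ->
  forall z, same_circle v p z = same_circle v q z.
Proof.
move=> pq z; apply/idP/idP; apply: same_circle_trans => //.
by rewrite same_circle_sym.
Qed.

Definition touched v l p := same_circle v (corner_a l) p || same_circle v (corner_d l) p.

Lemma toggleK v l : toggle (toggle v l) l = v.
Proof. by apply/ffunP => m; rewrite !ffunE eqxx; case: eqVneq => [->|//]; rewrite negbK. Qed.

Lemma orient_sources v l :
  [\/ source1 l = corner_a l /\ source2 l = corner_d l,
      orient v (source1 l) = corner_a l /\ orient v (source2 l) = corner_d l |
      orient v (source1 l) = corner_d l /\ orient v (source2 l) = corner_a l].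
Proof.
rewrite !orientE; have [ol|ol] := boolP (odd (left_at l)); last first.
  by apply: Or31; rewrite /source1 /source2 (negPf ol).
have e1 : straight_next (source1 l) = corner_a l.
  by rewrite /source1 ol /straight_next /= -[odd (letter_at l).1]/(odd (left_at l)) ol ord_pred_upper.
have e2 : straight_next (source2 l) = corner_d l.
  by rewrite /source2 ol /straight_next /= -[odd (letter_at l).1]/(odd (left_at l)) ol ordS_lower.
have s1 : is_source l (source1 l) by rewrite /is_source eqxx.
have s2 : is_source l (source2 l) by rewrite /is_source eqxx orbT.
have [vl|vl] := boolP (vertical v l).
  apply: Or32; rewrite !reconnect_id//.
    by move=> m mp; rewrite -(is_source_uniq s2 mp).
  by move=> m mp; rewrite -(is_source_uniq s1 mp).
by apply: Or33; rewrite !(reconnect_horizontal vl)// tpermL tpermR e1 e2.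
Qed.

Lemma porbit_orient v p : porbit (orient v) (orient v p) = porbit (orient v) p.
Proof. by apply/eqP; rewrite eq_porbit_mem porbit_step. Qed.

Lemma touched_sources v l p :
  touched v l p = (p \in porbit (orient v) (source1 l)) || (p \in porbit (orient v) (source2 l)).
Proof.
rewrite /touched !same_circleE; case: (orient_sources v l) => -[e1 e2].
- by rewrite -e1 -e2.
- by rewrite -e1 -e2 !porbit_orient.
- by rewrite -e1 -e2 !porbit_orient orbC.
Qed.

Lemma same_corners_sources v l :
  same_circle v (corner_a l) (corner_d l) = (source2 l \in porbit (orient v) (source1 l)).
Proof.
rewrite same_circleE -!eq_porbit_mem.
case: (orient_sources v l) => -[e1 e2].
- by rewrite -e1 -e2.
- by rewrite -e1 -e2 !porbit_orient.
- by rewrite -e1 -e2 !porbit_orient eq_sym.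
Qed.

(** Every edge of the cube is a merge or a split, never a map from one circle to one circle. *)
Lemma same_corners_toggle v l :
  same_circle (toggle v l) (corner_a l) (corner_d l) =
  ~~ same_circle v (corner_a l) (corner_d l).
Proof. by rewrite !same_corners_sources orient_toggle porbit_swap// source_neq. Qed.

Lemma same_circle_toggle v l p q :
  ~~ same_circle v (corner_a l) (corner_d l) ->
  same_circle (toggle v l) p q =
  same_circle v p q || touched v l p && touched v l q.
Proof.
rewrite same_corners_sources => h.
rewrite !same_circleE orient_toggle porbit_join ?source_neq// !touched_sources.
by rewrite ![p \in _]porbit_sym.
Qed.

Lemma touched_toggle v l p : touched (toggle v l) l p = touched v l p.
Proof.
wlog h : v / ~~ same_circle v (corner_a l) (corner_d l) => [hw|].
  have [h|h] := boolP (same_circle v (corner_a l) (corner_d l)); last exact: hw.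
  by rewrite -[in RHS](toggleK v l) -hw// same_corners_toggle h.
rewrite {1}/touched !same_circle_toggle// /touched !same_circle_refl orbT /= .
by case: (same_circle v _ p); case: (same_circle v _ p).
Qed.

Definition circle_of v p : {set point} := [set q | same_circle v p q]%SET.

Lemma mem_circle_of v p q : (q \in circle_of v p) = same_circle v p q.
Proof. by rewrite inE. Qed.

Lemma circlesE v : circles v = [set circle_of v p | p in [set: point]]%SET.
Proof.
by apply: eq_imset => p; apply/setP => q; rewrite !inE.
Qed.

Lemma circle_of_in v p : circle_of v p \in circles v.
Proof. by rewrite circlesE; apply/imsetP; exists p. Qed.

Lemma circlesP v C : reflect (exists p, C = circle_of v p) (C \in circles v).
Proof.
rewrite circlesE; apply: (iffP imsetP) => [[p _ ->]|[p ->]]; by exists p.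
Qed.

Lemma eq_circle_of v p q : (circle_of v p == circle_of v q) = same_circle v p q.
Proof.
apply/eqP/idP => [/setP/(_ q)|pq]; first by rewrite !mem_circle_of same_circle_refl.
by apply/setP => z; rewrite !mem_circle_of (same_circle_equiv pq).
Qed.

Lemma circles_toggle v l : ~~ same_circle v (corner_a l) (corner_d l) ->
  let A := circle_of v (corner_a l) in let D := circle_of v (corner_d l) in
  [/\ A != D, A :|: D \notin circles v &
      circles (toggle v l) = (A :|: D) |: (circles v :\ A :\ D)].
Proof.
move=> nad A D.
have big p : touched v l p -> circle_of (toggle v l) p = A :|: D.
  move=> tp; apply/setP => q; rewrite finset.in_setU !mem_circle_of same_circle_toggle// tp /=.
  rewrite -/(touched v l q); apply/orP/idP => [[pq|//]|tq]; last by right.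
  move: tp; rewrite /touched => /orP[/same_circle_trans/(_ pq) ->//|].
  by move=> /same_circle_trans/(_ pq) ->; rewrite orbT.
have small p : ~~ touched v l p -> circle_of (toggle v l) p = circle_of v p.
  move=> tp; apply/setP => q; rewrite !mem_circle_of same_circle_toggle//.
  by rewrite (negPf tp) orbF.
split; first by rewrite eq_circle_of.
  apply/circlesP => -[p /setP e].
  have := e (corner_a l); have := e (corner_d l).
  rewrite !inE !same_circle_refl orbT /= => /esym pd /esym pa.
  by case/negP: nad; apply: same_circle_trans pd; rewrite same_circle_sym.
apply/setP => C; rewrite !inE; apply/circlesP/idP => [[p ->]|].
  have [tp|tp] := boolP (touched v l p); first by rewrite big ?eqxx.
  rewrite small// circle_of_in andbT !eq_circle_of ![same_circle v p _]same_circle_sym.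
  by move: tp; rewrite /touched negb_or => /andP[-> ->]; rewrite orbT.
move=> /orP[/eqP ->|/and3P[nD nA /circlesP[p CE]]].
  by exists (corner_a l); rewrite big// /touched same_circle_refl.
exists p; rewrite small ?CE//.
move: nD nA; rewrite CE !eq_circle_of /touched ![same_circle v p _]same_circle_sym.
by move=> /negPf -> /negPf ->.
Qed.

(** The identity serves for a merge and, with the two smoothings exchanged, for a split. *)
Lemma sum_circles_toggle v l (F : {set point} -> int) :
  ~~ same_circle v (corner_a l) (corner_d l) ->
  let A := circle_of v (corner_a l) in let D := circle_of v (corner_d l) in
  \sum_(C in circles (toggle v l)) F C + F A + F D =
  \sum_(C in circles v) F C + F (A :|: D).
Proof.
move=> nad A D; have [AD nU ->] := circles_toggle nad.
rewrite -/A -/D in AD nU *.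
rewrite big_setU1 /=; last by rewrite !inE (negPf nU) !andbF.
rewrite [in RHS](big_setD1 A) ?circle_of_in//=.
rewrite [in RHS](big_setD1 D) /=; last by rewrite !inE eq_sym AD circle_of_in.
by ring.
Qed.

Lemma card_circles_toggle v l : ~~ same_circle v (corner_a l) (corner_d l) ->
  #|circles v| = #|circles (toggle v l)|.+1.
Proof.
move=> /(sum_circles_toggle (fun=> 1)) /=.
rewrite !sumr_const => e; apply/eqP; rewrite -eqz_nat; apply/eqP.
move: e; rewrite !natz; move: #|circles v| #|circles (toggle v l)| => a b.
by rewrite -!PoszD => -[e]; congr Posz; lia.
Qed.

End Surgery.

(** * The gradings along an edge of the cube *)

Section Gradings.
Variables (n : nat) (w : braid_word n).
Local Notation point := (diagram_point w).
Local Notation slab := 'I_(size w).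
Implicit Types (v : vertex w) (l m : slab) (p q z : point) (x y : state w).

Definition label_value (b : bool) : int := if b then 1 else -1.

Lemma labelled_eq x p q : is_labelled_resolution x -> same_circle x.1 p q -> x.2 p = x.2 q.
Proof. by move=> /forallP/(_ p)/forallP/(_ q)/implyP h /h /eqP. Qed.

Lemma label_sign_circle x p : is_labelled_resolution x ->
  label_sign x (circle_of x.1 p) = label_value (x.2 p).
Proof.
move=> lx; rewrite /label_sign /label_value; congr (if _ then _ else _).
apply/forallP/idP => [/(_ p)|xp q]; first by rewrite mem_circle_of same_circle_refl.
by apply/implyP; rewrite mem_circle_of => /(labelled_eq lx) <-.
Qed.

(** Common form of [deg], where [f] is always true, and of [kgrading], where it is [essential]. *)
Definition graded_sum (f : pred {set point}) x : int :=
  \sum_(C in circles x.1 | f C) label_sign x C.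

Lemma graded_sum_join (f : pred {set point}) x y l :
  is_labelled_resolution x -> is_labelled_resolution y ->
  y.1 = toggle x.1 l ->
  (forall p, ~~ touched x.1 l p -> y.2 p = x.2 p) ->
  ~~ same_circle x.1 (corner_a l) (corner_d l) ->
  let A := circle_of x.1 (corner_a l) in let D := circle_of x.1 (corner_d l) in
  graded_sum f y + (f A)%:R * label_value (x.2 (corner_a l))
    + (f D)%:R * label_value (x.2 (corner_d l)) =
  graded_sum f x + (f (A :|: D))%:R * label_value (y.2 (corner_a l)).
Proof.
move=> lx ly yE agree nad A D.
(* One function for both sums: the merged circle is read in [y] and all others in [x]; on untouched
   circles the two labellings agree. *)
pose F C := if f C then if C == A :|: D then label_sign y C else label_sign x C else 0.
have [AD nU E] := circles_toggle nad; rewrite -/A -/D in AD nU E.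
have Fx p : circle_of x.1 p != A :|: D.
  by apply: contraNneq nU => <-; exact: circle_of_in.
have UE : A :|: D = circle_of y.1 (corner_a l).
  apply/setP => q; rewrite finset.in_setU !mem_circle_of yE same_circle_toggle//.
  have -> : touched x.1 l (corner_a l) by rewrite /touched same_circle_refl.
  by rewrite /touched; case: (same_circle x.1 (corner_a l) q).
have ifE (b : bool) (t : int) : (if b then t else 0) = b%:R * t.
  by case: b; rewrite ?mul1r ?mul0r.
have FA : F A = (f A)%:R * label_value (x.2 (corner_a l)).
  by rewrite /F (negPf (Fx _)) (label_sign_circle _ lx) ifE.
have FD : F D = (f D)%:R * label_value (x.2 (corner_d l)).
  by rewrite /F (negPf (Fx _)) (label_sign_circle _ lx) ifE.
have FU : F (A :|: D) = (f (A :|: D))%:R * label_value (y.2 (corner_a l)).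
  by rewrite /F eqxx ifE; congr (_ * _); rewrite UE (label_sign_circle _ ly).
have := sum_circles_toggle F nad; rewrite -/A -/D /= FA FD FU.
have -> : \sum_(C in circles (toggle x.1 l)) F C = graded_sum f y.
  rewrite /graded_sum big_mkcondr /= yE; apply: eq_bigr => C.
  rewrite E !inE /F => /orP[/eqP ->|]; first by rewrite eqxx.
  move=> /and3P[CD CA /circlesP[p Cp]]; case: ifP => // _.
  case: (eqVneq C (A :|: D)) => [//|_].
  have ag q : q \in C -> y.2 q = x.2 q; last first.
    rewrite /label_sign; congr (if _ then _ else _).
    by apply/forallP/forallP => h q; apply/implyP => qC;
      have := implyP (h q) qC; rewrite ag.
  move=> qC; rewrite agree// /touched negb_or; move: qC CD CA; rewrite Cp mem_circle_of !eq_circle_of.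
  move=> pq nd na; apply/andP; split; [apply: contra na|apply: contra nd] => h;
    by rewrite same_circle_sym (same_circle_trans h)// same_circle_sym.
have -> : \sum_(C in circles x.1) F C = graded_sum f x.
  rewrite /graded_sum big_mkcondr /=; apply: eq_bigr => C /circlesP[p ->].
  by rewrite /F (negPf (Fx p)).
by [].
Qed.

Lemma degE x : deg x = graded_sum predT x.
Proof. by rewrite /deg /graded_sum; apply: eq_bigl => C; rewrite andbT. Qed.

Lemma kgradingE x : kgrading x = graded_sum (@essential n w) x.
Proof. by []. Qed.

Lemma winding_join v l : ~~ same_circle v (corner_a l) (corner_d l) ->
  let A := circle_of v (corner_a l) in let D := circle_of v (corner_d l) in
  winding (A :|: D) = winding A + winding D.
Proof.
move=> nad A D; rewrite /winding big_mkcond [X in _ = X + _]big_mkcond [X in _ = _ + X]big_mkcond.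
rewrite -big_split /=.
apply: eq_bigr => p _; rewrite finset.in_setU.
have : ~~ (((ord_max, p) \in A) && ((ord_max, p) \in D)).
  rewrite !mem_circle_of; apply: contra nad => /andP[h1 h2].
  by rewrite same_circle_sym in h2; exact: same_circle_trans h1 h2.
by case: (_ \in A); case: (_ \in D) => //= _; rewrite ?addr0 ?add0r.
Qed.

Lemma edge_toggle x y l : edge_coef x y l ->
  [/\ x.1 l = false, y.1 = toggle x.1 l,
      forall p, ~~ touched x.1 l p -> y.2 p = x.2 p &
      if same_circle x.1 (corner_a l) (corner_d l)
      then split_coef (x.2 (corner_a l)) (y.2 (corner_a l)) (y.2 (corner_d l))
      else merge_coef (x.2 (corner_a l)) (x.2 (corner_d l)) (y.2 (corner_a l))].
Proof.
move=> /and4P[xl /forallP yE /forallP agree c]; split => //.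
- exact: negbTE.
- apply/ffunP => m; rewrite ffunE (eqP (yE m)).
  by case: eqVneq => [->|//]; rewrite (negPf xl).
- by move=> p; rewrite /touched negb_or => h; apply/eqP; exact: (implyP (agree p) h).
Qed.

Lemma weight_toggle v l : v l = false -> weight (toggle v l) = (weight v).+1.
Proof.
move=> vl; rewrite /weight (cardD1 l) [X in (X + _)%N](_ : _ = 1%N); last first.
  by rewrite !inE ffunE eqxx vl.
congr S; apply: eq_card => m; rewrite !inE ffunE.
by case: eqVneq => [->|//]; rewrite vl.
Qed.

Section Edge.
Variables (x y : state w) (l : slab).
Hypotheses (lx : is_labelled_resolution x) (ly : is_labelled_resolution y).
Hypothesis xy : edge_coef x y l.

Let sum_join f := @graded_sum_join f x y l lx ly.

(** A split is a join from [y] to [x], because toggling twice is the identity. *)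
Let sum_split (f : pred {set point}) :
  same_circle x.1 (corner_a l) (corner_d l) ->
  let A := circle_of y.1 (corner_a l) in let D := circle_of y.1 (corner_d l) in
  graded_sum f x + (f A)%:R * label_value (y.2 (corner_a l))
    + (f D)%:R * label_value (y.2 (corner_d l)) =
  graded_sum f y + (f (A :|: D))%:R * label_value (x.2 (corner_a l)) /\
  winding (A :|: D) = winding A + winding D.
Proof.
move=> ad; have [_ yE agree _] := edge_toggle xy.
have nad : ~~ same_circle y.1 (corner_a l) (corner_d l).
  by rewrite yE same_corners_toggle ad.
split; last exact: winding_join.
apply: graded_sum_join => //; first by rewrite yE toggleK.
by move=> p; rewrite yE touched_toggle => /agree ->.
Qed.

Lemma edge_deg : deg y = deg x - 1.
Proof.
have [_ yE agree] := edge_toggle xy; rewrite !degE.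
case: ifP => [ad|/negbT nad].
  have yad : x.2 (corner_a l) = x.2 (corner_d l) by exact: labelled_eq.
  have [/= + _] := sum_split predT ad.
  rewrite !mul1r; move: (graded_sum _ _) (graded_sum _ _) => a b.
  by case: (x.2 _); case: (y.2 (corner_a l)); case: (y.2 (corner_d l)) => //=;
    rewrite /label_value => e _; lia.
have /= := sum_join predT yE agree nad.
rewrite /= !mul1r; move: (graded_sum _ _) (graded_sum _ _) => a b.
by case: (x.2 (corner_a l)); case: (x.2 (corner_d l)); case: (y.2 _) => //=;
  rewrite /label_value => e _; lia.
Qed.

Lemma edge_hgrading : hgrading y = hgrading x + 1.
Proof.
have [xl yE _ _] := edge_toggle xy.
by rewrite /hgrading yE weight_toggle// -addn1 PoszD; ring.
Qed.

Lemma edge_qgrading : qgrading y = qgrading x.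
Proof.
have [xl yE _ _] := edge_toggle xy.
by rewrite /qgrading edge_deg yE weight_toggle// -addn1 PoszD; ring.
Qed.

(** Two nonzero windings can only be opposite, since a sum of modulus 2 is excluded. *)
Lemma essential_add (a b : int) : `|a| <= 1 -> `|b| <= 1 -> `|a + b| <= 1 ->
  (a + b != 0) = (a != 0) (+) (b != 0).
Proof. by move=> a1 b1 ab; case: (eqVneq a 0) => a0; case: (eqVneq b 0) => b0 /=; lia. Qed.

(** The merged circle is essential when exactly one of the two parts is. Given this parity, each
    labelling allowed by a merge or a split keeps [k] or lowers it. *)
Lemma edge_kgrading :
  (forall v (C : {set point}), C \in circles v -> `|winding C| <= 1) ->
  kgrading y <= kgrading x.
Proof.
move=> bound; have [_ yE agree] := edge_toggle xy; rewrite !kgradingE.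
have ess v (v' : vertex w) : v' = toggle v l -> ~~ same_circle v (corner_a l) (corner_d l) ->
    let A := circle_of v (corner_a l) in let D := circle_of v (corner_d l) in
    essential (A :|: D) = essential A (+) essential D.
  move=> v'E nad A D; have wU := winding_join nad; rewrite -/A -/D in wU.
  have bU : `|winding A + winding D| <= 1.
    rewrite -wU; apply: (bound v'); have [_ _] := circles_toggle nad.
    by rewrite v'E => ->; rewrite !inE eqxx.
  by rewrite /essential wU essential_add//; apply: (bound v); exact: circle_of_in.
case: ifP => [ad|/negbT nad].
  have nad : ~~ same_circle y.1 (corner_a l) (corner_d l).
    by rewrite yE same_corners_toggle ad.
  have [/= + _] := sum_split (@essential n w) ad.
  rewrite (ess y.1 x.1) //; last by rewrite yE toggleK.
  move: (graded_sum _ _) (graded_sum _ _) => a b.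
  by case: (x.2 _); case: (y.2 (corner_a l)); case: (y.2 (corner_d l)) => //=;
    case: (essential _); case: (essential _) => /=; rewrite /label_value => e _; lia.
have /= := sum_join (@essential n w) yE agree nad.
rewrite (ess x.1 y.1) //; move: (graded_sum _ _) (graded_sum _ _) => a b.
by case: (x.2 (corner_a l)); case: (x.2 (corner_d l)); case: (y.2 _) => //=;
  case: (essential _); case: (essential _) => /=; rewrite /label_value => e _; lia.
Qed.

End Edge.

End Gradings.

(** * The square of the annular differential *)

Lemma F2_addrr (t : 'F_2) : t + t = 0.
Proof. by apply: val_inj; case: t => [[|[|[]]]]. Qed.

Section SquareZero.
Variables (n : nat) (w : braid_word n).
Local Notation point := (diagram_point w).
Local Notation slab := 'I_(size w).
Implicit Types (v : vertex w) (l m : slab) (p q z : point) (x y : state w).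
Implicit Types (s : seq point).

(* Write X_p for the label v_- of the circle through p: the state [y] is the
   image, in the truncated polynomial ring of its vertex, of the product of the
   X_p for p in [s]. *)
Definition monomial s y : bool := [forall p, count (same_circle y.1 p) s == ~~ y.2 p].

Lemma monomialP s y :
  reflect (forall p, count (same_circle y.1 p) s = ~~ y.2 p) (monomial s y).
Proof. by apply: (iffP forallP) => h p; apply/eqP; apply: h. Qed.

Lemma monomial_labelled s y : monomial s y -> is_labelled_resolution y.
Proof.
move=> /monomialP h; apply/forallP => p; apply/forallP => q; apply/implyP => pq.
have := h p; rewrite (eq_count (same_circle_equiv pq)) h.
by case: (y.2 p); case: (y.2 q).
Qed.

(** One variable for each circle labelled v_-, at the point chosen by [fingraph.root]. *)
Lemma monomial_exists x : is_labelled_resolution x -> exists s, monomial s x.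
Proof.
move=> lx; pose e := Defs.adjacent x.1.
have cs : connect_sym e by move=> p q; exact: (same_circle_sym x.1).
exists [seq p <- enum {: point} | (fingraph.root e p == p) && ~~ x.2 p].
apply/monomialP => p; rewrite count_filter.
rewrite (@eq_count _ _ (fun q => (q == fingraph.root e p) && ~~ x.2 p)); last first.
  move=> q /=; apply/idP/idP.
    move=> /and3P[pq /eqP rq nq].
    by rewrite (labelled_eq lx pq) nq andbT -rq (fingraph.rootP cs pq).
  move=> /andP[/eqP -> nq].
  have pr : same_circle x.1 p (fingraph.root e p) by exact: connect_root.
  by rewrite pr root_root// eqxx /= -(labelled_eq lx pr).
case: (x.2 p) => /=; first by rewrite (eq_count (a2 := pred0)) ?count_pred0// => q; rewrite andbF.
rewrite (eq_count (a2 := pred1 (fingraph.root e p))); last by move=> q; rewrite andbT.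
by rewrite count_uniq_mem ?enum_uniq// mem_enum.
Qed.

Lemma monomial_eq s x y : x.1 = y.1 -> monomial s x -> monomial s y -> x = y.
Proof.
case: x y => [v f] [v' g] /= <- /monomialP hf /monomialP hg; congr pair.
apply/ffunP => p; have := hf p; rewrite hg /=.
by case: (f p); case: (g p).
Qed.

Lemma monomial_swap s p q y : monomial (p :: q :: s) y = monomial (q :: p :: s) y.
Proof. by apply: eq_forallb => z; rewrite /= addnCA. Qed.

Lemma monomial_same s p q y : same_circle y.1 p q -> monomial (p :: s) y = monomial (q :: s) y.
Proof.
move=> pq; apply: eq_forallb => z /=; congr (nat_of_bool _ + _ == _)%N.
by rewrite ![same_circle _ z _]same_circle_sym (same_circle_equiv pq).
Qed.

Lemma count_touched v l s : ~~ same_circle v (corner_a l) (corner_d l) ->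
  count (touched v l) s =
  (count (same_circle v (corner_a l)) s + count (same_circle v (corner_d l)) s)%N.
Proof.
move=> nad; rewrite -[RHS]count_predUI [X in (_ + X)%N](@eq_count _ _ pred0) ?count_pred0 ?addn0//.
move=> q /=; apply/negP => /andP[aq dq]; case/negP: nad.
by rewrite same_circle_sym in dq; exact: same_circle_trans aq dq.
Qed.

Lemma count_toggle v l s p : ~~ same_circle v (corner_a l) (corner_d l) ->
  count (same_circle (toggle v l) p) s =
  if touched v l p then
    (count (same_circle v (corner_a l)) s + count (same_circle v (corner_d l)) s)%N
  else count (same_circle v p) s.
Proof.
move=> nad; rewrite -count_touched//; case: ifP => tp; apply: eq_count => q;
  rewrite same_circle_toggle// tp ?orbF//=.
case: (boolP (touched v l q)) => [_|]; first by rewrite orbT.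
rewrite orbF; apply: contraNF => pq; move: tp; rewrite /touched.
by case/orP => h; rewrite (same_circle_trans h pq) ?orbT.
Qed.

Lemma monomial_corners v l s y : y.1 = v -> is_labelled_resolution y ->
  monomial s y =
  [&& [forall p, ~~ touched v l p ==> (count (same_circle v p) s == ~~ y.2 p)],
      count (same_circle v (corner_a l)) s == ~~ y.2 (corner_a l) &
      count (same_circle v (corner_d l)) s == ~~ y.2 (corner_d l)].
Proof.
move=> <- ly; apply/monomialP/and3P => [h|[/forallP h /eqP ha /eqP hd] p].
  by split; rewrite ?h//; apply/forallP => p; rewrite h eqxx implybT.
have [|tp] := boolP (touched y.1 l p); last by apply/eqP; exact: (implyP (h p)).
by case/orP => ap; rewrite -(eq_count (same_circle_equiv ap)) -(labelled_eq ly ap).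
Qed.

(** The edge map on polynomials: a merge identifies two variables, a split multiplies by the sum of
    the variables of the new circles. A monomial with a repeated variable belongs to no state, which
    is the relation X^2 = 0. *)
Definition edge_image v l s y : 'F_2 :=
  if same_circle v (corner_a l) (corner_d l)
  then (monomial (corner_a l :: s) y)%:R + (monomial (corner_d l :: s) y)%:R
  else (monomial s y)%:R.

Lemma F2_xor (a b : bool) : a%:R + b%:R = (a (+) b)%:R :> 'F_2.
Proof. by case: a; case: b; apply: val_inj. Qed.

Lemma edge_coef_monomial s x y l : monomial s x -> is_labelled_resolution y ->
  x.1 l = false -> y.1 = toggle x.1 l ->
  (edge_coef x y l)%:R = edge_image x.1 l s y.
Proof.
move=> sx ly xl yE; have lx := monomial_labelled sx.
have /monomialP cx := sx.
have -> : edge_coef x y l =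
    [forall p, ~~ touched x.1 l p ==> (y.2 p == x.2 p)] &&
    (if same_circle x.1 (corner_a l) (corner_d l)
      then split_coef (x.2 (corner_a l)) (y.2 (corner_a l)) (y.2 (corner_d l))
      else merge_coef (x.2 (corner_a l)) (x.2 (corner_d l)) (y.2 (corner_a l))).
  have ytog : [forall m, y.1 m == ((m == l) || x.1 m)].
    apply/forallP => m; rewrite yE ffunE; case: (eqVneq m l) => [->|//].
    by rewrite xl.
  rewrite /edge_coef xl ytog /=.
  by congr (_ && _); apply: eq_forallb => p; rewrite /touched negb_or.
rewrite /edge_image; case: ifP => [ad|/negbT nad].
  have nad : ~~ same_circle y.1 (corner_a l) (corner_d l).
    by rewrite yE same_corners_toggle ad.
  have xE : x.1 = toggle y.1 l by rewrite yE toggleK.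
  have nda : ~~ same_circle y.1 (corner_d l) (corner_a l) by rewrite same_circle_sym.
  have := cx (corner_a l); rewrite xE count_toggle//.
  rewrite {1}/touched same_circle_refl /= => cA.
  rewrite F2_xor !(monomial_corners l _ erefl ly) /= !same_circle_refl.
  rewrite (negPf nad) (negPf nda) !add0n !add1n.
  have rest r : touched y.1 l r ->
      [forall p, ~~ touched y.1 l p ==>
        ((same_circle y.1 p r + count (same_circle y.1 p) s)%N == ~~ y.2 p)] =
      [forall p, ~~ touched (toggle y.1 l) l p ==> (y.2 p == x.2 p)].
    move=> tr; apply: eq_forallb => p; rewrite touched_toggle.
    case: (boolP (touched y.1 l p)) => //= np.
    rewrite (_ : same_circle _ p r = false) /=; last first.
      apply: contraNF np => pr; rewrite same_circle_sym in pr.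
      by case/orP: tr => h; rewrite /touched (same_circle_trans h pr) ?orbT.
    have := cx p; rewrite xE count_toggle// (negPf np) => ->.
    by case: (x.2 p); case: (y.2 p).
  rewrite !rest /touched ?same_circle_refl ?orbT//.
  case: [forall p, _] => //=.
  move: cA; move: (count _ _) (count _ _) => A D.
  by case: (x.2 _); case: (y.2 _); case: (y.2 _); case: A => [|[|A]]; case: D => [|[|D]].
rewrite (monomial_corners l _ yE ly) !(count_toggle s _ nad).
rewrite {3 4}/touched !same_circle_refl orbT /=.
have -> : [forall p, ~~ touched (toggle x.1 l) l p ==>
    (count (same_circle (toggle x.1 l) p) s == ~~ y.2 p)] =
  [forall p, ~~ touched x.1 l p ==> (y.2 p == x.2 p)].
  apply: eq_forallb => p; rewrite touched_toggle (count_toggle s p nad).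
  case: (boolP (touched x.1 l p)) => //= _; rewrite cx.
  by case: (x.2 p); case: (y.2 p).
congr ((_ && _)%:R); rewrite !cx.
have -> : y.2 (corner_d l) = y.2 (corner_a l).
  apply: (labelled_eq ly); rewrite yE same_circle_sym same_corners_toggle; exact: nad.
by case: (x.2 _); case: (x.2 _); case: (y.2 _).
Qed.

Lemma monomial_count s y p : monomial s y -> (count (same_circle y.1 p) s <= 1)%N.
Proof. by move=> /monomialP ->; case: (y.2 p). Qed.

(** If the monomial is nonzero at [v], it is a single state and [edge_coef_monomial] applies; if it
    is zero there, its image has to be zero as well. *)
Lemma edge_image_sum v m s (z : state w) : v m = false -> z.1 = toggle v m ->
  is_labelled_resolution z ->
  \sum_(y : state w | is_labelled_resolution y && (y.1 == v))
     (monomial s y)%:R * (edge_coef y z m)%:R = edge_image v m s z.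
Proof.
move=> vm zE lz.
have [/existsP[y /andP[/eqP yv sy]]|none] := boolP [exists y : state w, (y.1 == v) && monomial s y].
  rewrite (bigD1 y) /=; last by rewrite (monomial_labelled sy) yv eqxx.
  rewrite sy mul1r big1 ?addr0; last first.
    move=> y' /andP[/andP[_ /eqP y'v] ny]; case: (boolP (monomial s y')) => sy'; last by rewrite mul0r.
    by case/eqP: ny; apply: (@monomial_eq s); rewrite ?y'v.
  by rewrite -yv; apply: edge_coef_monomial; rewrite ?yv.
rewrite big1; last first.
  move=> y /andP[_ /eqP yv]; case: (boolP (monomial s y)) => sy; last by rewrite mul0r.
  by case/existsP: none; exists y; rewrite yv eqxx.
(* The monomial is zero at [v] because some circle carries two of its variables. *)
have [p cp] : exists p, (1 < count (same_circle v p) s)%N.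
  apply/existsP; apply: contraNT none => /existsPn h.
  apply/existsP; exists (v, [ffun p => count (same_circle v p) s == 0%N]).
  rewrite eqxx; apply/monomialP => p /=; rewrite ffunE.
  by have := h p; rewrite -leqNgt; case: (count _ s) => [|[|]].
rewrite /edge_image; case: ifP => [ad|/negbT nad].
  have nad : ~~ same_circle z.1 (corner_a m) (corner_d m).
    by rewrite zE same_corners_toggle ad.
  have vE : v = toggle z.1 m by rewrite zE toggleK.
  move: cp; rewrite vE count_toggle//.
  have nda : ~~ same_circle z.1 (corner_d m) (corner_a m) by rewrite same_circle_sym.
  case: ifP => tp cp.
    (* This circle splits. If the half receiving the new variable is to carry only one, it carried
       none before, and then the other half carries two. *)
    have -> : monomial (corner_a m :: s) z = false.
      apply/negP => h; have := monomial_count (corner_a m) h.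
      have := monomial_count (corner_d m) h.
      rewrite /= same_circle_refl (negPf nda) add0n add1n ltnS leqn0 => h1 /eqP h2.
      by move: cp; rewrite h2 add0n ltnNge h1.
    suff -> : monomial (corner_d m :: s) z = false by rewrite addr0.
    apply/negP => h; have := monomial_count (corner_d m) h.
    have := monomial_count (corner_a m) h.
    rewrite /= same_circle_refl (negPf nad) add0n add1n ltnS leqn0 => h1 /eqP h2.
    by move: cp; rewrite h2 addn0 ltnNge h1.
  have no r : monomial (r :: s) z = false.
    apply/negP => /(monomial_count p) /=.
    by rewrite leqNgt (leq_trans cp)// leq_addl.
  by rewrite !no addr0.
rewrite (_ : monomial s z = false)//; apply/negP => /(monomial_count p).
rewrite zE count_toggle//; case: ifP => tp; last by rewrite leqNgt cp.
rewrite leqNgt -count_touched// (leq_trans cp)//; apply: sub_count => q pq.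
move: tp; rewrite /touched => /orP[] h; by rewrite (same_circle_trans h pq) ?orbT.
Qed.

Lemma toggleC v l m : toggle (toggle v l) m = toggle (toggle v m) l.
Proof.
have [->//|lm] := eqVneq l m; have ml : (m == l) = false by rewrite eq_sym (negPf lm).
apply/ffunP => k; rewrite !ffunE (negPf lm) ml.
by have [->|km] := eqVneq k m; rewrite ?ml.
Qed.

(* The coefficient of [z] after the edge maps at [l], then at [m]. *)
Definition face_image v l m s (z : state w) : 'F_2 :=
  if same_circle v (corner_a l) (corner_d l)
  then edge_image (toggle v l) m (corner_a l :: s) z +
       edge_image (toggle v l) m (corner_d l :: s) z
  else edge_image (toggle v l) m s z.

Lemma card_circles_split v l :
  (#|circles (toggle v l)| + ~~ same_circle v (corner_a l) (corner_d l) =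
   #|circles v| + same_circle v (corner_a l) (corner_d l))%N.
Proof.
have [h|h] := boolP (same_circle v (corner_a l) (corner_d l)); last first.
  by rewrite addn1 addn0 (card_circles_toggle h).
have h' : ~~ same_circle (toggle v l) (corner_a l) (corner_d l).
  by rewrite same_corners_toggle h.
by rewrite addn0 addn1 (card_circles_toggle h') toggleK.
Qed.

(** Counting circles at the corners of the square shows that both paths contain the same number of
    splits. Six of the sixteen cases remain, and three of them are identities. *)
Lemma face_image_sym v l m s (z : state w) : z.1 = toggle (toggle v l) m ->
  face_image v l m s z = face_image v m l s z.
Proof.
move=> zE; have zE' : z.1 = toggle (toggle v m) l by rewrite toggleC.
have c1 := card_circles_split v l; have c2 := card_circles_split (toggle v l) m.
have c3 := card_circles_split v m; have c4 := card_circles_split (toggle v m) l.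
rewrite -zE in c2; rewrite -zE' in c4.
have sl : same_circle z.1 (corner_a l) (corner_d l) =
    ~~ same_circle (toggle v m) (corner_a l) (corner_d l).
  by rewrite zE' same_corners_toggle.
have sm : same_circle z.1 (corner_a m) (corner_d m) =
    ~~ same_circle (toggle v l) (corner_a m) (corner_d m).
  by rewrite zE same_corners_toggle.
have sm' : same_circle (toggle v m) (corner_a m) (corner_d m) =
    ~~ same_circle v (corner_a m) (corner_d m).
  exact: same_corners_toggle.
rewrite /face_image /edge_image.
move: c1 c2 c3 c4 sl sm sm'.
case: (boolP (same_circle v (corner_a l) (corner_d l))) => _;
case: (boolP (same_circle (toggle v l) (corner_a m) (corner_d m))) => nm;
case: (boolP (same_circle v (corner_a m) (corner_d m))) => _;
case: (boolP (same_circle (toggle v m) (corner_a l) (corner_d l))) => nl /=;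
  move=> c1 c2 c3 c4 sl sm sm'; try (exfalso; lia); try by [].
- rewrite (monomial_swap _ (corner_a m)) (monomial_swap _ (corner_d m)).
  rewrite (monomial_swap _ (corner_a m) (corner_d l)) (monomial_swap _ (corner_d m) (corner_d l)).
  by ring.
(* Both paths split and then merge: in [z] the two new variables are equal, so each sum cancels
   modulo 2. *)
- by rewrite (monomial_same _ sl) (monomial_same s sm) !F2_addrr.
(* Both paths merge and then split. Merging at [l] in [z] joins the corners of [m], so the two
   circles through these corners are those through the corners of [l], in one order or the other. *)
- have split q : same_circle (toggle v m) (corner_a m) (corner_d m) by rewrite sm'.
  have vmE : toggle v m = toggle z.1 l by rewrite zE' toggleK.
  have nad : ~~ same_circle z.1 (corner_a l) (corner_d l) by rewrite sl.
  move: sm'; rewrite vmE same_circle_toggle// sm /= => /andP[].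
  rewrite /touched => /orP[] h1 /orP[] h2.
  + by move: sm; rewrite (same_circle_trans _ h2)// same_circle_sym.
  + by rewrite (monomial_same _ h1) (monomial_same _ h2).
  + by rewrite (monomial_same _ h1) (monomial_same _ h2) addrC.
  + by move: sm; rewrite (same_circle_trans _ h2)// same_circle_sym.
Qed.

End SquareZero.

Lemma F2_sum_symmetric (I : finType) (S : I -> I -> 'F_2) :
  (forall i, S i i = 0) -> (forall i j, S i j = S j i) -> \sum_i \sum_j S i j = 0.
Proof.
move=> S0 SC; have -> : \sum_i \sum_j S i j = \sum_(i : I) \sum_(j | (enum_rank i < enum_rank j)%N)
    (S i j + S j i).
  under eq_bigr => i _.
    rewrite (bigID (fun j => enum_rank i < enum_rank j)%N) /=.
    rewrite [X in _ + X](bigD1 i) /= ?ltnn// S0 add0r.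
    rewrite [X in _ + X](eq_bigl (fun j => enum_rank j < enum_rank i)%N); last first.
      move=> j /=. rewrite -leqNgt ltn_neqAle andbC; congr (_ && _).
      by rewrite -(inj_eq enum_rank_inj) -val_eqE.
    over.
  rewrite big_split /= [X in _ + X](exchange_big_dep predT)//= -big_split /=.
  by apply: eq_bigr => i _; rewrite -big_split.
by rewrite big1 // => i _; rewrite big1// => j _; rewrite SC F2_addrr.
Qed.

Section Differential.
Variables (n : nat) (w : braid_word n).
Local Notation point := (diagram_point w).
Local Notation slab := 'I_(size w).
Implicit Types (v : vertex w) (l m : slab) (x y z : state w).

Lemma khovanov_coefE x y : (khovanov_coef x y)%:R = \sum_l (edge_coef x y l)%:R :> 'F_2.
Proof.
rewrite /khovanov_coef; case: (boolP [exists l, edge_coef x y l]) => [/existsP[l xy]|/existsPn h].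
  rewrite (bigD1 l)//= xy big1 ?addr0// => m ml.
  case: (boolP (edge_coef x y m)) => // xy'; exfalso.
  have [xl yl _ _] := edge_toggle xy; have [xm ym _ _] := edge_toggle xy'.
  have /ffunP/(_ m) : toggle x.1 l = toggle x.1 m by rewrite -yl.
  by rewrite !ffunE eqxx (negPf ml); case: (x.1 m).
by rewrite big1// => l _; rewrite (negPf (h l)).
Qed.

(** The contribution of an ordered pair of crossings is symmetric in the pair and zero on the
    diagonal, so the sum vanishes in characteristic 2. *)
Lemma khovanov_square x z : is_labelled_resolution x -> is_labelled_resolution z ->
  \sum_(y : state w | is_labelled_resolution y)
    (khovanov_coef x y)%:R * (khovanov_coef y z)%:R = 0 :> 'F_2.
Proof.
move=> lx lz; have [s sx] := monomial_exists lx.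
pose S l m : 'F_2 := \sum_(y : state w | is_labelled_resolution y)
  (edge_coef x y l)%:R * (edge_coef y z m)%:R.
transitivity (\sum_l \sum_m S l m).
  rewrite /S; under [RHS]eq_bigr => l _ do rewrite exchange_big /=.
  rewrite exchange_big /=; apply: eq_bigr => y _.
  rewrite !khovanov_coefE big_distrl /=; apply: eq_bigr => l _.
  by rewrite big_distrr.
have S_face l m : l != m -> x.1 l = false -> x.1 m = false ->
    z.1 = toggle (toggle x.1 l) m -> S l m = face_image x.1 l m s z.
  move=> lm xl xm zE.
  have tm : toggle x.1 l m = false by rewrite ffunE eq_sym (negPf lm).
  have ext r := edge_image_sum r tm zE lz.
  have -> : S l m = \sum_(y : state w | is_labelled_resolution y && (y.1 == toggle x.1 l))
      edge_image x.1 l s y * (edge_coef y z m)%:R.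
    rewrite /S big_mkcondr /=; apply: eq_bigr => y ly.
    case: eqP => [yE|nyE]; first by rewrite (edge_coef_monomial sx).
    case: (boolP (edge_coef x y l)) => xy; last by rewrite mul0r.
    by have [_ yE _ _] := edge_toggle xy.
  rewrite /face_image /edge_image; case: ifP => ad; last exact: ext.
  rewrite -[in RHS]/(edge_image _ _ _ _) -[X in _ = _ + X]/(edge_image _ _ _ _).
  rewrite -!ext -big_split /=; apply: eq_bigr => y _.
  by rewrite mulrDl.
have S_zero l m : ~ [/\ l != m, x.1 l = false, x.1 m = false &
    z.1 = toggle (toggle x.1 l) m] -> S l m = 0.
  move=> h; rewrite /S big1// => y _.
  case: (boolP (edge_coef x y l)) => xy; last by rewrite mul0r.
  case: (boolP (edge_coef y z m)) => yz; last by rewrite mulr0.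
  have [xl yE _ _] := edge_toggle xy; have [ym zE _ _] := edge_toggle yz.
  case: h; have lm : l != m by apply: contra_eqN ym => /eqP <-; rewrite yE ffunE eqxx xl.
  split=> //; last by rewrite zE yE.
  by move: ym; rewrite yE ffunE eq_sym (negPf lm).
apply: F2_sum_symmetric => [l|l m].
  by apply: S_zero => -[]; rewrite eqxx.
have [/and4P[lm /eqP xl /eqP xm /eqP zE]|h] :=
  boolP [&& l != m, x.1 l == false, x.1 m == false & z.1 == toggle (toggle x.1 l) m].
  have zE' : z.1 = toggle (toggle x.1 m) l by rewrite toggleC.
  have ml : m != l by rewrite eq_sym.
  by rewrite (S_face _ _ lm xl xm zE) (S_face _ _ ml xm xl zE'); exact: face_image_sym.
rewrite (S_zero l m) => [|[h1 h2 h3 h4]]; last first.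
  by case/negP: h; apply/and4P; split=> //; apply/eqP.
rewrite (S_zero m l) // => -[h1 h2 h3 h4]; case/negP: h.
by apply/and4P; split; rewrite 1?eq_sym//; apply/eqP; rewrite // h4 toggleC.
Qed.

(** A property of one bidegree, because it has two sources: the winding bound for three strands, and
    the top annular degree for any number of strands. *)
Definition square_zero (j k : int) : Prop := forall i,
  annular_diff w i j k *m annular_diff w (i + 1) j k = 0.

(** No edge raises [k], so a path of two edges between states with the same [k] stays in this [k];
    the annular square is therefore a coefficient of the Khovanov square. *)
Lemma annular_square_zero (j k : int) :
  (forall v (C : {set point}), C \in circles v -> `|winding C| <= 1) ->
  square_zero j k.
Proof.
move=> bound i; apply/matrixP => r t; rewrite !mxE.
under eq_bigr => s _ do rewrite !mxE.
have /= := enum_valP r; have /= := enum_valP t.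
rewrite !inE; move: (enum_val r) (enum_val t) => x z.
rewrite -(big_enum_val (fun y => (khovanov_coef x y)%:R * (khovanov_coef y z)%:R)) /=.
move=> /and4P[lz /eqP hz /eqP qz /eqP kz] /and4P[lx /eqP hx /eqP qx /eqP kx].
rewrite -[RHS](khovanov_square lx lz) [RHS](bigID (mem (generators w (i + 1) j k))) /=.
rewrite [X in _ = _ + X]big1 ?addr0.
  by apply: eq_bigl => y; rewrite !inE; case: (is_labelled_resolution y).
move=> y /andP[ly]; rewrite inE ly /=.
rewrite /khovanov_coef.
case: (boolP [exists l, edge_coef x y l]) => [/existsP[l xy]|_]; last by rewrite mul0r.
case: (boolP [exists l, edge_coef y z l]) => [/existsP[m yz]|_]; last by rewrite mulr0.
rewrite (edge_hgrading xy) hx eqxx (edge_qgrading lx ly xy) qx eqxx /=.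
have := edge_kgrading lx ly xy bound; have := edge_kgrading ly lz yz bound.
by rewrite kz kx eq_le => -> ->.
Qed.

End Differential.

(** * The annular Jones polynomial as a state sum *)

Section EulerCharacteristic.
Variables (n : nat) (w : braid_word n).
Implicit Types (x : state w) (i j k : int).

Lemma signz_succ i : (-1 : int) ^ (i + 1) = - (-1) ^ i.
Proof. by rewrite exprzDr ?unitrN1// expr1z mulrN1. Qed.

Lemma weight_max x : (weight x.1 <= size w)%N.
Proof. by apply: leq_trans (max_card _) _; rewrite card_ord. Qed.

Section Degrees.
Variables (j k : int).
Hypothesis d2 : square_zero w j k.
Let g i := #|generators w i j k|.
Let r i := \rank (annular_diff w i j k).

Let rank_le i : (r (i - 1) + r i <= g i)%N.
Proof.
have h i0 : (r i0 + r (i0 + 1) <= g (i0 + 1))%N by exact: mulmx0_rank_max (d2 i0).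
by have := h (i - 1); rewrite subrK.
Qed.

Let dim_eq i : (dim_AKh w i j k)%:Z = (g i)%:Z - (r i)%:Z - (r (i - 1))%:Z.
Proof.
have := rank_le i; rewrite /dim_AKh mxrank_ker -/(g i) -/(r i) -/(r (i - 1)).
by move=> h; lia.
Qed.

Let rank_low : r (0%:Z - (n_minus w)%:Z - 1) = 0%N.
Proof.
apply/eqP; rewrite -leqn0; apply: leq_trans (rank_leq_row _) _.
rewrite leqn0 cards_eq0; apply/eqP/setP => x; rewrite !inE.
by apply/negP => /and4P[_ /eqP + _ _]; rewrite /hgrading; lia.
Qed.

Let rank_high : r ((size w)%:Z - (n_minus w)%:Z) = 0%N.
Proof.
apply/eqP; rewrite -leqn0; apply: leq_trans (rank_leq_col _) _.
rewrite leqn0 cards_eq0; apply/eqP/setP => x; rewrite !inE.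
apply/negP => /and4P[_ /eqP + _ _]; rewrite /hgrading.
by have := weight_max x; lia.
Qed.

(** Homology has dimension g(i) - r(i) - r(i - 1). With alternating signs the ranks telescope to
    those at the two ends of the complex, which are zero. *)
Lemma annular_jonesE :
  annular_jones w j k =
  \sum_(x : state w | [&& is_labelled_resolution x, qgrading x == j & kgrading x == k])
    (-1) ^ hgrading x.
Proof.
pose c := size w; pose e (m : nat) : int := m%:Z - (n_minus w)%:Z.
have eS m : e m.+1 = e m + 1 by rewrite /e -addn1 PoszD; ring.
have tele M : \sum_(m < M) (-1) ^ e m * ((r (e m))%:Z + (r (e m - 1))%:Z) =
    - ((-1) ^ e M * (r (e M - 1))%:Z).
  elim: M => [|M IH]; first by rewrite big_ord0 rank_low mulr0 oppr0.
  rewrite big_ord_recr /= IH eS signz_succ addrK.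
  by ring.
have -> : annular_jones w j k = \sum_(m < c.+1) (-1) ^ e m * (g (e m))%:Z -
    \sum_(m < c.+1) (-1) ^ e m * ((r (e m))%:Z + (r (e m - 1))%:Z).
  rewrite -sumrB; apply: eq_bigr => m _; rewrite dim_eq /e.
  by ring.
rewrite tele eS addrK rank_high mulr0 opprK addr0.
transitivity (\sum_(m < c.+1) \sum_(x in generators w (e m) j k) (-1 : int) ^ hgrading x).
  apply: eq_bigr => m _; rewrite (eq_bigr (fun=> (-1) ^ e m)).
    by rewrite sumr_const -mulr_natr natz.
  by move=> x; rewrite inE => /and4P[_ /eqP -> _ _].
rewrite (exchange_big_dep (fun x : state w =>
  [&& is_labelled_resolution x, qgrading x == j & kgrading x == k])) /=; last first.
  by move=> m x _; rewrite inE => /and4P[-> _ -> ->].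
apply: eq_bigr => x /and3P[lx qx kx].
have wx : (weight x.1 < c.+1)%N by rewrite ltnS weight_max.
rewrite (bigD1 (Ordinal wx)) /=; last by rewrite inE lx qx kx eqxx.
rewrite big1 ?addr0// => m /andP[]; rewrite inE => /and4P[_ /eqP hx _ _] /eqP.
by case; apply: val_inj; move: hx; rewrite /hgrading /e /=; lia.
Qed.

End Degrees.
End EulerCharacteristic.

(** * The top annular degree *)

Section TopDegree.
Variables (n : nat) (w : braid_word n).
Local Notation point := (diagram_point w).
Local Notation slab := 'I_(size w).
Implicit Types (v : vertex w) (l m : slab) (p q : 'I_n) (k : 'I_(size w).+1).
Implicit Types (x y : state w) (C : {set point}).

Definition winding_at k C : int := \sum_(p < n | (k, p) \in C) (-1) ^+ p.

Lemma adjacent_same v (z t : point) : Defs.adjacent v z t -> same_circle v z t.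
Proof. exact: connect1. Qed.

Lemma same_circle_vertical v l p : vertical v l || (p \notin [:: left_at l; right_at l]) ->
  same_circle v (lower_level l, p) (upper_level l, p).
Proof.
move=> h; apply/adjacent_same/(@slab_arc_adjacent _ _ _ l).
by rewrite /slab_arc /= h !eqxx.
Qed.

Lemma same_circle_turnback v l k : ~~ vertical v l ->
  k \in [:: lower_level l; upper_level l] ->
  same_circle v (k, left_at l) (k, right_at l).
Proof.
move=> /negPf nv kl; apply/adjacent_same/(@slab_arc_adjacent _ _ _ l).
by move: kl; rewrite /slab_arc /= nv !inE !eqxx /= => ->.
Qed.

(** Vertical arcs keep the position, and the ends of a turnback have consecutive positions, whose
    signs cancel. *)
Lemma winding_at_step v l C : C \in circles v ->
  winding_at (lower_level l) C = winding_at (upper_level l) C.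
Proof.
move=> /circlesP[z ->]; have [vl|vl] := boolP (vertical v l).
  apply: eq_bigl => p; rewrite !mem_circle_of ![same_circle _ z _]same_circle_sym.
  by apply: same_circle_equiv; apply: same_circle_vertical; rewrite vl.
have cancel k : k \in [:: lower_level l; upper_level l] ->
    winding_at k (circle_of v z) =
    \sum_(p < n | ((k, p) \in circle_of v z) && (p \notin [:: left_at l; right_at l])) (-1) ^+ p.
  move=> kl; rewrite /winding_at (bigID (fun p => p \in [:: left_at l; right_at l])) /=.
  rewrite [X in X + _ = _](_ : _ = 0) ?add0r//.
  have LR : ((k, left_at l) \in circle_of v z) = ((k, right_at l) \in circle_of v z).
    rewrite !mem_circle_of ![same_circle _ z _]same_circle_sym.
    by apply: same_circle_equiv; exact: same_circle_turnback.
  have [inL|ninL] := boolP ((k, left_at l) \in circle_of v z); last first.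
    rewrite big1// => p /andP[kp]; rewrite !inE => /orP[] /eqP pE; move: ninL.
      by rewrite -pE kp.
    by rewrite LR -pE kp.
  rewrite (bigD1 (left_at l)) /=; last by rewrite inL !inE eqxx.
  rewrite (bigD1 (right_at l)) /=; last first.
    by rewrite -LR inL !inE eqxx orbT eq_sym left_right_neq.
  rewrite big1 => [|p]; last first.
    by rewrite !inE => /andP[/andP[/andP[_ /orP[/eqP ->|/eqP ->]]]]; rewrite eqxx ?andbF.
  by rewrite addr0 /= exprS mulN1r addrN.
rewrite !cancel ?inE ?eqxx ?orbT//; apply: eq_bigl => p; rewrite !mem_circle_of.
have [np|//] := boolP (p \notin _); rewrite ?andbT ?andbF//.
rewrite ![same_circle _ z _]same_circle_sym.
by apply: same_circle_equiv; apply: same_circle_vertical; rewrite np orbT.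
Qed.

Lemma winding_atE v k C : C \in circles v -> winding_at k C = winding C.
Proof.
move=> Cv; have e0 (i : nat) (hi : (i < (size w).+1)%N) :
    winding_at (Ordinal hi) C = winding_at ord0 C.
  elim: i hi => [|i IH] hi; first by congr winding_at; exact: val_inj.
  have hi' : (i < size w)%N by rewrite -ltnS.
  rewrite -(IH (ltnW hi)) (_ : Ordinal hi = upper_level (Ordinal hi')); last first.
    by apply: val_inj; rewrite /= /bump /= add1n.
  rewrite -(winding_at_step _ Cv); congr winding_at; exact: val_inj.
by rewrite -[winding C]/(winding_at ord_max C); case: k => k hk; rewrite !e0 -(e0 (size w) (ltnSn _)).
Qed.

Definition essential_circles v : {set {set point}} :=
  [set C in circles v | essential C]%SET.

(** A circle that misses a level has winding 0 there, so an essential circle meets every level. *)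
Lemma essential_sub v k :
  essential_circles v \subset [set circle_of v (k, p) | p : 'I_n]%SET.
Proof.
apply/fintype.subsetP => C; rewrite inE => /andP[Cv].
rewrite /essential -(winding_atE k Cv) => h.
have [p kp] : exists p, (k, p) \in C.
  apply/existsP; apply: contraNT h => /existsPn h.
  by rewrite /winding_at big1// => p kp; have := h p; rewrite kp.
apply/imsetP; exists p => //; move: Cv kp => /circlesP[z ->].
by rewrite mem_circle_of -eq_circle_of => /eqP.
Qed.

Lemma card_essential v : (#|essential_circles v| <= n)%N.
Proof.
apply: leq_trans (subset_leq_card (essential_sub v ord0)) _.
by apply: leq_trans (leq_imset_card _ _) _; rewrite card_ord.
Qed.

(** A turnback puts two of the [n] points of its level on one circle. *)
Lemma card_essential_lt v l : ~~ vertical v l -> (#|essential_circles v| < n)%N.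
Proof.
move=> vl; apply: leq_ltn_trans (subset_leq_card (essential_sub v (lower_level l))) _.
rewrite ltn_neqAle (leq_trans (leq_imset_card _ _)) ?card_ord// andbT.
apply/negP => /eqP e.
have /imset_injP inj : #|[set circle_of v (lower_level l, p) | p : 'I_n]%SET| == #|'I_n|.
  by rewrite e card_ord.
have := inj (left_at l) (right_at l) isT isT.
have -> : circle_of v (lower_level l, left_at l) = circle_of v (lower_level l, right_at l).
  by apply/eqP; rewrite eq_circle_of; apply: same_circle_turnback => //; rewrite inE eqxx.
by move=> /(_ erefl) /eqP; rewrite (negPf (left_right_neq l)).
Qed.

Lemma label_sign_le x C : label_sign x C <= 1.
Proof. by rewrite /label_sign; case: ifP. Qed.

Lemma kgrading_sum x : kgrading x = \sum_(C in essential_circles x.1) label_sign x C.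
Proof. by apply: eq_bigl => C; rewrite inE. Qed.

Lemma kgrading_card x : kgrading x <= #|essential_circles x.1|%:Z.
Proof.
rewrite kgrading_sum; apply: (@le_trans _ _ (\sum_(C in essential_circles x.1) 1)).
  by apply: ler_sum => C _; exact: label_sign_le.
by rewrite sumr_const natz.
Qed.

Lemma kgrading_le x : kgrading x <= n%:Z.
Proof. by apply: le_trans (kgrading_card x) _; rewrite lez_nat card_essential. Qed.

Definition vertical_vertex : vertex w := [ffun l => ~~ pos_at l].

Lemma vertical_vertexP v : (forall l, vertical v l) -> v = vertical_vertex.
Proof. by move=> h; apply/ffunP => l; rewrite ffunE; apply/eqP/h. Qed.

Lemma vertical_vertical l : vertical vertical_vertex l.
Proof. by rewrite /vertical ffunE. Qed.

Lemma same_circle_straight (z t : point) :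
  same_circle vertical_vertex z t = (z.2 == t.2).
Proof.
apply/idP/eqP.
  case/connectP => s; elim: s z => [|u s IH] z /=; first by move=> _ ->.
  move=> /andP[zu /IH h] /h <-; move: zu.
  rewrite /Defs.adjacent /resolution_arc /closing_arc /slab_arc.
  by case/orP => /orP[/and3P[_ _ /eqP]//|/existsP[l]];
    rewrite vertical_vertical /= => /and3P[_ _ /eqP].
have base k p : same_circle vertical_vertex (ord0, p) (k, p).
  case: k => k; elim: k => [|k IH] hk.
    rewrite (_ : Ordinal hk = ord0) ?same_circle_refl//; exact: val_inj.
  have hk' : (k < size w)%N by rewrite -ltnS.
  apply: same_circle_trans (IH (ltnW hk)) _.
  have := @same_circle_vertical vertical_vertex (Ordinal hk') p.
  rewrite vertical_vertical => /(_ isT).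
  rewrite (_ : lower_level _ = Ordinal (ltnW hk)); last exact: val_inj.
  rewrite (_ : upper_level _ = Ordinal hk)//.
  by apply: val_inj; rewrite /= /bump /= add1n.
case: z t => [k p] [k' p'] /= <-.
by apply: same_circle_trans (base k' p); rewrite same_circle_sym.
Qed.

Lemma winding_straight k p : winding (circle_of vertical_vertex (k, p)) = (-1) ^+ p.
Proof.
rewrite /winding (big_pred1 p)// => q.
by rewrite mem_circle_of same_circle_straight /= eq_sym.
Qed.

Lemma essential_straight : essential_circles vertical_vertex = circles vertical_vertex.
Proof.
apply/setP => C; rewrite inE andbC; have [/circlesP[[k p] ->]|] := boolP (C \in _); last by rewrite andbF.
by rewrite andbT /essential winding_straight signr_eq0.
Qed.

Lemma card_circles_straight : #|circles vertical_vertex| = n.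
Proof.
have -> : circles vertical_vertex =
    [set circle_of vertical_vertex (ord0, p) | p : 'I_n]%SET.
  apply/setP => C; apply/circlesP/imsetP => [[[k p] ->]|[p _ ->]].
    by exists p => //; apply/eqP; rewrite eq_circle_of same_circle_straight.
  by exists (ord0, p).
rewrite card_imset ?card_ord// => p q /eqP.
by rewrite eq_circle_of same_circle_straight => /eqP.
Qed.

Definition top_state : state w := (vertical_vertex, [ffun=> true]).

Lemma top_label C : label_sign top_state C = 1.
Proof. by rewrite /label_sign ifT//; apply/forallP => p; rewrite ffunE implybT. Qed.

Lemma top_labelled : is_labelled_resolution top_state.
Proof. by apply/forallP => p; apply/forallP => q; rewrite !ffunE eqxx implybT. Qed.

Lemma top_kgrading : kgrading top_state = n%:Z.
Proof.
rewrite kgrading_sum (eq_bigr (fun=> 1)); last by move=> C _; exact: top_label.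
by rewrite sumr_const natz essential_straight card_circles_straight.
Qed.

Lemma top_deg : deg top_state = n%:Z.
Proof.
rewrite /deg (eq_bigr (fun=> 1)); last by move=> C _; exact: top_label.
by rewrite sumr_const natz card_circles_straight.
Qed.

Lemma weight_vertical : weight vertical_vertex = n_minus w.
Proof. by apply: eq_card => l; rewrite !inE ffunE. Qed.

Lemma top_hgrading : hgrading top_state = 0.
Proof. by rewrite /hgrading weight_vertical subrr. Qed.

Definition writhe : int := (n_plus w)%:Z - (n_minus w)%:Z.

Lemma top_qgrading : qgrading top_state = n%:Z + writhe.
Proof. by rewrite /qgrading top_deg weight_vertical /writhe mulr2n; ring. Qed.

Lemma top_state_uniq x : is_labelled_resolution x -> kgrading x = n%:Z -> x = top_state.
Proof.
move=> lx kx.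
have vx l : vertical x.1 l.
  apply: contraT => /card_essential_lt h; have := kgrading_card x.
  by rewrite kx lez_nat leqNgt h.
have xv := vertical_vertexP vx.
have all1 C : C \in circles x.1 -> label_sign x C = 1.
  move=> Cx; apply/eqP; rewrite eq_le label_sign_le /=.
  move: kx; rewrite kgrading_sum xv essential_straight -xv (bigD1 C)//= => kx.
  have : \sum_(D in circles x.1 | D != C) label_sign x D <= (#|circles x.1|.-1)%:Z.
    apply: (@le_trans _ _ (\sum_(D in circles x.1 | D != C) 1)).
      by apply: ler_sum => D _; exact: label_sign_le.
    rewrite sumr_const natz lez_nat (cardD1 C (circles x.1)) Cx /=.
    by apply: subset_leq_card; apply/fintype.subsetP => D; rewrite !inE andbC.
  have c0 : (0 < #|circles x.1|)%N by apply/card_gt0P; exists C.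
  have cX : #|circles x.1| = n by rewrite xv card_circles_straight.
  move: kx c0; rewrite cX; move: (label_sign _ _) (\sum_(_ in _ | _) _) => a b.
  by lia.
have xt (p : point) : x.2 p.
  have := all1 _ (circle_of_in x.1 p); rewrite (label_sign_circle _ lx) /label_value.
  by case: (x.2 p).
case: x xv xt {lx kx vx all1} => [v f] /= -> xt; congr pair.
by apply/ffunP => p; rewrite ffunE xt.
Qed.

Lemma jones_top (j : int) : annular_jones w j n = (j == n%:Z + writhe)%:R.
Proof.
(* Every generator in this annular degree is [top_state], of homological degree 0, so the source and
   the target of the squared differential are never both nonempty. *)
rewrite annular_jonesE; last first.
  move=> i; apply/matrixP => r; have := enum_valP r.
  rewrite inE => /and4P[lr /eqP hr _ /eqP kr] t; have := enum_valP t.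
  rewrite inE => /and4P[lt /eqP ht _ /eqP kt]; exfalso.
  move: hr ht; rewrite (top_state_uniq lr kr) (top_state_uniq lt kt) top_hgrading.
  by lia.
have [->|nj] := eqVneq j (n%:Z + writhe).
  rewrite (big_pred1 top_state) ?top_hgrading ?expr0z// => x /=.
  apply/and3P/eqP => [[lx _ /eqP kx]|->]; first exact: top_state_uniq.
  by rewrite top_labelled top_qgrading top_kgrading !eqxx.
rewrite big1// => x /and3P[lx /eqP qx /eqP kx]; case/eqP: nj.
by rewrite -qx (top_state_uniq lx kx) top_qgrading.
Qed.

Lemma jones_above (j k : int) : n%:Z < k -> annular_jones w j k = 0.
Proof.
move=> nk; have no x : (kgrading x == k) = false.
  by apply/negP => /eqP kx; have := kgrading_le x; rewrite kx leNgt nk.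
rewrite annular_jonesE; last first.
  move=> i; apply/matrixP => r; have := enum_valP r.
  by rewrite inE no !andbF.
by rewrite big1// => x; rewrite no !andbF.
Qed.

End TopDegree.

Lemma jones_strands_writhe (n n' : nat) (w : braid_word n) (w' : braid_word n') :
  (forall j k, annular_jones w j k = annular_jones w' j k) ->
  n = n' /\ writhe w = writhe w'.
Proof.
move=> ww'; have nn' : n = n'.
  case: (ltngtP n n') => // nn'.
    have := ww' (n'%:Z + writhe w') n'; rewrite jones_top eqxx.
    by rewrite jones_above// ltz_nat.
  have := ww' (n%:Z + writhe w) n; rewrite jones_top eqxx.
  by rewrite jones_above// ltz_nat.
split=> //; subst n'; have := ww' (n%:Z + writhe w) n.
rewrite !jones_top eqxx; case: eqP => // /addrI //.
Qed.

(** At the level of a turnback two of the three points lie on the same circle with opposite signs,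
    so at most one point counts. Without turnbacks each circle meets a level once. *)
Lemma winding_bound (w : braid_word 3) v (C : {set diagram_point w}) :
  C \in circles v -> `|winding C| <= 1.
Proof.
move=> Cv; have [/forallP vv|/forallPn[l vl]] := boolP [forall l, vertical v l].
  move: Cv; rewrite (vertical_vertexP vv) => /circlesP[[k p] ->].
  by rewrite winding_straight normrX normrN1 expr1n.
rewrite -(winding_atE (lower_level l) Cv) /winding_at big_mkcond /= !big_ord_recl big_ord0 /=.
have : ((lower_level l, left_at l) \in C) = ((lower_level l, right_at l) \in C).
  move: Cv => /circlesP[z ->]; rewrite !mem_circle_of ![same_circle _ z _]same_circle_sym.
  by apply: same_circle_equiv; apply: same_circle_turnback => //; rewrite inE eqxx.
have /orP[/eqP l0|/eqP l1] : (left_at l == 0%N :> nat) || (left_at l == 1%N :> nat).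
  by have := ltn_ord (letter_at l).1; rewrite /left_at /=; case: (nat_of_ord _) => [|[|]].
- have -> : left_at l = ord0 by exact: val_inj.
  have -> : right_at l = lift ord0 ord0 by apply: val_inj; apply: (congr1 S l0).
  by move=> ->; do 2 case: (_ \in C).
- have -> : left_at l = lift ord0 ord0 by exact: val_inj.
  have -> : right_at l = lift ord0 (lift ord0 ord0).
    apply: val_inj; exact: (congr1 S l1).
  by move=> ->; do 2 case: (_ \in C).
Qed.

(** * Labellings as functions on the set of circles *)

Section CircleLabels.
Variables (n : nat) (w : braid_word n) (v : vertex w).
Local Notation point := (diagram_point w).
Local Notation slab := 'I_(size w).
Implicit Types (p q : point) (f : {ffun point -> bool}).

Definition circle : finType := {C : {set point} | C \in circles v}.
Implicit Types (g : {ffun circle -> bool}).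

Definition circle_through p : circle := Sub (circle_of v p) (circle_of_in v p).

Definition spread g : {ffun point -> bool} := [ffun p => g (circle_through p)].
Definition gather f : {ffun circle -> bool} := [ffun C : circle => [forall p in val C, f p]].

Lemma circle_through_eq p q : (circle_through p == circle_through q) = same_circle v p q.
Proof. by rewrite -val_eqE /= eq_circle_of. Qed.

Lemma circle_throughP (C : circle) : exists p, C = circle_through p.
Proof.
by case: C => C hC; have /circlesP[p CE] := hC; exists p; apply: val_inj.
Qed.

Lemma spread_labelled g : is_labelled_resolution ((v, spread g) : state w).
Proof.
apply/forallP => p; apply/forallP => q; apply/implyP => /= pq.
by rewrite !ffunE (_ : circle_through p = circle_through q)//; apply/eqP; rewrite circle_through_eq.
Qed.

Lemma spreadK : cancel spread gather.
Proof.
move=> g; apply/ffunP => C; rewrite ffunE; have [p ->] := circle_throughP C.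
have gE q : q \in val (circle_through p) -> spread g q = g (circle_through p).
  rewrite /= mem_circle_of => pq; rewrite ffunE; congr (g _).
  by apply/eqP; rewrite eq_sym circle_through_eq.
apply/forallP/idP => [/(_ p)|gp q].
  by rewrite gE /= ?mem_circle_of ?same_circle_refl.
by apply/implyP => qp; rewrite gE.
Qed.

Lemma gatherK f : is_labelled_resolution ((v, f) : state w) -> spread (gather f) = f.
Proof.
move=> lf; apply/ffunP => p; rewrite !ffunE /=.
apply/forallP/idP => [/(_ p)|fp q]; first by rewrite mem_circle_of same_circle_refl.
by apply/implyP; rewrite mem_circle_of => pq; rewrite -(labelled_eq lf pq).
Qed.

Lemma sum_labellings (V : zmodType) (P : pred {ffun point -> bool})
    (F : {ffun point -> bool} -> V) :
  \sum_(f | is_labelled_resolution ((v, f) : state w) && P f) F f =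
  \sum_(g | P (spread g)) F (spread g).
Proof.
rewrite (reindex_onto spread gather) /=; last first.
  by move=> f /andP[lf _]; exact: gatherK.
by apply: eq_bigl => g; rewrite spread_labelled spreadK eqxx andbT.
Qed.

Lemma sum_circles (V : zmodType) (F : {set point} -> V) :
  \sum_(C in circles v) F C = \sum_(C : circle) F (val C).
Proof.
rewrite (reindex_omap (val : circle -> _) insub) /=; last first.
  by move=> C hC; rewrite insubT.
by apply: eq_bigl => C; rewrite (valP C) valK eqxx.
Qed.

Lemma deg_spread g : deg ((v, spread g) : state w) = \sum_(C : circle) label_value (g C).
Proof.
rewrite /deg sum_circles; apply: eq_bigr => C _; have [p ->] := circle_throughP C.
by rewrite (@label_sign_circle n w (v, spread g) p (spread_labelled g)) /= ffunE.
Qed.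

Lemma card_circle : #|{: circle}| = #|circles v|.
Proof. by rewrite card_sig. Qed.

Variable F : fieldType.

Lemma expfz_sum (q : F) (I : finType) (e : I -> int) : q != 0 ->
  q ^ (\sum_i e i) = \prod_i q ^ e i.
Proof.
move=> q0; apply: (big_morph (fun e => q ^ e)); last exact: expr0z.
by move=> a b; exact: expfzDr.
Qed.

(** [C0] will be the only essential circle: it carries v_+ and contributes [q], while every other
    circle contributes [q + q^-1]. *)
Lemma sum_trivial_labels (q : F) (C0 : circle) : q != 0 ->
  \sum_(g : {ffun circle -> bool} | g C0)
    q ^ (\sum_(C : circle) label_value (g C)) = q * (q + q^-1) ^+ #|circles v|.-1.
Proof.
move=> q0; under eq_bigr => g _ do rewrite expfz_sum//.
pose Q (C : circle) (b : bool) := (C == C0) ==> b.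
rewrite (eq_bigl (fun g => g \in family Q)); last first.
  move=> g; apply/idP/familyP => [g0 C|/(_ C0)].
    by rewrite unfold_in /Q; apply/implyP => /eqP ->.
  by rewrite unfold_in /Q eqxx.
rewrite -(bigA_distr_big_dep Q (fun C b => q ^ label_value b)).
rewrite (bigD1 C0) //= big_mkcond big_bool /Q eqxx /= addr0 expr1z; congr (_ * _).
rewrite (eq_bigr (fun=> q + q^-1)); last first.
  by move=> C /negPf nC; rewrite big_mkcond big_bool nC.
rewrite prodr_const; congr (_ ^+ _).
by rewrite -card_circle -(cardC1 C0); apply: eq_card => C; rewrite !inE.
Qed.

(** The sum of three signs is 1 when exactly one of them is negative. *)
Lemma sum_three_labels (q : F) : #|circles v| = 3%N ->
  \sum_(g : {ffun circle -> bool} | \sum_(C : circle) label_value (g C) == 1)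
    q ^ (\sum_(C : circle) label_value (g C)) = q *+ 3.
Proof.
move=> c3; rewrite (eq_bigr (fun=> q)); last by move=> g /eqP ->; rewrite expr1z.
rewrite sumr_const; congr (_ *+ _).
have lv g : (\sum_(C : circle) label_value (g C) == 1) = (#|[set C | ~~ g C]%SET| == 1)%N.
  rewrite (bigID g) /= (eq_bigr (fun=> 1)); last by move=> C ->.
  rewrite [X in _ + X](eq_bigr (fun=> -1)); last by move=> C /negPf ->.
  rewrite sumr_const sumrN sumr_const /= !natz.
  pose G := [pred C : circle | g C]; have := cardC G; rewrite card_circle c3.
  rewrite (_ : #|[set C | ~~ g C]%SET| = #|[predC G]|); last by apply: eq_card => C; rewrite !inE.
  rewrite (_ : #|(fun C => ~~ g C)| = #|[predC G]|); last by apply: eq_card.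
  rewrite (_ : #|(fun C => g C)| = #|G|); last by apply: eq_card.
  by move: #|G| #|[predC G]| => a b; lia.
rewrite (eq_card lv).
have := card_draws circle 1%N; rewrite card_circle c3 bin1 => <-.
pose h (A : {set circle}) : {ffun circle -> bool} := [ffun C => C \notin A].
rewrite -[RHS](@card_imset _ _ h); last first.
  by move=> A B /ffunP e; apply/setP => C; have := e C; rewrite !ffunE => /negb_inj.
apply: eq_card => g; rewrite [LHS]unfold_in; apply/idP/imsetP => [g1|[A + ->]].
  exists [set C | ~~ g C]%SET; first by rewrite inE.
  by apply/ffunP => C; rewrite ffunE inE negbK.
rewrite inE => A1; rewrite (_ : [set C | ~~ h A C]%SET = A)//.
by apply/setP => C; rewrite inE ffunE negbK.
Qed.

End CircleLabels.

(** * Resolutions of closed three-strand braids *)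

Definition third_strand (i : 'I_2) : 'I_3 := if i == ord0 then ord_max else ord0.
Definition on_strands (i : 'I_2) (p : 'I_3) : bool :=
  p \in [:: @left_strand 3 i; @right_strand 3 i].

Lemma third_strandP i p : ~~ on_strands i p = (p == third_strand i).
Proof.
by case: i p => [[|[|//]] ?] [[|[|[|//]]] ?].
Qed.

Lemma middle_strand : exists p : 'I_3, forall i, on_strands i p.
Proof. by exists (lift ord0 ord0) => -[[|[|//]] ?]. Qed.

Lemma third_strand_other i j : i != j -> on_strands i (third_strand j).
Proof. by case: i j => [[|[|//]] ?] [[|[|//]] ?]. Qed.

Section CountCircles.
Variables (w : braid_word 3) (v : vertex w).
Local Notation point := (diagram_point w).
Local Notation slab := 'I_(size w).
Implicit Types (l m : slab) (p q : 'I_3) (k : nat).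
Variable l0 : slab.
Hypothesis l0_turn : ~~ vertical v l0.

Definition turns : seq slab := [seq l <- enum 'I_(size w) | ~~ vertical v l].
Definition turn_letter (l : slab) : 'I_2 := (letter_at l).1.
Local Notation h := (size turns).

Lemma turns_mem l : (l \in turns) = ~~ vertical v l.
Proof. by rewrite mem_filter mem_enum andbT. Qed.

Lemma turns_gt0 : (0 < h)%N.
Proof. by rewrite -has_predT; apply/hasP; exists l0 => //; rewrite turns_mem. Qed.

(** Numbers the regions between turnbacks: level [k] lies in the region just below the turnback of
    this index, taken modulo [h] because of the closing arcs. *)
Definition turns_below k : nat :=
  size [seq l <- take k (enum 'I_(size w)) | ~~ vertical v l].

Lemma turns_below0 : turns_below 0 = 0%N.
Proof. by rewrite /turns_below take0. Qed.

Lemma turns_below_size : turns_below (size w) = h.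
Proof. by rewrite /turns_below take_oversize// size_enum_ord. Qed.

Lemma take_enum_ord l :
  take l.+1 (enum 'I_(size w)) = rcons (take l (enum 'I_(size w))) l.
Proof. by rewrite (take_nth l) ?size_enum_ord// nth_ord_enum. Qed.

Lemma turns_belowS l : turns_below l.+1 = (turns_below l + ~~ vertical v l)%N.
Proof.
rewrite /turns_below take_enum_ord filter_rcons.
by case: (vertical v l); rewrite ?addn0 //= size_rcons addn1.
Qed.

Lemma nth_turns l : ~~ vertical v l ->
  (turns_below l < h)%N /\ nth l0 turns (turns_below l) = l.
Proof.
move=> vl; have E : turns = rcons [seq m <- take l (enum 'I_(size w)) | ~~ vertical v m] l ++
    [seq m <- drop l.+1 (enum 'I_(size w)) | ~~ vertical v m].
  rewrite -[turns in LHS]/([seq m <- enum 'I_(size w) | _]) -{1}(cat_take_drop l.+1 (enum _)).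
  by rewrite filter_cat take_enum_ord filter_rcons vl.
rewrite E size_cat size_rcons /turns_below addSn ltnS leq_addr; split=> //.
by rewrite nth_cat size_rcons ltnSn nth_rcons ltnn eqxx.
Qed.

Lemma turns_below_nth r : (r < h)%N -> turns_below (nth l0 turns r) = r.
Proof.
move=> rh; have lr : ~~ vertical v (nth l0 turns r) by rewrite -turns_mem mem_nth.
have [lt e] := nth_turns lr; apply/eqP.
by rewrite -(nth_uniq l0 lt rh) ?e// filter_uniq// enum_uniq.
Qed.

Definition below r : 'I_(size w).+1 := lower_level (nth l0 turns r).
Definition above r : 'I_(size w).+1 := upper_level (nth l0 turns r).

(** All arcs up to the next turnback are vertical; the induction is on the distance to the last
    level. *)
Lemma climb k (hk : (k < (size w).+1)%N) p : (turns_below k < h)%N ->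
  same_circle v (Ordinal hk, p) (below (turns_below k), p).
Proof.
move: {2}(size w - k)%N (leqnn (size w - k)) => d; elim: d k hk => [|d IH] k hk.
  rewrite leqn0 subn_eq0 => ck lt; exfalso; move: lt.
  have -> : k = size w by apply/eqP; rewrite eqn_leq ck -ltnS hk.
  by rewrite turns_below_size ltnn.
have [kc _ lt|kc] := eqVneq k (size w).
  by exfalso; move: lt; rewrite kc turns_below_size ltnn.
have lk : (k < size w)%N by rewrite ltn_neqAle kc -ltnS.
move=> dk ck; pose l := Ordinal lk.
have kE : Ordinal hk = lower_level l by exact: val_inj.
have [vl|vl] := boolP (vertical v l); last first.
  have [_ e] := nth_turns vl.
  by rewrite kE /below [nth _ _ _]e same_circle_refl.
have uE : upper_level l = Ordinal (lk : (k.+1 < (size w).+1)%N).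
  by apply: val_inj; rewrite /= /bump /= add1n.
have cE : turns_below k.+1 = turns_below k by rewrite (turns_belowS l) vl addn0.
apply: same_circle_trans (_ : same_circle v _ (upper_level l, p)) _.
  by rewrite kE; apply: same_circle_vertical; rewrite vl.
rewrite uE -cE; apply: IH; last by rewrite cE.
by move: dk; lia.
Qed.

Lemma climb_region (z : point) :
  same_circle v z (below (turns_below z.1 %% h), z.2).
Proof.
case: z => [[k hk] p] /=.
have hle : (turns_below k <= h)%N.
  rewrite /turns_below /turns !size_filter.
  by rewrite -[X in (_ <= count _ X)%N](cat_take_drop k) count_cat leq_addr.
move: hle; rewrite leq_eqVlt => /orP[/eqP e|lt]; last first.
  by rewrite modn_small//; exact: climb.
rewrite e modnn.
have up d (hd : (d < (size w).+1)%N) : turns_below d = h ->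
    same_circle v (Ordinal hd, p) (ord_max, p).
  move: {2}(size w - d)%N (leqnn (size w - d)) => s; elim: s d hd => [|s IH] d hd ds ed.
    rewrite (_ : Ordinal hd = ord_max) ?same_circle_refl//; apply: val_inj => /=.
    by apply/eqP; rewrite eqn_leq -ltnS hd -subn_eq0 -leqn0.
  have [dc|dc] := eqVneq d (size w).
    by rewrite (_ : Ordinal hd = ord_max) ?same_circle_refl//; exact: val_inj.
  have ld : (d < size w)%N by rewrite ltn_neqAle dc -ltnS.
  have vl : vertical v (Ordinal ld).
    by apply: contraT => /nth_turns[]; rewrite /= ed ltnn.
  have dE : Ordinal hd = lower_level (Ordinal ld) by exact: val_inj.
  have uE : upper_level (Ordinal ld) = Ordinal (ld : (d.+1 < (size w).+1)%N).
    by apply: val_inj; rewrite /= /bump /= add1n.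
  apply: same_circle_trans (_ : same_circle v _ (upper_level (Ordinal ld), p)) _.
    by rewrite dE; apply: same_circle_vertical; rewrite vl.
  rewrite uE; apply: IH; first by move: ds; lia.
  by rewrite (turns_belowS (Ordinal ld)) vl addn0.
apply: same_circle_trans (up _ _ e) _.
apply: same_circle_trans (_ : same_circle v _ (ord0, p)) _.
  apply: adjacent_same; apply/orP; left; apply/orP; left.
  by rewrite /closing_arc /= !eqxx.
have := @climb 0 (ltn0Sn _) p; rewrite turns_below0 turns_gt0 => /(_ isT).
by rewrite (_ : Ordinal _ = ord0)//; exact: val_inj.
Qed.

Definition region_letter r : 'I_2 := turn_letter (nth l0 turns r).
(** Adding [h.-1] modulo [h] gives the cyclic predecessor; a single turnback is its own
    predecessor. *)
Definition previous_letter r : 'I_2 := region_letter ((r + h.-1) %% h).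

Definition region k : 'I_h := Ordinal (ltn_pmod (turns_below k) turns_gt0).

(* The circles other than the essential one lie between two consecutive
   turnbacks at the same strands. *)
Definition class_at (r : 'I_h) p : option 'I_h :=
  if (previous_letter r == region_letter r) && on_strands (region_letter r) p
  then Some r else None.

Definition circle_class (z : point) : option 'I_h := class_at (region z.1) z.2.

Lemma region_lower l : ~~ vertical v l ->
  region (lower_level l) = turns_below l :> nat /\
  region_letter (region (lower_level l)) = turn_letter l.
Proof.
move=> vl; have [lt e] := nth_turns vl.
have rE : region (lower_level l) = turns_below l :> nat by rewrite /= modn_small.
by rewrite rE /region_letter e.
Qed.

Lemma previous_upper l : ~~ vertical v l ->
  previous_letter (region (upper_level l)) = turn_letter l.
Proof.
move=> vl; have [lt e] := nth_turns vl.
rewrite /previous_letter (_ : ((region (upper_level l) + h.-1) %% h)%N = turns_below l).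
  by rewrite /region_letter e.
have -> : region (upper_level l) = (turns_below l.+1 %% h)%N :> nat by [].
rewrite turns_belowS vl addn1 modnDml addSnnS.
by rewrite prednK ?turns_gt0// modnDr modn_small.
Qed.

Lemma turn_strands l p :
  (p \in [:: left_at l; right_at l]) = on_strands (turn_letter l) p.
Proof. by []. Qed.

Lemma class_lower l p : ~~ vertical v l ->
  circle_class (lower_level l, p) =
  if on_strands (turn_letter l) p
  then (if previous_letter (region (lower_level l)) == turn_letter l
        then Some (region (lower_level l)) else None)
  else None.
Proof.
move=> vl; have [_ e] := region_lower vl.
by rewrite /circle_class /class_at e; case: (on_strands _ _); rewrite ?andbF ?andbT.
Qed.

Lemma class_upper l p : ~~ vertical v l ->
  circle_class (upper_level l, p) =
  if on_strands (turn_letter l) p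
  then (if turn_letter l == region_letter (region (upper_level l))
        then Some (region (upper_level l)) else None)
  else None.
Proof.
move=> vl; rewrite /circle_class /class_at [fst _]/= [snd _]/= (previous_upper vl).
set b := region_letter _; case: (eqVneq (turn_letter l) b) => [<-|_].
  by [].
by case: (on_strands (turn_letter l) p).
Qed.

Lemma class_resolution_arc (z t : point) :
  resolution_arc v z t -> circle_class z = circle_class t.
Proof.
case: z t => [k p] [k' p'] /orP[/and3P[/= /eqP -> /eqP -> /eqP <-]|/existsP[l]].
  congr class_at; apply: val_inj.
  by rewrite /= turns_below_size turns_below0 modnn mod0n.
rewrite /slab_arc turn_strands.
have [vl|vl] := boolP (vertical v l).
  move=> /and3P[/= /eqP -> /eqP -> /eqP <-].
  congr class_at; apply: val_inj; rewrite -[RHS]/(turns_below l.+1 %% h)%N.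
  by rewrite turns_belowS vl addn0.
case: ifP => [/negPf np /and3P[/= /eqP -> /eqP -> /eqP <-]|_].
  by rewrite class_lower// class_upper// np.
move=> /and4P[/= /eqP <- kl /eqP -> /eqP ->].
have sL : on_strands (turn_letter l) (left_at l) by rewrite -turn_strands inE eqxx.
have sR : on_strands (turn_letter l) (right_at l).
  by rewrite -turn_strands !inE eqxx orbT.
by move: kl; rewrite !inE => /orP[] /eqP ->;
  rewrite ?(class_lower _ vl) ?(class_upper _ vl) sL sR.
Qed.

Lemma class_same_circle (z t : point) :
  same_circle v z t -> circle_class z = circle_class t.
Proof.
case/connectP => s; elim: s z => [|u s IH] z /=; first by move=> _ ->.
move=> /andP[zu /IH e] /e <-; case/orP: zu => /class_resolution_arc //.
Qed.

Lemma region_below r : (r < h)%N -> region (below r) = r :> nat.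
Proof. by move=> rh; rewrite /= turns_below_nth// modn_small. Qed.

Lemma class_below r p (rh : (r < h)%N) : circle_class (below r, p) = class_at (Ordinal rh) p.
Proof.
rewrite /circle_class; congr class_at; apply: val_inj.
exact: region_below.
Qed.

Lemma turn_nth r : (r < h)%N -> ~~ vertical v (nth l0 turns r).
Proof. by move=> rh; rewrite -turns_mem mem_nth. Qed.

Lemma turn_same l (k : 'I_(size w).+1) p q :
  ~~ vertical v l -> k \in [:: lower_level l; upper_level l] ->
  on_strands (turn_letter l) p -> on_strands (turn_letter l) q ->
  same_circle v (k, p) (k, q).
Proof.
move=> vl kl; have LR := same_circle_turnback vl kl.
rewrite -!turn_strands !inE => /orP[] /eqP -> /orP[] /eqP -> //;
  rewrite ?same_circle_refl//.
by rewrite same_circle_sym.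
Qed.

Lemma below_turn_same r p q : (r < h)%N -> on_strands (region_letter r) p ->
  on_strands (region_letter r) q -> same_circle v (below r, p) (below r, q).
Proof.
by move=> rh; apply: turn_same; rewrite ?turn_nth// inE eqxx.
Qed.

Lemma above_below r p : (r < h)%N -> same_circle v (above r, p) (below (r.+1 %% h), p).
Proof.
move=> rh; have := climb_region (above r, p).
rewrite -[turns_below _]/(turns_below (nth l0 turns r).+1).
by rewrite turns_belowS turns_below_nth// turn_nth// addn1.
Qed.

(** If the turnbacks at the ends of the region use different pairs of strands, the upper one leads
    to the middle strand, and the lower one from there to the third strand of the upper one. *)
Lemma class_none_third r p : (r < h)%N -> circle_class (below r, p) = None ->
  same_circle v (below r, p) (below r, third_strand (region_letter r)).
Proof.
move=> rh; rewrite (class_below _ rh) /class_at /=.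
have [sp|] := boolP (on_strands (region_letter r) p); last first.
  by rewrite third_strandP => /eqP ->; rewrite same_circle_refl.
rewrite andbT; case: eqVneq => // ne _; have [mid hm] := middle_strand.
apply: same_circle_trans (below_turn_same rh sp (hm _)) _.
pose s := ((r + h.-1) %% h)%N.
have sh : (s < h)%N by rewrite ltn_pmod// turns_gt0.
have sS : (s.+1 %% h = r)%N.
  rewrite -addn1 modnDml -addnA addn1 prednK ?turns_gt0// modnDr modn_small//.
have e p' : same_circle v (above s, p') (below r, p').
  by have := above_below p' sh; rewrite sS.
apply: same_circle_trans (_ : same_circle v _ (above s, mid)) _.
  by rewrite same_circle_sym.
apply: same_circle_trans (e _).
apply: (@turn_same (nth l0 turns s)); rewrite ?turn_nth ?inE ?eqxx ?orbT//.
exact: third_strand_other.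
Qed.

(** The strand outside turnback [r] passes it vertically and has class [None] in the next region. *)
Lemma third_step r : (r.+1 < h)%N ->
  same_circle v (below r, third_strand (region_letter r))
    (below r.+1, third_strand (region_letter r.+1)).
Proof.
move=> rh; have rh' := ltnW rh.
have nt : on_strands (region_letter r) (third_strand (region_letter r)) = false.
  by apply/negbTE; rewrite third_strandP.
apply: same_circle_trans (_ : same_circle v _ (above r, third_strand (region_letter r))) _.
  by apply: same_circle_vertical; rewrite turn_strands nt orbT.
have := above_below (third_strand (region_letter r)) rh'; rewrite modn_small// => ab.
apply: same_circle_trans ab _; apply: class_none_third => //.
have <- : circle_class (above r, third_strand (region_letter r)) =
    circle_class (below r.+1, third_strand (region_letter r)).
  by have := class_same_circle (above_below (third_strand (region_letter r)) rh'); rewrite modn_small.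
by rewrite class_upper ?turn_nth// -[turn_letter _]/(region_letter r) nt.
Qed.

Lemma third_connected r : (r < h)%N ->
  same_circle v (below 0, third_strand (region_letter 0))
    (below r, third_strand (region_letter r)).
Proof.
elim: r => [|r IH] rh; first exact: same_circle_refl.
exact: same_circle_trans (IH (ltnW rh)) (third_step rh).
Qed.

Lemma same_circle_class (z t : point) :
  same_circle v z t = (circle_class z == circle_class t).
Proof.
apply/idP/eqP => [/class_same_circle //|].
have zE := climb_region z; have tE := climb_region t.
rewrite (class_same_circle zE) (class_same_circle tE).
move: zE tE; set r := (_ %% h)%N; set r' := (_ %% h)%N => zE tE.
have rh : (r < h)%N by rewrite ltn_pmod// turns_gt0.
have rh' : (r' < h)%N by rewrite ltn_pmod// turns_gt0.
move=> e; apply: same_circle_trans zE _; rewrite same_circle_sym.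
apply: same_circle_trans tE _; rewrite same_circle_sym.
have [cN|cN] := boolP (circle_class (below r, z.2) == None).
  have c1 := eqP cN; have c2 : circle_class (below r', t.2) = None by rewrite -e.
  apply: same_circle_trans (class_none_third rh c1) _.
  rewrite same_circle_sym; apply: same_circle_trans (class_none_third rh' c2) _.
  have h1 := third_connected rh; have h2 := third_connected rh'.
  by rewrite same_circle_sym in h2; exact: same_circle_trans h2 h1.
move: e cN; rewrite (class_below _ rh) (class_below _ rh') /class_at /=.
case: ifP => [/andP[_ s1]|//]; case: ifP => [/andP[_ s2] [rr] _|//].
by move: s2; rewrite -rr => s2; exact: below_turn_same.
Qed.

(** The class [None] gives one circle, and each region whose two turnbacks agree gives one more.
    These cyclic coincidences are what the trace of a product of cup-cap matrices counts. *)
Lemma card_circles_turns :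
  #|circles v| = #|[set r : 'I_h | previous_letter r == region_letter r]%SET|.+1.
Proof.
have -> : #|circles v| = #|[set circle_class z | z : point]%SET|.
  rewrite circlesE.
  pose G (o : option 'I_h) : {set point} := [set z | circle_class z == o]%SET.
  have GE z : circle_of v z = G (circle_class z).
    by apply/setP => t; rewrite !inE same_circle_class eq_sym.
  have -> : [set circle_of v p | p in [set: point]]%SET =
      (G @: [set circle_class z | z : point])%SET.
    apply/setP => C; apply/imsetP/imsetP => [[z _ ->]|[c cI ->]].
      by exists (circle_class z); rewrite ?GE// imset_f.
    by have /imsetP[z _ ->] := cI; exists z => //; rewrite GE.
  rewrite card_in_imset// => o o' /imsetP[z _ ->] /imsetP[t _ ->] /setP/(_ z).
  by rewrite !inE eqxx => /esym/eqP.
set S := [set r : 'I_h | _]%SET.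
have -> : [set circle_class z | z : point]%SET = (None |: (Some @: S))%SET.
  apply/setP => o; rewrite !inE; apply/imsetP/idP => [[z _ ->]|].
    rewrite /circle_class /class_at; case: ifP => // /andP[e _] /=.
    by apply/imsetP; exists (region z.1); rewrite ?inE.
  case/orP => [/eqP ->|/imsetP[r + ->]].
    exists (below 0, third_strand (region_letter 0)) => //.
    rewrite (class_below _ turns_gt0) /class_at /= (_ : on_strands _ _ = false) ?andbF//.
    by apply/negbTE; rewrite third_strandP.
  rewrite inE => e; have [mid hm] := middle_strand.
  exists (below r, mid) => //; rewrite (class_below _ (ltn_ord r)) /class_at /= e hm.
  by congr Some; exact: val_inj.
have nN : None \notin (Some @: S)%SET by apply/negP => /imsetP[].
by rewrite cardsU1 nN card_imset ?add1n// => a b [].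
Qed.

End CountCircles.

Lemma ord2_cases (i : 'I_2) : i = ord0 \/ i = ord_max.
Proof. by case: i => [[|[|]]] // hi; [left|right]; exact: val_inj. Qed.

Lemma matrix2P (F : fieldType) (M M' : 'M[F]_2) :
  M ord0 ord0 = M' ord0 ord0 -> M ord0 ord_max = M' ord0 ord_max ->
  M ord_max ord0 = M' ord_max ord0 -> M ord_max ord_max = M' ord_max ord_max -> M = M'.
Proof.
move=> e00 e01 e10 e11; apply/matrixP => i j.
by have [->|->] := ord2_cases i; have [->|->] := ord2_cases j.
Qed.

Lemma mulmx2 (F : fieldType) (M M' : 'M[F]_2) i j :
  (M * M') i j = M i ord0 * M' ord0 j + M i ord_max * M' ord_max j.
Proof.
rewrite !mxE !big_ord_recl big_ord0 addr0 (_ : lift ord0 ord0 = ord_max)//.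
exact: val_inj.
Qed.

(** * Cup-cap matrices and the traces of their products *)

Section TemperleyLieb.
Variables (F : fieldType) (d : F).
Implicit Types (i j : 'I_2) (s : seq 'I_2).

(** A cap against a cup closes a circle, of value [d], if they are at the same strands, and
    otherwise only straightens a strand. *)
Definition loop_coef i j : F := if i == j then d else 1.

(* The cup-cap diagrams acting on the two diagrams with one through strand. *)
Definition cup_cap i j : 'M[F]_2 := \matrix_(r, c) ((r == i)%:R * loop_coef j c).

Lemma cup_cap_mul i j k l : cup_cap i j * cup_cap k l = loop_coef j k *: cup_cap i l.
Proof.
apply/matrixP => r c; rewrite !mxE (bigD1 k)//= big1 => [|x xk].
  by rewrite !mxE eqxx mul1r addr0; ring.
by rewrite !mxE (negPf xk) mul0r mulr0.
Qed.

Lemma cup_cap_trace i j : \tr (cup_cap i j) = loop_coef j i.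
Proof.
rewrite /mxtrace (bigD1 i)//= big1 => [|x xi]; rewrite !mxE.
  by rewrite eqxx mul1r addr0.
by rewrite (negPf xi) mul0r.
Qed.

Lemma cup_cap_prod i j s : cup_cap i j * \prod_(x <- s) cup_cap x x =
  (\prod_(r < size s) loop_coef (nth ord0 (j :: s) r) (nth ord0 s r)) *: cup_cap i (last j s).
Proof.
elim: s j => [|x s IH] j; first by rewrite big_nil mulr1 big_ord0 scale1r.
rewrite big_cons mulrA cup_cap_mul -scalerAl IH scalerA big_ord_recl /=.
by congr (_ * _ *: _).
Qed.

(** The matrices have rank one, so that a product gives one scalar for each adjacent pair; the trace
    adds the pair of the last and the first letter, which has index 0. *)
Lemma trace_cup_cap s : (0 < size s)%N -> \tr (\prod_(x <- s) cup_cap x x) =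
  \prod_(r < size s)
    loop_coef (nth ord0 s ((r + (size s).-1) %% size s)) (nth ord0 s r).
Proof.
case: s => [//|a s] _; rewrite big_cons cup_cap_prod mxtraceZ cup_cap_trace.
rewrite [RHS]big_ord_recl /= add0n modn_small// mulrC -last_nth; congr (_ * _).
apply: eq_bigr => r _; rewrite /= /bump /= add1n addSnnS modnDr modn_small//.
by rewrite ltnS ltnW.
Qed.

End TemperleyLieb.

Lemma card_sumz (T : finType) (P : pred T) : #|P|%:Z = \sum_x (P x : nat)%:Z.
Proof.
rewrite -sum1_card big_mkcond /= -[LHS]natz natr_sum.
by apply: eq_bigr => x _; rewrite unfold_in natz; case: (P x).
Qed.

(** * The state sum as a trace *)

Section StateSum.
Variables (F : fieldType) (q : F).
Hypothesis q_neq0 : q != 0.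
Local Notation d := (q + q^-1).
Variable w : braid_word 3.
Local Notation slab := 'I_(size w).
Implicit Types (v : vertex w) (l : slab) (x : state w).

Definition state_term x : F := (-1) ^ hgrading x * q ^ qgrading x.

Definition state_sum : F :=
  \sum_(x : state w | is_labelled_resolution x && (kgrading x == 1)) state_term x.

(** The factor of crossing [l] in [state_term], sign included: [q] or [q^-1] for the vertical
    smoothing, [- q^2] or [- q^-2] for the turnbacks. *)
Definition slab_weight l (b : bool) : F :=
  if pos_at l then (if b then - q ^+ 2 else q) else (if b then q^-1 else - q ^- 2).

Lemma vertex_weight v (e : int) :
  (-1) ^ ((weight v)%:Z - (n_minus w)%:Z) *
  q ^ (e + (weight v)%:Z + (n_plus w)%:Z - (n_minus w)%:Z *+ 2) =
  q ^ e * \prod_l slab_weight l (v l).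
Proof.
rewrite /weight /n_plus /n_minus !card_sumz /=.
have -> : e + \sum_l (v l : nat)%:Z + \sum_(l : slab) (pos_at l : nat)%:Z
    - (\sum_(l : slab) (~~ pos_at l : nat)%:Z) *+ 2 =
    e + \sum_l ((v l : nat)%:Z + (pos_at l : nat)%:Z - (~~ pos_at l : nat)%:Z *+ 2).
  by rewrite sumrB big_split /= sumrMnl !addrA.
rewrite -sumrB.
rewrite expfzDr// !expfz_sum ?oppr_eq0 ?oner_eq0// mulrCA -big_split /=; congr (_ * _).
apply: eq_bigr => l _; rewrite /slab_weight; case: (pos_at l); case: (v l) => /=.
- by rewrite expr1z mulN1r.
- by rewrite expr0z mul1r expr1z.
- by rewrite subrr expr0z mul1r.
- by rewrite sub0r exprN1 invrN invr1 mulN1r.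
Qed.

Definition slab_matrix v l : 'M[F]_2 :=
  if vertical v l then 1 else cup_cap d (turn_letter l) (turn_letter l).

Lemma essential_turn v (l : slab) : ~~ vertical v l ->
  essential_circles v = [set circle_of v (lower_level l, third_strand (turn_letter l))]%SET.
Proof.
move=> vl; apply/setP => C; rewrite !inE.
have [Cv|nC] := boolP (C \in circles v); last first.
  by apply/esym/negbTE; apply: contraNneq nC => ->; exact: circle_of_in.
have -> : essential C = ((lower_level l, third_strand (turn_letter l)) \in C).
  rewrite /essential -(winding_atE (lower_level l) Cv) /winding_at big_mkcond /=.
  have : ((lower_level l, left_at l) \in C) = ((lower_level l, right_at l) \in C).
    move: Cv => /circlesP[z ->]; rewrite !mem_circle_of ![same_circle _ z _]same_circle_sym.
    by apply: same_circle_equiv; apply: same_circle_turnback => //; rewrite inE eqxx.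
  rewrite /left_at /right_at -/(turn_letter l) !big_ord_recl big_ord0 /=.
  case: (turn_letter l) => [[|[|//]] hi].
  - have -> : left_strand (Ordinal hi : 'I_3.-1) = ord0 by exact: val_inj.
    have -> : right_strand (Ordinal hi : 'I_3.-1) = lift ord0 ord0 by exact: val_inj.
    have -> : third_strand (Ordinal hi) = lift ord0 (lift ord0 ord0) by exact: val_inj.
    by move=> ->; do 2 case: (_ \in C).
  - have -> : left_strand (Ordinal hi : 'I_3.-1) = lift ord0 ord0 by exact: val_inj.
    have -> : right_strand (Ordinal hi : 'I_3.-1) = lift ord0 (lift ord0 ord0) by exact: val_inj.
    have -> : third_strand (Ordinal hi) = ord0 by exact: val_inj.
    by move=> ->; do 2 case: (_ \in C).
move: Cv => /circlesP[z ->]; rewrite mem_circle_of -eq_circle_of.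
by [].
Qed.

Lemma trace_turns v l0 : ~~ vertical v l0 ->
  \tr (\prod_l slab_matrix v l) = d ^+ #|circles v|.-1.
Proof.
move=> vl0; have -> : \prod_l slab_matrix v l =
    \prod_(x <- [seq turn_letter l | l <- turns v]) cup_cap d x x.
  rewrite big_map big_filter /= enumT [RHS]big_mkcond [index_enum _]unlock /=.
  by apply: eq_bigr => l _; rewrite /slab_matrix; case: (vertical v l).
rewrite trace_cup_cap size_map ?(turns_gt0 vl0)// (card_circles_turns vl0) /=.
rewrite -sum1_card -prodrXr [in RHS]big_mkcond /=; apply: eq_bigr => r _.
rewrite !(nth_map l0) ?ltn_pmod ?(turns_gt0 vl0)// inE /loop_coef.
by case: eqP.
Qed.

End StateSum.

Section VertexSum.
Variables (F : fieldType) (q : F).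
Hypothesis q_neq0 : q != 0.
Variable w : braid_word 3.
Local Notation slab := 'I_(size w).
Implicit Types (v : vertex w) (l : slab).

(** With a turnback, the essential circle carries v_+ and the other labels are free, which gives [q]
    times the trace. On the vertical vertex the three essential circles give [3 q], while the trace
    of the identity accounts for [2 q]; the remaining [q] is the last term. *)
Lemma vertex_sum v :
  \sum_(f | is_labelled_resolution ((v, f) : state w) && (kgrading ((v, f) : state w) == 1))
    q ^ deg ((v, f) : state w) =
  q * \tr (\prod_l slab_matrix q v l) + (v == vertical_vertex w)%:R * q.
Proof.
rewrite (@sum_labellings 3 w v _ (fun f => kgrading ((v, f) : state w) == 1)
  (fun f => q ^ deg ((v, f) : state w))).
transitivity (\sum_(g | kgrading ((v, spread g) : state w) == 1)
    q ^ (\sum_(C : circle v) label_value (g C))).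
  by apply: eq_bigr => g _; rewrite deg_spread.
have [/forallP v_vert|] := boolP [forall l, vertical v l].
  have -> := vertical_vertexP v_vert; rewrite eqxx mul1r.
  have -> : \prod_l slab_matrix q (vertical_vertex w) l = 1.
    by apply: big1 => l _; rewrite /slab_matrix vertical_vertical.
  have v3 := card_circles_straight w; rewrite mxtrace1.
  have -> : q * 2%:R + q = q *+ 3 by ring.
  rewrite -(sum_three_labels q v3); apply: eq_bigl => g.
  by rewrite -deg_spread kgrading_sum /= essential_straight.
rewrite negb_forall => /existsP[l vl].
have -> : v == vertical_vertex w = false.
  by apply: contraNF vl => /eqP ->; exact: vertical_vertical.
rewrite mul0r addr0 (trace_turns q vl).
pose C0 : circle v := circle_through v (lower_level l, third_strand (turn_letter l)).
rewrite -(sum_trivial_labels C0 q_neq0); apply: eq_bigl => g.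
rewrite kgrading_sum /= (essential_turn vl) big_set1.
have -> : label_sign ((v, spread g) : state w)
    (circle_of v (lower_level l, third_strand (turn_letter l))) = label_value (g C0).
  rewrite label_sign_circle ?spread_labelled//=.
  by rewrite ffunE.
by case: (g C0).
Qed.

(** Both smoothings of a crossing with their weights, so that expanding a product of these matrices
    gives the sum over all vertices. *)
Definition braid_matrix (a : braid_letter 3) : 'M[F]_2 :=
  if a.2 then q%:M - q ^+ 2 *: cup_cap (q + q^-1) a.1 a.1
  else q^-1%:M - q ^- 2 *: cup_cap (q + q^-1) a.1 a.1.

Lemma slab_matrix_sum l :
  \sum_b slab_weight q l b *: (if b == ~~ pos_at l then 1 else
    cup_cap (q + q^-1) (turn_letter l) (turn_letter l)) = braid_matrix (letter_at l).
Proof.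
rewrite big_bool /= /slab_weight /braid_matrix /turn_letter /pos_at.
by case: (letter_at l).2 => /=; rewrite ?scaleNr scalemx1 // addrC.
Qed.

Lemma vertical_weight : \prod_(l : slab) slab_weight q l (~~ pos_at l) = q ^ writhe w.
Proof.
rewrite /writhe /n_plus /n_minus !card_sumz -sumrB expfz_sum//; apply: eq_bigr => l _.
by rewrite /slab_weight /=; case: (pos_at l).
Qed.

Lemma state_sumE : state_sum q w =
  q * (\tr (\prod_(a <- w) braid_matrix a) + q ^ writhe w).
Proof.
rewrite big_tnth; under [in RHS]eq_bigr => l _ do rewrite -slab_matrix_sum.
rewrite bigA_distr_bigA /= raddf_sum /=.
transitivity (\sum_(v : vertex w) (\prod_l slab_weight q l (v l)) *
    (q * \tr (\prod_l slab_matrix q v l) + (v == vertical_vertex w)%:R * q)).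
  rewrite /state_sum -(pair_big_dep xpredT (fun v f =>
    is_labelled_resolution ((v, f) : state w) && (kgrading ((v, f) : state w) == 1))
    (fun v f => state_term q ((v, f) : state w))) /=.
  apply: eq_bigr => v _; rewrite -vertex_sum mulr_sumr; apply: eq_bigr => f _.
  by rewrite /state_term /hgrading /qgrading (vertex_weight q_neq0) mulrC.
transitivity (\sum_(v : vertex w) (\prod_l slab_weight q l (v l)) *
      (q * \tr (\prod_l slab_matrix q v l)) +
    \sum_(v : vertex w) (\prod_l slab_weight q l (v l)) *
      ((v == vertical_vertex w)%:R * q)).
  by rewrite -big_split /=; apply: eq_bigr => v _; rewrite mulrDr.
rewrite mulrDr; congr (_ + _).
  rewrite mulr_sumr; apply: eq_bigr => v _.
  by rewrite scaler_prod mxtraceZ mulrCA.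
rewrite (bigD1 (vertical_vertex w))//= [X in _ + X]big1 => [|v /negPf ->].
  rewrite eqxx mul1r addr0 mulrC -vertical_weight; congr (_ * _).
  by apply: eq_bigr => l _; rewrite ffunE.
by rewrite mul0r mulr0.
Qed.

End VertexSum.

(** * From the annular Jones polynomial to the Burau trace *)

Section JonesTrace.
Variables (F : fieldType) (q : F).
Hypothesis q_neq0 : q != 0.

(** [S] is left free so that two words can be compared along a common list of degrees. *)
Lemma state_sum_jones (w : braid_word 3) (S : seq int) :
  uniq S -> (forall x : state w, qgrading x \in S) ->
  state_sum q w = \sum_(j <- S) (annular_jones w j 1)%:~R * q ^ j.
Proof.
move=> Su Sx; under [RHS]eq_bigr => j _.
  rewrite (annular_jonesE (annular_square_zero j 1 (@winding_bound w))).
  rewrite rmorph_sum /= mulr_suml.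
  over.
rewrite (exchange_big_dep (fun x : state w => is_labelled_resolution x && (kgrading x == 1))) /=.
  apply: eq_bigr => x /andP[lx kx].
  rewrite lx kx -big_filter (eq_filter (a2 := pred1 (qgrading x))); last first.
    by move=> j /=; rewrite andbT eq_sym.
  rewrite filter_pred1_uniq ?Sx// big_seq1 /state_term; congr (_ * _).
  by rewrite rmorphXz ?unitrN1//= rmorphN1.
by move=> j x _ /and3P[-> _ ->].
Qed.

Lemma state_sum_eq (w w' : braid_word 3) :
  (forall j k, annular_jones w j k = annular_jones w' j k) ->
  state_sum q w = state_sum q w'.
Proof.
move=> ww'; pose S := undup ([seq qgrading x | x : state w] ++ [seq qgrading x | x : state w']).
rewrite (@state_sum_jones w S) ?(@state_sum_jones w' S) ?undup_uniq //.
- by apply: eq_bigr => j _; rewrite ww'.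
- by move=> x; rewrite mem_undup mem_cat orbC map_f ?mem_enum.
- by move=> x; rewrite mem_undup mem_cat map_f ?mem_enum.
Qed.

(* The reduced Burau matrices at t = - s. *)
Definition burau (s : F) (a : braid_letter 3) : 'M[F]_2 :=
  \matrix_(i, j)
    if i == a.1 then
      if j == a.1 then (if a.2 then s else s^-1)
      else if a.1 == ord0 then (if a.2 then 1 else - s^-1) else (if a.2 then - s else 1)
    else (i == j)%:R.

Definition burau_prod s (w : braid_word 3) : 'M[F]_2 := \prod_(a <- w) burau s a.

Definition letter_exp (a : braid_letter 3) : int := if a.2 then 1 else -1.
Definition exp_sum (w : braid_word 3) : int := \sum_(a <- w) letter_exp a.

Lemma writhe_exp_sum w : writhe w = exp_sum w.
Proof.
rewrite /writhe /n_plus /n_minus !card_sumz -sumrB /exp_sum [RHS]big_tnth; apply: eq_bigr => l _.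
by rewrite /pos_at /letter_exp /= /letter_at; case: (tnth _ l).2.
Qed.

(** The change of basis from the two Temperley-Lieb diagrams to the Burau basis. *)
Definition burau_base : 'M[F]_2 := diag_mx (\row_j if j == ord0 then 1 else - q).

Lemma burau_conj a : burau_base * braid_matrix q a =
  q ^ letter_exp a *: (burau (- q ^+ 2) a * burau_base).
Proof.
case: a => i b; rewrite /burau_base /braid_matrix /cup_cap /loop_coef /letter_exp.
have [->|->] := ord2_cases i; case: b; apply: matrix2P;
  rewrite [RHS]mxE !mulmx2 !mxE /= ?expr1z ?exprN1; field; rewrite ?oppr_eq0 ?expf_neq0 ?q_neq0 //.
Qed.

Lemma trace_braid_matrix w :
  \tr (\prod_(a <- w) braid_matrix q a) = q ^ writhe w * \tr (burau_prod (- q ^+ 2) w).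
Proof.
have base_unit : burau_base \is a GRing.unit.
  rewrite unitmxE det_diag !big_ord_recl big_ord0 !mxE /=.
  by rewrite mul1r mulr1 unitfE oppr_eq0.
have e : burau_base * \prod_(a <- w) braid_matrix q a =
    q ^ exp_sum w *: (burau_prod (- q ^+ 2) w * burau_base).
  rewrite /burau_prod /exp_sum; elim: w => [|a w IH].
    by rewrite !big_nil mulr1 mul1r expr0z scale1r.
  by rewrite !big_cons mulrA burau_conj -scalerAl -!mulrA IH -scalerAr scalerA expfzDr.
rewrite -[X in \tr X](mulKr base_unit) e -scalerAr mxtraceZ writhe_exp_sum; congr (_ * _).
by rewrite -mulmxE mxtrace_mulC -[_ *m _]/(_ * _) mulrK.
Qed.

Lemma jones_burau (w w' : braid_word 3) :
  (forall j k, annular_jones w j k = annular_jones w' j k) -> writhe w = writhe w' ->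
  \tr (burau_prod (- q ^+ 2) w) = \tr (burau_prod (- q ^+ 2) w').
Proof.
move=> /state_sum_eq; rewrite !state_sumE// !trace_braid_matrix => + ww'; rewrite ww'.
by move=> /(mulfI q_neq0) /addIr /mulfI -> //; rewrite expfz_neq0.
Qed.

End JonesTrace.

(** * Conjugacy in the braid group on three strands *)

Section ThreeStrandBraids.
Local Notation word := (braid_word 3).
Implicit Types (u v w : word) (a : braid_letter 3).

(** The Artin presentation of B_3; [braid_triple] with [i = j] is an instance of reflexivity. *)
Inductive braid_eq : word -> word -> Prop :=
| braid_refl w : braid_eq w w
| braid_sym u v : braid_eq u v -> braid_eq v u
| braid_trans u v w : braid_eq u v -> braid_eq v w -> braid_eq u w
| braid_cat u u' v v' : braid_eq u u' -> braid_eq v v' -> braid_eq (u ++ v) (u' ++ v')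
| braid_cancel (i : 'I_2) b : braid_eq [:: (i, b); (i, ~~ b)] [::]
| braid_triple (i j : 'I_2) :
    braid_eq [:: (i, true); (j, true); (i, true)] [:: (j, true); (i, true); (j, true)].

#[local] Instance braid_equivalence : RelationClasses.Equivalence braid_eq.
Proof. by split; [exact: braid_refl | exact: braid_sym | exact: braid_trans]. Qed.

#[local] Instance cat_braid : Morphisms.Proper
  (Morphisms.respectful braid_eq (Morphisms.respectful braid_eq braid_eq)) (@cat _).
Proof. by move=> u u' uu' v v' vv'; exact: braid_cat. Qed.

#[local] Instance cons_braid a : Morphisms.Proper (Morphisms.respectful braid_eq braid_eq) (cons a).
Proof. by move=> u v uv; exact: (braid_cat (braid_refl [:: a]) uv). Qed.

Definition inv_letter a : braid_letter 3 := (a.1, ~~ a.2).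
Definition inv_word w : word := rev (map inv_letter w).

Lemma inv_wordr w : braid_eq (w ++ inv_word w) [::].
Proof.
elim: w => [|[i b] w IH]; first exact: braid_refl.
rewrite /inv_word /= rev_cons -cats1 catA -/(inv_word w) -cat1s.
have -> : [:: (i, b)] ++ (w ++ inv_word w) ++ [:: inv_letter (i, b)] =
  [:: (i, b)] ++ (w ++ inv_word w) ++ [:: (i, ~~ b)] by [].
by rewrite -> IH; exact: braid_cancel.
Qed.

Lemma inv_wordK w : inv_word (inv_word w) = w.
Proof.
rewrite /inv_word map_rev revK -map_comp -[RHS]map_id; apply: eq_map => -[i b].
by rewrite /inv_letter /= negbK.
Qed.

Lemma inv_wordl w : braid_eq (inv_word w ++ w) [::].
Proof. by rewrite -{2}(inv_wordK w); exact: inv_wordr. Qed.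

Lemma braid_cancel_l u v w : braid_eq (u ++ v) (u ++ w) -> braid_eq v w.
Proof.
move=> e; rewrite -[v]cat0s -[w]cat0s; rewrite <- (inv_wordl u).
by rewrite -!catA; apply: braid_cat => //; exact: braid_refl.
Qed.

Definition s1 : braid_letter 3 := (ord0, true).
Definition s2 : braid_letter 3 := (ord_max, true).
Definition half_twist : word := [:: s1; s2; s1].
Definition full_twist : word := half_twist ++ half_twist.

Lemma half_twist1 : braid_eq (half_twist ++ [:: s1]) (s2 :: half_twist).
Proof.
exact: braid_cat (braid_triple ord0 ord_max) (braid_refl [:: s1]).
Qed.

Lemma half_twist2 : braid_eq (half_twist ++ [:: s2]) (s1 :: half_twist).
Proof.
exact: braid_cat (braid_refl [:: s1]) (braid_triple ord_max ord0).
Qed.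

Lemma full_twist_letter i : braid_eq (full_twist ++ [:: (i, true)]) ((i, true) :: full_twist).
Proof.
rewrite /full_twist -catA.
have [->|->] := ord2_cases i.
  rewrite -> half_twist1; rewrite -cat1s catA; rewrite -> half_twist2; exact: braid_refl.
rewrite -> half_twist2; rewrite -cat1s catA; rewrite -> half_twist1; exact: braid_refl.
Qed.

Lemma full_twist_central w : braid_eq (full_twist ++ w) (w ++ full_twist).
Proof.
elim: w => [|a w IH]; first by rewrite cats0; exact: braid_refl.
suff h : braid_eq (full_twist ++ [:: a]) (a :: full_twist).
  rewrite -[a :: w]cat1s catA; rewrite -> h; rewrite -cat1s -!catA.
  by apply: braid_cat => //; exact: braid_refl.
case: a => i [|]; first exact: full_twist_letter.
apply: (@braid_cancel_l [:: (i, true)]); transitivity full_twist; last first.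
  exact: braid_sym (braid_cat (braid_cancel i true) (braid_refl full_twist)).
have e : braid_eq ([:: (i, true)] ++ full_twist) (full_twist ++ [:: (i, true)]).
  exact: braid_sym (full_twist_letter i).
rewrite catA; rewrite -> e; rewrite -catA -[X in braid_eq _ X]cats0.
exact: braid_cat (braid_refl _) (braid_cancel i true).
Qed.

Definition twists k : word := flatten (nseq k full_twist).

Lemma twistsD k l : twists (k + l) = twists k ++ twists l.
Proof. by rewrite /twists nseqD flatten_cat. Qed.

Lemma twists_central k w : braid_eq (twists k ++ w) (w ++ twists k).
Proof.
elim: k => [|k IH]; first by rewrite cats0; exact: braid_refl.
have -> : twists k.+1 = full_twist ++ twists k by [].
rewrite -catA; rewrite -> IH; rewrite catA; rewrite -> full_twist_central.
by rewrite -catA; exact: braid_refl.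
Qed.

(** Full twists are added on both sides, which expresses equality modulo the centre without negative
    powers. *)
Definition central_eq u v : Prop := exists k l, braid_eq (twists k ++ u) (twists l ++ v).

#[local] Instance central_equivalence : RelationClasses.Equivalence central_eq.
Proof.
split=> [u|u v [k [l e]]|u v w [k [l e]] [k' [l' e']]].
- by exists 0%N, 0%N; exact: braid_refl.
- by exists l, k; exact: braid_sym.
exists (k' + k)%N, (l + l')%N; rewrite !twistsD -!catA; rewrite -> e.
rewrite !catA; rewrite -> (twists_central k'); rewrite -!catA; rewrite -> e'.
exact: braid_refl.
Qed.

#[local] Instance cat_central : Morphisms.Proper
  (Morphisms.respectful central_eq (Morphisms.respectful central_eq central_eq)) (@cat _).
Proof.
move=> u u' [k [l e]] v v' [k' [l' e']].
exists (k + k')%N, (l + l')%N; rewrite !twistsD -!catA.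
rewrite [twists k' ++ _]catA [twists l' ++ _]catA.
rewrite -> (twists_central k' u); rewrite -> (twists_central l' u').
by rewrite -!catA; rewrite -> e'; rewrite !catA; rewrite -> e; exact: braid_refl.
Qed.

#[local] Instance cons_central a :
  Morphisms.Proper (Morphisms.respectful central_eq central_eq) (cons a).
Proof.
by move=> u v uv; exact: (@cat_central [:: a] [:: a] (RelationClasses.reflexivity _) u v uv).
Qed.

#[local] Instance braid_central : RelationClasses.subrelation braid_eq central_eq.
Proof. by move=> u v e; exists 0%N, 0%N. Qed.

Lemma twist_trivial : central_eq full_twist [::].
Proof. by exists 0%N, 1%N; exact: braid_refl. Qed.

(* Modulo the centre, half_twist and rot generate PSL(2, Z) = Z/2 * Z/3. *)
Definition rot : word := [:: s1; s2].

Lemma rot3 : central_eq (rot ++ rot ++ rot) [::].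
Proof.
transitivity full_twist; last exact: twist_trivial.
apply: braid_central.
exact: braid_cat (braid_refl half_twist) (braid_triple ord_max ord0).
Qed.

Definition block (b : bool) : braid_letter 3 := if b then s1 else (ord_max, false).
Definition rots (k : nat) : word := flatten (nseq k rot).

(** A reduced word of Z/2 * Z/3 alternates nontrivial powers of [rot] with half twists; cut after
    each half twist, it becomes a word in the two blocks. *)
Lemma block_rots b : central_eq [:: block b] (rots b.+1 ++ half_twist).
Proof.
case: b.
  have -> : rots 2 ++ half_twist = (rot ++ rot ++ rot) ++ [:: s1] by [].
  by rewrite -> rot3; reflexivity.
have -> : rots 1 ++ half_twist = rot ++ half_twist by [].
have e : central_eq rot ([:: (ord_max, false)] ++ half_twist).
  apply: braid_central; apply: braid_sym.
  apply: (@braid_trans _ ([:: (ord_max, false)] ++ [:: s2; s1; s2])).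
    exact: braid_cat (braid_refl _) (braid_triple ord0 ord_max).
  exact: braid_cat (braid_cancel ord_max false) (braid_refl rot).
rewrite -> e; rewrite -catA -/full_twist; rewrite -> twist_trivial.
by rewrite cats0; reflexivity.
Qed.

Definition halves (h : seq bool) : word :=
  flatten [seq (if b then half_twist else rot) | b <- h].

Lemma letter_halves a : exists h, central_eq [:: a] (halves h).
Proof.
have half2 : central_eq (half_twist ++ half_twist) [::] by exact: twist_trivial.
case: a => i b; have [->|->] := ord2_cases i.
- case: b; first by exists [:: false; false; true]; exact: (block_rots true).
  exists [:: true; false].
  have -> : halves [:: true; false] = half_twist ++ rot by [].
  have e : central_eq rot (half_twist ++ [:: (ord0, false)]).
    apply: braid_central; apply: braid_sym.
    exact: braid_cat (braid_refl rot) (braid_cancel ord0 true).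
  by rewrite -> e; rewrite catA; rewrite -> half2; reflexivity.
- case: b; last by exists [:: false; true]; exact: (block_rots false).
  exists [:: true; false; false].
  have e : central_eq ([:: s2] ++ rot) half_twist.
    by apply: braid_central; exact: (braid_triple ord_max ord0).
  have -> : halves [:: true; false; false] = half_twist ++ rot ++ rot by [].
  rewrite <- e; rewrite -catA; rewrite -> rot3; reflexivity.
Qed.

Lemma word_halves w : exists h, central_eq w (halves h).
Proof.
elim: w => [|a w [u IH]]; first by exists [::]; reflexivity.
have [v ea] := letter_halves a; exists (v ++ u).
rewrite /halves map_cat flatten_cat -/(halves u) -/(halves v) -cat1s.
by rewrite -> ea; rewrite -> IH; reflexivity.
Qed.

Definition blocks (P : seq bool) : word := map block P.
Definition half_pow (b : bool) : word := if b then half_twist else [::].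

(** Reduced words built one syllable at a time. A further half twist closes a pending power of [rot]
    into a block; if none is pending, it cancels the half twist of the last block, or the initial
    one. *)
Lemma normal_form w : exists b P k,
  (k < 3)%N /\ central_eq w (half_pow b ++ blocks P ++ rots k).
Proof.
have [u wu] := word_halves w; suff [b [P [k [k3 e]]]] : exists b P k,
    (k < 3)%N /\ central_eq (halves u) (half_pow b ++ blocks P ++ rots k).
  by exists b, P, k; split=> //; rewrite -> wu.
elim/last_ind: u {w wu} => [|u c [b [P [k [k3 IH]]]]].
  by exists false, [::], 0%N; split=> //; reflexivity.
rewrite -cats1 /halves map_cat flatten_cat -/(halves u).
have : central_eq (halves u ++ (if c then half_twist else rot))
    ((half_pow b ++ blocks P ++ rots k) ++ (if c then half_twist else rot)).
  by rewrite -> IH; reflexivity.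
rewrite [flatten _]cats0 -catA -[(blocks P ++ _) ++ _]catA; case: c => [|].
  case: k k3 {IH} => [|k] k3 e.
    case/lastP: P e => [|P c] e.
      exists (~~ b), [::], 0%N; split=> //; rewrite -> e.
      by case: b {e} => /=; [exact: twist_trivial | reflexivity].
    exists b, P, c.+1; split; first by case: c {e}.
    rewrite -> e.
    have -> : blocks (rcons P c) ++ rots 0 ++ half_twist = blocks P ++ [:: block c] ++ half_twist.
      by rewrite /blocks map_rcons -cats1 -catA.
    rewrite -> (block_rots c); rewrite -[(rots c.+1 ++ _) ++ _]catA.
    have half2 : central_eq (half_twist ++ half_twist) [::] by exact: twist_trivial.
    by rewrite -> half2; rewrite cats0; reflexivity.
  exists b, (rcons P (k == 1%N)), 0%N; split=> //; rewrite -> e.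
  rewrite /blocks map_rcons -cats1 -/(blocks P) cats0.
  rewrite -> (block_rots (k == 1%N)).
  by case: k {e} k3 => [|[|]] //= _; reflexivity.
move=> e; case: (ltnP k.+1 3) => k2.
  exists b, P, k.+1; split=> //; rewrite -> e.
  rewrite -[k.+1]addn1 /rots nseqD flatten_cat; reflexivity.
exists b, P, 0%N; split=> //; rewrite -> e.
have -> : k = 2%N by lia.
have -> : rots 2 ++ rot = rot ++ rot ++ rot by [].
by rewrite -> rot3; rewrite cats0; reflexivity.
Qed.

Definition central_conj u v : Prop := exists g, central_eq (g ++ u) (v ++ g).

Lemma central_conj_trans u v w : central_conj u v -> central_conj v w -> central_conj u w.
Proof.
move=> [g e] [h e']; exists (h ++ g); rewrite -catA; rewrite -> e.
by rewrite !catA; rewrite -> e'; reflexivity.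
Qed.

Lemma central_conj_refl u : central_conj u u.
Proof. by exists [::]; rewrite cats0; reflexivity. Qed.

Lemma central_conj_eq u v : central_eq u v -> central_conj u v.
Proof. by move=> e; exists [::]; rewrite cats0. Qed.

Lemma central_conj_rot u v : central_conj (u ++ v) (v ++ u).
Proof. by exists v; rewrite !catA; reflexivity. Qed.

(** Conjugation brings the two ends together, where they merge. A merge that does not finish the
    reduction shortens [P], on whose size the induction runs. *)
Lemma cyclic_normal_form w : exists v, central_conj w v /\
  (v \in [:: half_twist; rots 1; rots 2] \/ exists P, v = blocks P).
Proof.
have [b [P [k [k3]]]] := normal_form w.
move=> /central_conj_eq; have [m] := ubnP (size P).
have half2 : central_eq (half_twist ++ half_twist) [::] by exact: twist_trivial.
elim: m b P k k3 => // m IH b P k k3 Pm; case: b => [|] e.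
- case: k k3 e => [|k] k3 e.
    case/lastP: P Pm e => [|P c] Pm e.
      by exists half_twist; split; [exact: e | left; rewrite inE eqxx].
    apply: (IH false P c.+1); [by case: c {Pm e} | by rewrite size_rcons in Pm |].
    apply: central_conj_trans e _; apply: central_conj_trans (central_conj_rot _ _) _.
    apply: central_conj_eq.
    have -> : (blocks (rcons P c) ++ rots 0) ++ half_twist = blocks P ++ [:: block c] ++ half_twist.
      by rewrite /blocks map_rcons -cats1 cats0 -catA.
    rewrite -> (block_rots c); rewrite -[(rots c.+1 ++ _) ++ _]catA.
    by rewrite -> half2; rewrite cats0; reflexivity.
  exists (blocks (rcons P (k == 1%N))); split; last by right; eexists.
  apply: central_conj_trans e _; apply: central_conj_trans (central_conj_rot _ _) _.
  apply: central_conj_eq; rewrite /blocks map_rcons -cats1 -/(blocks P) -catA.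
  rewrite -> (block_rots (k == 1%N)).
  by case: k k3 => [|[|]] //= _; reflexivity.
- case: k k3 e => [|k] k3 e.
    exists (blocks P); split; last by right; eexists.
    by rewrite cats0 in e.
  case: P Pm e => [|c P] Pm e.
    exists (rots k.+1); split=> //; left.
    by case: k k3 {e} => [|[|]] // _; rewrite !inE eqxx ?orbT.
  (* The final power of [rot], moved to the front, joins that of the first block: exponent 3 cancels
     and shortens the word, 2 gives the block [true], and 4, that is 1 modulo 3, the block
     [false]. *)
  have {}e : central_conj w (rots (k.+1 + c.+1) ++ half_twist ++ blocks P).
    apply: central_conj_trans e _.
    apply: central_conj_trans (central_conj_rot (blocks (c :: P)) _) _.
    apply: central_conj_eq; rewrite /rots nseqD flatten_cat -/(rots k.+1) -/(rots c.+1) -catA.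
    have -> : blocks (c :: P) = [:: block c] ++ blocks P by [].
    by rewrite -> (block_rots c); rewrite -[(rots c.+1 ++ _) ++ _]catA; reflexivity.
  case: k k3 e => [|[|//]] _; case: c {Pm} (Pm : (size P < m)%N) => Pm e.
  + apply: (IH true P 0%N) => //; apply: central_conj_trans e _; apply: central_conj_eq.
    by rewrite -> rot3; rewrite cats0; reflexivity.
  + exists (blocks (true :: P)); split; last by right; eexists.
    apply: central_conj_trans e _; apply: central_conj_eq; rewrite catA.
    by rewrite <- (block_rots true); reflexivity.
  + exists (blocks (false :: P)); split; last by right; eexists.
    apply: central_conj_trans e _; apply: central_conj_eq.
    have -> : rots (2 + 2) = (rot ++ rot ++ rot) ++ rots 1 by [].
    rewrite -> rot3; rewrite catA.
    by rewrite <- (block_rots false); reflexivity.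
  + apply: (IH true P 0%N) => //; apply: central_conj_trans e _; apply: central_conj_eq.
    by rewrite -> rot3; rewrite cats0; reflexivity.
Qed.

End ThreeStrandBraids.

(** * Burau traces *)

Lemma exp_sum_cat (u v : braid_word 3) : exp_sum (u ++ v) = exp_sum u + exp_sum v.
Proof. exact: big_cat. Qed.

Lemma exp_sum_braid (u v : braid_word 3) : braid_eq u v -> exp_sum u = exp_sum v.
Proof.
elim=> [//|{}u {}v _ -> //|u1 u2 u3 _ -> _ -> //|u1 u2 u3 u4 _ e _ e'|i b|i j].
- by rewrite !exp_sum_cat e e'.
- by rewrite /exp_sum !big_cons big_nil /letter_exp; case: b.
- by rewrite /exp_sum !big_cons !big_nil.
Qed.

Lemma exp_sum_twists k : exp_sum (twists k) = (6 * k)%N%:Z.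
Proof.
elim: k => [|k IH]; first by rewrite /exp_sum big_nil.
rewrite -[twists k.+1]/(full_twist ++ twists k) exp_sum_cat IH.
by rewrite /exp_sum /full_twist /half_twist /= !big_cons big_nil /letter_exp /=; lia.
Qed.

Section Burau.
Variables (F : fieldType) (s : F).
Hypothesis s_neq0 : s != 0.
Local Notation word := (braid_word 3).
Implicit Types (u v w : word).

Lemma burau_prod_cat u v : burau_prod s (u ++ v) = burau_prod s u * burau_prod s v.
Proof. exact: big_cat. Qed.

Lemma burau_braid u v : braid_eq u v -> burau_prod s u = burau_prod s v.
Proof.
elim=> [//|{}u {}v _ -> //|u1 u2 u3 _ -> _ -> //|u1 u2 u3 u4 _ e _ e'|i b|i j].
- by rewrite !burau_prod_cat e e'.
- rewrite /burau_prod !big_cons big_nil mulr1.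
  have [->|->] := ord2_cases i; case: b; apply: matrix2P;
    rewrite mulmx2 !mxE /=; field; rewrite ?s_neq0 //.
- rewrite /burau_prod !big_cons big_nil mulr1.
  have [->|->] := ord2_cases i; have [->|->] := ord2_cases j; apply: matrix2P;
    rewrite !mulmx2 !mxE /=; ring.
Qed.

Lemma burau_twists k : burau_prod s (twists k) = ((- s ^+ 3) ^+ k)%:M.
Proof.
elim: k => [|k IH]; first by rewrite /burau_prod big_nil.
rewrite -[twists k.+1]/(full_twist ++ twists k) burau_prod_cat IH.
have -> : burau_prod s full_twist = (- s ^+ 3)%:M.
  rewrite /burau_prod /full_twist /half_twist /= !big_cons big_nil mulr1.
  by apply: matrix2P; rewrite !mulmx2 !mxE /=; ring.
by rewrite [in RHS]exprS scalar_mxM mulmxE.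
Qed.

Lemma burau_inv_word w : burau_prod s w * burau_prod s (inv_word w) = 1.
Proof. by rewrite -burau_prod_cat (burau_braid (inv_wordr w)) /burau_prod big_nil. Qed.

Lemma burau_inv_wordl w : burau_prod s (inv_word w) *m burau_prod s w = 1%:M.
Proof. by rewrite mulmxE -burau_prod_cat (burau_braid (inv_wordl w)) /burau_prod big_nil. Qed.

End Burau.

(** The numbers of twists are unknown; a full twist has exponent sum 6 and the scalar Burau matrix
    [- s^3], so exponent sum and trace each give a relation between them. *)
Lemma central_conj_invariants (F : fieldType) (u v : braid_word 3) :
  central_conj u v -> exists g k l,
  [/\ braid_eq (twists k ++ g ++ u) (twists l ++ v ++ g),
      (6 * k)%N%:Z + exp_sum u = (6 * l)%N%:Z + exp_sum v &
      forall s : F, s != 0 ->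
      (- s ^+ 3) ^+ k * \tr (burau_prod s u) = (- s ^+ 3) ^+ l * \tr (burau_prod s v)].
Proof.
move=> [g [k [l e]]]; exists g, k, l; split=> //.
  by have := exp_sum_braid e; rewrite !exp_sum_cat !exp_sum_twists; lia.
move=> s s0; have := congr1 (fun M => \tr (M * burau_prod s (inv_word g))) (burau_braid s0 e).
rewrite /= !burau_prod_cat !burau_twists -!mulrA burau_inv_word// mulr1.
rewrite -!mulmxE !mul_scalar_mx !mxtraceZ => <-.
by rewrite mxtrace_mulC -mulmxA burau_inv_wordl// mulmx1.
Qed.

(** * The two lowest coefficients of the trace of a positive word *)

Section PositiveWords.
Implicit Types (P : seq bool) (p r : {poly rat}).

(** The difference vanishes at - 1, - 4, - 9 and so on, more points than its degree allows. *)
Lemma poly_eq_neg_squares p r :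
  (forall q : rat, q != 0 -> p.[- q ^+ 2] = r.[- q ^+ 2]) -> p = r.
Proof.
move=> pr; apply/eqP; rewrite -subr_eq0; apply/eqP.
pose f (i : nat) : rat := - (i.+1)%:R ^+ 2.
apply: (@roots_geq_poly_eq0 _ _ [seq f i | i <- iota 0 (size (p - r))]).
- apply/allP => _ /mapP[i _ ->]; rewrite rootE !hornerE pr ?subrr//.
- rewrite map_inj_uniq ?iota_uniq// => i j /oppr_inj /eqP.
  by rewrite eqrXn2 ?ler0n// eqr_nat => /eqP[].
- by rewrite size_map size_iota.
Qed.

(** The Burau matrices of the blocks, that of [sigma_2^-1] multiplied by [s] to clear the
    denominator. *)
Definition block_poly (b : bool) : 'M[{poly rat}]_2 :=
  \matrix_(i, j) if b then (if i == ord0 then (if j == ord0 then 'X else 1) else (i == j)%:R)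
                 else (if j == ord0 then 'X else (i == j)%:R).

Definition trace_poly P : {poly rat} := \tr (\prod_(b <- P) block_poly b).

Lemma horner_block_poly (s : rat) b : s != 0 ->
  map_mx (horner_eval s) (block_poly b) = (if b then 1 else s) *: burau s (block b).
Proof.
move=> s0; case: b; apply: matrix2P; rewrite !mxE /= /horner_eval ?hornerE //; field; rewrite ?s0 //.
Qed.

Lemma horner_trace_poly (s : rat) P : s != 0 ->
  (trace_poly P).[s] = s ^+ count negb P * \tr (burau_prod s (blocks P)).
Proof.
move=> s0; rewrite /trace_poly -[LHS]/(horner_eval s _) -trace_map_mx -mxtraceZ; congr (\tr _).
elim: P => [|b P IH]; first by rewrite /burau_prod !big_nil expr0 scale1r rmorph1.
have -> : burau_prod s (blocks (b :: P)) = burau s (block b) * burau_prod s (blocks P).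
  exact: big_cons.
rewrite big_cons rmorphM /= IH horner_block_poly// -scalerAr -scalerAl scalerA -mulrC; congr (_ *: _).
by case: b => /=; rewrite ?mul1r // add1n exprS.
Qed.

Lemma exp_sum_blocks P : exp_sum (blocks P) = (count id P)%:Z - (count negb P)%:Z.
Proof.
elim: P => [|b P IH]; first by rewrite /exp_sum big_nil.
rewrite /exp_sum big_cons -/(exp_sum (blocks P)) IH /letter_exp.
by case: b => /=; lia.
Qed.

Fixpoint rises (prev : bool) P : nat :=
  if P is b :: P' then (~~ prev && b) + rises b P' else 0.

Lemma row_block (u : 'rV[{poly rat}]_2) b :
  (u *m block_poly b) 0 ord0 = (u 0 ord0 + (if b then 0 else u 0 ord_max)) * 'X /\
  (u *m block_poly b) 0 ord_max = (if b then u 0 ord0 else 0) + u 0 ord_max.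
Proof.
rewrite !mxE !big_ord_recl !big_ord0 (_ : lift ord0 ord0 = ord_max); last exact: val_inj.
by rewrite !mxE /=; case: b; split; rewrite /=; ring.
Qed.

(* Modulo X^2, reading P changes the row (c, d) = (e X, 1 + m X), where e tells
   whether the previous block is false, into a row whose second entry counts the rises. *)
Lemma row_step (u : 'rV[{poly rat}]_2) (prev b : bool) (m : nat) :
  (u 0 ord0)`_0 = 0 -> (u 0 ord0)`_1 = (~~ prev)%:R ->
  (u 0 ord_max)`_0 = 1 -> (u 0 ord_max)`_1 = m%:R ->
  let u' := u *m block_poly b in
  [/\ (u' 0 ord0)`_0 = 0, (u' 0 ord0)`_1 = (~~ b)%:R,
      (u' 0 ord_max)`_0 = 1 & (u' 0 ord_max)`_1 = (m + (~~ prev && b))%N%:R].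
Proof.
move=> c0 c1 d0 d1 u'; have [e0 e1] := row_block u b.
rewrite e0 e1 !coefMX !coefD /= c0 d0 d1; case: b {u' e0 e1}; rewrite ?coef0 ?c0 ?c1 ?d0 ?add0r ?addr0.
  by split=> //; rewrite andbT natrD addrC.
by split=> //; rewrite andbF addn0.
Qed.

Lemma row_rises P : forall (u : 'rV[{poly rat}]_2) (prev : bool) (m : nat),
  (u 0 ord0)`_0 = 0 -> (u 0 ord0)`_1 = (~~ prev)%:R ->
  (u 0 ord_max)`_0 = 1 -> (u 0 ord_max)`_1 = m%:R ->
  let u' := u *m \prod_(b <- P) block_poly b in
  [/\ (u' 0 ord0)`_0 = 0, (u' 0 ord_max)`_0 = 1 & (u' 0 ord_max)`_1 = (m + rises prev P)%N%:R].
Proof.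
elim: P => [|b P IH] u prev m c0 c1 d0 d1 /=.
  by rewrite big_nil mulmx1 addn0.
rewrite big_cons -mulmxE mulmxA addnA.
have [c0' c1' d0' d1'] := row_step b c0 c1 d0 d1.
exact: IH.
Qed.

(** Applied to the first row of a first block, this shows that the first diagonal entry of a longer
    product starts in degree 2; both low coefficients of the trace then come from the second
    diagonal entry. *)
Lemma row_top P : forall u : 'rV[{poly rat}]_2,
  (u 0 ord0)`_0 = 0 -> (u 0 ord_max)`_0 = 0 \/ all id P ->
  let u' := u *m \prod_(b <- P) block_poly b in
  (u' 0 ord0)`_0 = 0 /\ ((0 < size P)%N || ((u 0 ord0)`_1 == 0) -> (u' 0 ord0)`_1 = 0).
Proof.
elim: P => [|b P IH] u c0 d0 /=; first by rewrite big_nil mulmx1; split=> // /eqP.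
rewrite big_cons -mulmxE mulmxA; have [e0 e1] := row_block u b.
have c0' : ((u *m block_poly b) 0 ord0)`_0 = 0 by rewrite e0 coefMX.
have c1' : ((u *m block_poly b) 0 ord0)`_1 = 0.
  rewrite e0 coefMX coefD c0 add0r /=; case: b d0 {e0 e1 c0'}; rewrite ?coef0 //=.
  by case.
have d0' : ((u *m block_poly b) 0 ord_max)`_0 = 0 \/ all id P.
  case: d0 => [d0|/= /andP[_ Pt]]; last by right.
  by left; rewrite e1 coefD d0 addr0; case: b {e0 e1 c0' c1'}; rewrite ?coef0.
by have [-> t1] := IH _ c0' d0'; split=> // _; apply: t1; rewrite c1' eqxx orbT.
Qed.

(** In such a word no [true] follows a [false] across the end, so [rises true] is the cyclic
    count. *)
Definition trace_start P := all id P \/ exists P', P = false :: P'.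

Lemma trace_poly_coef P : trace_start P -> (0 < size P)%N ->
  (trace_poly P)`_0 = 1 /\ ((1 < size P)%N -> (trace_poly P)`_1 = (rises true P)%:R).
Proof.
case: P => [//|b P] start _.
pose u i := row i (block_poly b); pose M := \prod_(c <- P) block_poly c.
have traceE : trace_poly (b :: P) = (u ord0 *m M) 0 ord0 + (u ord_max *m M) 0 ord_max.
  rewrite /trace_poly big_cons /mxtrace !big_ord_recl big_ord0 addr0 -/M.
  rewrite (_ : lift ord0 ord0 = ord_max); last exact: val_inj.
  by rewrite /u -!row_mul !mxE.
have [| | | |_ e0 e1] := row_rises P (u := u ord_max) (prev := b) (m := 0).
- by rewrite !mxE /=; case: b {start u traceE}; rewrite ?coefX ?coef0.
- by rewrite !mxE /=; case: b {start u traceE}; rewrite ?coefX ?coef0.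
- by rewrite !mxE /=; case: b {start u traceE}; rewrite coef1.
- by rewrite !mxE /=; case: b {start u traceE}; rewrite coef1.
have [||t0 t1] := @row_top P (u ord0).
- by rewrite !mxE /=; case: b {start u traceE e0 e1}; rewrite coefX.
- rewrite /u !mxE /=; case: b start {u traceE e0 e1} => start /=; last by left; rewrite coef0.
  by right; case: start => [/andP[]|[]].
rewrite traceE !coefD t0 e0 e1 add0r; split=> // P1.
by rewrite t1 ?add0r //; rewrite (P1 : (0 < size P)%N).
Qed.

(** Each rise uses two letters, and equality leaves room for no other letter. The two values of
    [prev] are treated together because the induction passes between them. *)
Lemma rises_half P :
  ((2 * rises true P <= size P)%N /\
   ((2 * rises true P)%N = size P -> P = flatten (nseq (rises true P) [:: false; true]))) /\
  ((2 * rises false P <= (size P).+1)%N /\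
   ((2 * rises false P)%N = (size P).+1 ->
    P = true :: flatten (nseq (rises false P).-1 [:: false; true]))).
Proof.
elim: P => [//|b P [[le1 eq1] [le0 eq0]]]; split.
  case: b => /=; first by split=> [|e]; [lia | exfalso; lia].
  split=> [|e]; first by lia.
  have {}eq0 := eq0 e; case: (rises false P) e eq0 => [|r] e; first by lia.
  by move=> ->.
case: b => /=; last by split=> [|e]; [lia | exfalso; lia].
split=> [|e]; first by lia.
by rewrite {1}eq1 //; lia.
Qed.

End PositiveWords.

(** * Recovering the conjugacy class from the trace *)

Section Detection.
Implicit Types (P : seq bool) (w : braid_word 3) (p r : {poly rat}).

Definition alternating (m : nat) : seq bool := flatten (nseq m [:: false; true]).

(** The alternating word is the conjugate of [KN_word] that begins with [sigma_2^-1], as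
    [trace_start] asks. *)
Lemma alternating_KN N : s1 :: blocks (alternating N) = KN_word N ++ [:: s1].
Proof.
rewrite /KN_word /alternating; elim: N => [//|m IH].
by rewrite -[LHS]/(s1 :: block false :: s1 :: blocks (flatten (nseq m [:: false; true]))) IH.
Qed.

Lemma alternating_rises m b : rises b (alternating m) = m.
Proof. by elim: m b => [|m IH] b //=; rewrite IH andbF add1n. Qed.

Lemma alternating_size m : size (alternating m) = (2 * m)%N.
Proof. by elim: m => [//|m IH]; rewrite /= -/(alternating m) IH mulnS. Qed.

Lemma alternating_count m : count negb (alternating m) = m.
Proof. by elim: m => [//|m IH]; rewrite /= -/(alternating m) IH. Qed.

Lemma alternating_start m : (0 < m)%N -> trace_start (alternating m).
Proof. by case: m => // m _; right; eexists. Qed.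

Lemma exp_sum_alternating m : exp_sum (blocks (alternating m)) = 0.
Proof.
rewrite exp_sum_blocks alternating_count.
have := count_predC id (alternating m); rewrite alternating_size.
have -> : count (predC id) (alternating m) = count negb (alternating m) by exact: eq_count.
by rewrite alternating_count => h; lia.
Qed.

Lemma trace_KN N (s : rat) : s != 0 ->
  \tr (burau_prod s (KN_word N)) = \tr (burau_prod s (blocks (alternating N))).
Proof.
move=> s0; have e : burau_prod s [:: s1] *m burau_prod s (blocks (alternating N)) =
    burau_prod s (KN_word N) *m burau_prod s [:: s1].
  by rewrite !mulmxE -!burau_prod_cat -alternating_KN.
have h := congr1 (fun M => \tr (burau_prod s (inv_word [:: s1]) *m M)) e.
move: h; rewrite /= mulmxA burau_inv_wordl// mul1mx => ->.
by rewrite mxtrace_mulC -mulmxA [X in _ *m X]burau_inv_word// mulmx1.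
Qed.

Lemma start_rotation P : exists P', trace_start P' /\ central_conj (blocks P) (blocks P').
Proof.
have [Pt|] := boolP (all id P); first by exists P; split; [left | exact: central_conj_refl].
rewrite -has_predC => /split_find[b Q1 Q2 nb _].
have -> : b = false by case: b nb.
exists (false :: Q2 ++ Q1); split; first by right; eexists.
rewrite cat_rcons /blocks map_cat -cat_cons map_cat; exact: central_conj_rot.
Qed.

(** With constant terms 1, the exponents are the lowest degrees of the two sides and the signs their
    lowest coefficients. *)
Lemma shift_eq (p r : {poly rat}) (a b m m' : nat) : p`_0 = 1 -> r`_0 = 1 ->
  (-1) ^+ a *: (p * 'X^m) = (-1) ^+ b *: (r * 'X^m') -> m = m' /\ p = r.
Proof.
have nz c : ((-1) ^+ c : rat) != 0 by rewrite expf_eq0 oppr_eq0 oner_eq0 andbF.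
have aux (p0 r0 : {poly rat}) a0 b0 k k' : p0`_0 = 1 -> (k < k')%N ->
    (-1) ^+ a0 *: (p0 * 'X^k) <> (-1) ^+ b0 *: (r0 * 'X^k').
  move=> p1 kk' /(congr1 (fun t : {poly rat} => t`_k)).
  rewrite !coefZ !coefMXn ltnn subnn p1 kk' mulr0 mulr1 => /eqP.
  by rewrite (negPf (nz _)).
move=> p1 r1 e; have mm : m = m'.
  by case: (ltngtP m m') => // lt; 
    [case: (aux _ _ _ _ _ _ p1 lt e) | case: (aux _ _ _ _ _ _ r1 lt (esym e))].
split=> //; subst m'; have sgn : ((-1) ^+ a : rat) = (-1) ^+ b.
  have := congr1 (fun t : {poly rat} => t`_m) e.
  by rewrite !coefZ !coefMXn ltnn subnn p1 r1 !mulr1.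
move: e; rewrite sgn !scalerAl => /(mulIf (monic_neq0 (monicXn _ m))).
by move=> /(congr1 (fun t => ((-1) ^+ b)^-1 *: t)); rewrite !scalerA !mulVf ?nz// !scale1r.
Qed.

Lemma detection N w : (0 < N)%N -> exp_sum w = 0 ->
  (forall q : rat, q != 0 ->
    \tr (burau_prod (- q ^+ 2) w) = \tr (burau_prod (- q ^+ 2) (KN_word N))) ->
  exists g, braid_eq (g ++ w) (KN_word N ++ g).
Proof.
move=> N_gt0 w0 trw; have [v [wv vE]] := cyclic_normal_form w.
have nz (q : rat) : q != 0 -> - q ^+ 2 != 0 by move=> q0; rewrite oppr_eq0 expf_neq0.
case: vE => [vE|[P vE]].
  have [g [k [l [_ + _]]]] := central_conj_invariants rat wv.
  (* The torsion words have exponent sums 3, 2 and 4, none of them a multiple of 6. *)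
  by move: vE; rewrite w0 !inE => /or3P[] /eqP -> ; rewrite /exp_sum !big_cons big_nil /letter_exp /=; lia.
have [Q [Qs PQ]] := start_rotation P.
rewrite vE in wv; have {wv PQ vE v} wQ := central_conj_trans wv PQ.
have [g [k [l [e es tr]]]] := central_conj_invariants rat wQ.
have [K0 K1] : (trace_poly (alternating N))`_0 = 1 /\ (trace_poly (alternating N))`_1 = N%:R.
  have [|K0 K1] := trace_poly_coef (alternating_start N_gt0); rewrite ?alternating_size; first lia.
  by split; rewrite // K1 ?alternating_size ?alternating_rises//; lia.
pose b := count negb Q.
have trK (q : rat) : q != 0 -> (trace_poly (alternating N)).[- q ^+ 2] =
    (- q ^+ 2) ^+ N * \tr (burau_prod (- q ^+ 2) w).
  move=> q0; rewrite (horner_trace_poly _ (nz q q0)) alternating_count trw//.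
  by rewrite trace_KN ?nz.
(* The trace relation multiplied by [s^(N + b)], where [s = - q^2]: both traces become trace
   polynomials and the scalars of the twists powers of [s^3]. *)
have id0 : (-1) ^+ k *: (trace_poly (alternating N) * 'X^(3 * k + b)) =
    (-1) ^+ l *: (trace_poly Q * 'X^(3 * l + N)).
  apply: poly_eq_neg_squares => q q0; have := tr _ (nz q q0).
  rewrite !(hornerZ, hornerM, hornerXn) trK// horner_trace_poly ?nz// -/b; set s := - q ^+ 2.
  have sE m c : s ^+ (3 * m + c) = (s ^+ 3) ^+ m * s ^+ c by rewrite exprD exprM.
  rewrite !(exprNn (s ^+ 3)) !sE => h.
  set t := \tr _ in h *; set u := \tr _ in h *.
  transitivity (s ^+ N * s ^+ b * ((-1) ^+ k * (s ^+ 3) ^+ k * t)); last rewrite h.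
    by move: ((s ^+ 3) ^+ k) => x; ring.
  by move: ((s ^+ 3) ^+ l) => x; ring.
(* The empty word has trace 2 and is treated apart: then [k = l], and only the left side has a term
   of degree [3 k], because [N > 0]. *)
case: (posnP (size Q)) => [/size0nil Q0|Q_gt0].
  have kl : k = l by move: es; rewrite Q0 w0 exp_sum_blocks /=; lia.
  have := congr1 (fun t : {poly rat} => t`_(3 * k)) id0.
  rewrite /b Q0 /= addn0 -kl !coefZ !coefMXn ltnn subnn K0 mulr1.
  rewrite -[X in (X < _)%N]addn0 ltn_add2l N_gt0 mulr0 => /eqP.
  by rewrite expf_eq0 oppr_eq0 oner_eq0 andbF.
have [Q1 Q2] := trace_poly_coef Qs Q_gt0.
have [kl KQ] := shift_eq K0 Q1 id0.
move: es; rewrite w0 exp_sum_blocks -/b => es.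
(* Combines [3 k + b = 3 l + N] with the exponent sums, by which [6 (k - l)] is the number of
   letters [true] minus [b]. *)
have szQ : size Q = (2 * N)%N.
  have := count_predC id Q; rewrite (@eq_count _ (predC id) negb)// -/b; lia.
have rQ : rises true Q = N.
  apply/eqP; rewrite -(eqr_nat rat) -Q2 ?szQ -?KQ ?K1//; lia.
have QE : Q = alternating N.
  by have [[_ h] _] := rises_half Q; rewrite -rQ; apply: h; rewrite rQ szQ.
(* The twists on the two sides cancel, so that conjugacy modulo the centre becomes conjugacy. *)
have kl' : k = l by move: kl; rewrite /b QE alternating_count; lia.
exists (s1 :: g); rewrite -[s1 :: g]cat1s catA -alternating_KN -!catA.
by apply: (braid_cat (braid_refl [:: s1])); rewrite QE kl' in e; exact: braid_cancel_l e.
Qed.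

End Detection.

(** * Ambient isotopies of the thickened annulus *)

Local Open Scope classical_set_scope.
Local Open Scope ring_scope.

Section CompactQuotient.
Variables (X Y Z : topologicalType).

(** A continuous map from a compact set to a Hausdorff space is a quotient map onto its image. It
    lets continuity on the thickened annulus be checked on a cube with two faces identified. *)
Lemma continuous_within_quotient (K : set X) (f : X -> Y) (g : Y -> Z)
    (G : X -> Z) :
  compact K -> hausdorff_space Y -> continuous f -> continuous G ->
  (forall k, K k -> g (f k) = G k) -> {within f @` K, continuous g}.
Proof.
move=> /compact_near_coveringP/near_covering_withinP cK hY cf cG gfG.
apply/subspace_continuousP => y [k0 Kk0 fk0] W Wgy.
pose P (y' : Y) (k : X) := f k = y' -> W (g y').
have nP : \forall y' \near y, K `<=` P y'.
  apply: (cK Y (nbhs y) P) => k Kk.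
  have [fky|fky] := pselect (f k = y).
    have : \forall k' \near k, W (G k').
      by apply: cG; rewrite -gfG// fky.
    move=> nW; exists ([set k' | W (G k')], setT); first by split=> //; exact: filterT.
    by move=> [k' y'] [/= Wk' _] Kk' fk'; rewrite -fk' gfG.
  have /existsNP[U1 /existsNP[U2 /not_implyP[nU1 /not_implyP[nU2 U12]]]] :
    ~ cluster (nbhs (f k)) y by move=> c; apply: fky; apply: hY.
  have n1 : \forall k' \near k, U1 (f k') by apply: cf.
  exists ([set k' | U1 (f k')], U2) => //.
  move=> [k' y'] [/= U1k' U2y'] Kk' fk'; exfalso; apply: U12; exists y'.
  by split=> //; rewrite -fk'.
rewrite /nbhs /= /within /=; apply: filterS nP => y' Py' [k Kk fk].
exact: (Py' k Kk fk).
Qed.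

End CompactQuotient.

HB.instance Definition _ (R : realType) := isPointed.Build (R * R)%type 0.

Section PlaneComplete.
Variable R : realType.

(** For the Banach fixed point theorem in a page of the annulus. *)
Lemma plane_complete (F : set_system (R * R)%type) :
  ProperFilter F -> cauchy F -> cvg F.
Proof.
move=> FF cF; pose F1 := fst @ F; pose F2 := snd @ F.
have c1 : cvg F1.
  apply: R_complete; apply/cauchy_ballP => e e0.
  have /cauchy_ballP/(_ e e0) := cF.
  rewrite !near_simpl => -[[A B] [FA FB] AB].
  exists (fst @` A, fst @` B); first by split;
    [apply: (@filterS _ F _ A) => // x Ax; exists x | apply: (@filterS _ F _ B) => // x Bx; exists x].
  by move=> [_ _] [/= [a Aa <-] [b Bb <-]]; have [] := AB (a, b) (conj Aa Bb).
have c2 : cvg F2.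
  apply: R_complete; apply/cauchy_ballP => e e0.
  have /cauchy_ballP/(_ e e0) := cF.
  rewrite !near_simpl => -[[A B] [FA FB] AB].
  exists (snd @` A, snd @` B); first by split;
    [apply: (@filterS _ F _ A) => // x Ax; exists x | apply: (@filterS _ F _ B) => // x Bx; exists x].
  by move=> [_ _] [/= [a Aa <-] [b Bb <-]]; have [] := AB (a, b) (conj Aa Bb).
apply/cvg_ex; exists (lim F1, lim F2).
rewrite (_ : F = (fun x => (x.1, x.2)) @ F); last first.
  by apply/funext => A; congr (F _); apply/funext => -[].
by apply: (@cvg_pair _ _ _ F (nbhs (lim F1)) (nbhs (lim F2)) _ _ _ fst snd c1 c2).
Qed.

End PlaneComplete.

HB.instance Definition _ (R : realType) :=
  Uniform_isComplete.Build (R * R)%type (@plane_complete R).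

Section ContractivePerturbation.
Variables (R : realType) (v : R * R -> R * R) (Q : set (R * R)).
Hypothesis v_lip : forall x y, `|v x - v y| <= 2^-1 * `|x - y|.
Hypothesis v_supp : forall x, ~ Q x -> v x = 0.

Lemma perturbation_inj x y : x + v x = y + v y -> x = y.
Proof.
move=> e; have e' : x - y = v y - v x.
  by apply/eqP; rewrite subr_eq addrAC [v y + _]addrC -e addrK.
have := v_lip y x; rewrite -e' [`|y - x|]distrC => h.
apply/eqP; rewrite -subr_eq0 -normr_eq0 eq_le normr_ge0 andbT.
by have := normr_ge0 (x - y); lra.
Qed.

(** A preimage of [y] is a fixed point of the contraction sending [x] to [y - v x]. *)
Lemma perturbation_surj y : exists x, x + v x = y.
Proof.
pose f0 : R * R -> R * R := fun x => y - v x.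
have fS : set_fun setT setT f0 by [].
pose f := HB.pack_for {fun (@setT (R * R)) >-> (@setT (R * R))} f0
  (@isFun.Build _ _ setT setT f0 fS).
have cf : is_contraction f.
  have h0 : (0 : R) <= 2^-1 by rewrite invr_ge0.
  exists (NngNum h0).
  split; first by rewrite /=; lra.
  move=> [a b] _ /=; rewrite /f0 opprB addrC addrA subrK distrC.
  exact: v_lip.
have [|//|x _ xE] := @banach_fixed_point R (R * R)%type setT f cf.
- exact: closedT.
- by exists 0.
by exists x; rewrite {1}xE subrK.
Qed.

(** Outside [Q] every point is fixed. An image outside [Q] would thus have itself as a preimage,
    besides [x], against injectivity. *)
Lemma perturbation_stable x : Q x -> Q (x + v x).
Proof.
move=> Qx; apply: contrapT => nQ; apply: (nQ).
by rewrite -(@perturbation_inj x (x + v x)) // [v (x + v x)]v_supp // addr0.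
Qed.

Lemma perturbation_onto y : Q y -> exists2 x, Q x & x + v x = y.
Proof.
move=> Qy; have [x xE] := perturbation_surj y; exists x => //.
by apply: contrapT => nQ; apply: (nQ); move: Qy; rewrite -xE v_supp // addr0.
Qed.

End ContractivePerturbation.

Section CirclePoint.
Variable R : realType.
Implicit Types u : R.

Lemma cos_addn u (m : nat) : cos (2 * pi * (u + m%:R)) = cos (2 * pi * u).
Proof.
rewrite mulrDr (_ : 2 * pi * m%:R = (pi *+ 2) *+ m) ?(periodicn (@cosD2pi R))//.
by rewrite mulr_natr mulr_natl.
Qed.

Lemma sin_addn u (m : nat) : sin (2 * pi * (u + m%:R)) = sin (2 * pi * u).
Proof.
rewrite mulrDr (_ : 2 * pi * m%:R = (pi *+ 2) *+ m) ?(periodicn (@sinD2pi R))//.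
by rewrite mulr_natr mulr_natl.
Qed.

Lemma circle_param (c s : R) : c ^+ 2 + s ^+ 2 = 1 ->
  exists2 u, 0 <= u <= 1 & cos (2 * pi * u) = c /\ sin (2 * pi * u) = s.
Proof.
move=> cs1.
have p0 := pi_gt0 R; have pn0 : pi != 0 :> R by rewrite gt_eqF.
have c1 : -1 <= c <= 1.
  rewrite -ler_norml -(@expr_le1 _ 2)// -normrX ger0_norm ?sqr_ge0//.
  by have := sqr_ge0 s; lra.
have [ac ca] := acos_def c1; have := sin_acos c1.
have -> : 1 - c ^+ 2 = s ^+ 2 by lra.
rewrite sqrtr_sqr => sa.
have [s0|s0] := lerP 0 s.
  exists (acos c / (2 * pi)).
    apply/andP; split; first by apply: divr_ge0; lra.
    by rewrite ler_pdivrMr ?mulr_gt0//; lra.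
  have -> : 2 * pi * (acos c / (2 * pi)) = acos c by rewrite mulrC divfK ?mulf_neq0.
  by rewrite sa ger0_norm.
exists (1 - acos c / (2 * pi)).
  have q0 : 0 <= acos c / (2 * pi) by apply: divr_ge0; lra.
  have : acos c / (2 * pi) <= 1 by rewrite ler_pdivrMr ?mulr_gt0//; lra.
  by lra.
have -> : 2 * pi * (1 - acos c / (2 * pi)) = - acos c + pi *+ 2.
  by rewrite mulrBr mulr1 [_ * (_ / _)]mulrC divfK ?mulf_neq0// addrC mulr_natl.
by rewrite cosD2pi sinD2pi cosN sinN sa ltr0_norm// opprK.
Qed.

Lemma circle_param_inj (u u' : R) : 0 <= u <= 1 -> 0 <= u' <= 1 ->
  cos (2 * pi * u) = cos (2 * pi * u') -> sin (2 * pi * u) = sin (2 * pi * u') ->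
  [\/ u = u', u = 0 /\ u' = 1 | u = 1 /\ u' = 0].
Proof.
wlog uu' : u u' / u <= u' => [hw|].
  have [h|/ltW h] := lerP u u'; first exact: hw.
  move=> h1 h2 h3 h4.
  have [->|[-> ->]|[-> ->]] := hw _ _ h h2 h1 (esym h3) (esym h4);
    by [apply: Or31|apply: Or33|apply: Or32].
move=> u01 u'01 ec es.
(* Half the difference of the angles: its sine vanishes and it lies between 0 and [pi], so it is one
   of these two ends. *)
pose w := pi * (u' - u).
have : cos (2 * pi * u' - 2 * pi * u) = 1.
  by rewrite cosB ec es -!expr2 cos2Dsin2.
rewrite (_ : _ - _ = w *+ 2) /w; last by ring.
rewrite -/w cos_mulr2n => cw.
have p0 := pi_gt0 R.
have sw : sin w = 0.
  by apply/eqP; rewrite -sqrf_eq0 sin2cos2; apply/eqP; lra.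
have [e|lt] := eqVneq u u'; first by apply: Or31.
have [e|lt1] := eqVneq (u' - u) 1; first by apply: Or32; split; lra.
have : 0 < sin w.
  have d0 : 0 < u' - u by rewrite subr_gt0 lt_neqAle lt.
  have d1 : u' - u < 1 by rewrite lt_neqAle lt1; lra.
  by apply: sin_gt0_pi; rewrite mulr_gt0//= /w gtr_pMr.
by rewrite sw ltxx.
Qed.

End CirclePoint.

Section ContinuousFunctions.
Variables (R : realType) (T : topologicalType).

Lemma continuous_addf (V : normedModType R) (f g : T -> V) :
  continuous f -> continuous g -> continuous (fun x => f x + g x).
Proof. by move=> cf cg x; apply: continuousD; [exact: cf|exact: cg]. Qed.

Lemma continuous_subf (V : normedModType R) (f g : T -> V) :
  continuous f -> continuous g -> continuous (fun x => f x - g x).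
Proof. by move=> cf cg x; apply: continuousB; [exact: cf|exact: cg]. Qed.

Lemma continuous_mulf (f g : T -> R) :
  continuous f -> continuous g -> continuous (fun x => f x * g x).
Proof. by move=> cf cg x; apply: continuousM; [exact: cf|exact: cg]. Qed.

Lemma continuous_scalef (V : normedModType R) (f : T -> R) (g : T -> V) :
  continuous f -> continuous g -> continuous (fun x => f x *: g x).
Proof. by move=> cf cg x; apply: continuousZ; [exact: cf|exact: cg]. Qed.

Lemma continuous_maxf (f g : T -> R) :
  continuous f -> continuous g -> continuous (fun x => Num.max (f x) (g x)).
Proof. by move=> cf cg x; apply: continuous_max; [exact: cf|exact: cg]. Qed.

Lemma continuous_normf (V : normedModType R) (f : T -> V) :
  continuous f -> continuous (fun x => `|f x|).
Proof. by move=> cf x; apply: cvg_norm; exact: cf. Qed.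

Lemma continuous_compf (U V : topologicalType) (f : T -> U) (g : U -> V) :
  continuous f -> continuous g -> continuous (fun x => g (f x)).
Proof. by move=> cf cg x; apply: continuous_comp; [exact: cf|exact: cg]. Qed.

Lemma continuous_pairf (U V : topologicalType) (f : T -> U) (g : T -> V) :
  continuous f -> continuous g -> continuous (fun x => (f x, g x)).
Proof. by move=> cf cg x; apply: cvg_pair; [exact: cf|exact: cg]. Qed.

Lemma continuous_fstf (U V : topologicalType) (f : T -> U * V) :
  continuous f -> continuous (fun x => (f x).1).
Proof. by move=> cf x; apply: cvg_comp (cf x) _; exact: cvg_fst. Qed.

Lemma continuous_sndf (U V : topologicalType) (f : T -> U * V) :
  continuous f -> continuous (fun x => (f x).2).
Proof. by move=> cf x; apply: cvg_comp (cf x) _; exact: cvg_snd. Qed.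

Lemma continuous_sumf (V : normedModType R) (I : finType) (f : I -> T -> V) :
  (forall i, continuous (f i)) -> continuous (fun x => \sum_i f i x).
Proof.
move=> cf; elim: (index_enum I) => [|i r IH].
  by under eq_fun do rewrite big_nil; exact: cst_continuous.
under eq_fun do rewrite big_cons.
exact: continuous_addf.
Qed.

End ContinuousFunctions.

Definition unit_square (R : realType) : set (R * R) :=
  [set x | 0 <= x.1 <= 1 /\ 0 <= x.2 <= 1].

Definition annulus_point (R : realType) (k : R * (R * R)) : space4 R :=
  (cos (2 * pi * k.1), sin (2 * pi * k.1), k.2.1, k.2.2).

(* The link swept by the points [gam p u], 0 <= u <= 1, in the square, where the
   strand [p] is continued by the strand [nxt p] after one turn. *)
Definition loop_link (R : realType) (I : finType) (gam : I -> R -> R * R)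
    (nxt : I -> I) (p : I) (u : R) : space4 R :=
  annulus_point
    (u, gam (iter (Num.truncn u) nxt p) (u - (Num.truncn u)%:R)).

Section AnnulusPoint.
Variable R : realType.

Definition solid_cube : set (R * (R * R)) :=
  [set` `[0, 1]] `*` @unit_square R.

Lemma solid_cubeP (k : R * (R * R)) :
  solid_cube k <-> 0 <= k.1 <= 1 /\ unit_square k.2.
Proof. by rewrite /solid_cube /setX /= in_itv. Qed.

Lemma solid_cube_compact : compact solid_cube.
Proof.
apply: compact_setX; first exact: segment_compact.
rewrite (_ : @unit_square R = [set` `[0, 1]] `*` [set` `[0, 1]]).
  by apply: compact_setX; exact: segment_compact.
by apply/funext => x; apply/propext; rewrite /setX /unit_square /= !in_itv.
Qed.

Lemma annulus_point_continuous : continuous (@annulus_point R).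
Proof.
have c1 : continuous (fun k : R * (R * R) => 2 * pi * k.1).
  apply: continuous_mulf; first exact: cst_continuous.
  by apply: continuous_fstf => x; exact: cvg_id.
have c2 : continuous (fun k : R * (R * R) => k.2).
  by apply: continuous_sndf => x; exact: cvg_id.
apply: continuous_pairf; last exact: continuous_sndf.
apply: continuous_pairf; last exact: continuous_fstf.
apply: continuous_pairf; apply: continuous_compf => //.
- exact: continuous_cos.
- exact: continuous_sin.
Qed.

Lemma annulus_point_in (k : R * (R * R)) :
  solid_cube k -> thickened_annulus R (annulus_point k).
Proof.
by move=> /solid_cubeP[k1 [k21 k22]]; split => //=; exact: cos2Dsin2.
Qed.

Lemma annulus_point_onto (P : space4 R) : thickened_annulus R P ->
  exists2 k, solid_cube k & annulus_point k = P.
Proof.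
case: P => [[[c s] r] h] [/= cs r01 h01].
have [u u01 [uc us]] := circle_param cs.
exists (u, (r, h)); first exact/solid_cubeP.
by rewrite /annulus_point /= uc us.
Qed.

Lemma annulus_point_image :
  @annulus_point R @` solid_cube = thickened_annulus R.
Proof.
apply/seteqP; split=> [P [k Kk <-]|P /annulus_point_onto[k Kk <-]].
  exact: annulus_point_in.
by exists k.
Qed.

Lemma annulus_point_inj (k k' : R * (R * R)) : solid_cube k -> solid_cube k' ->
  annulus_point k = annulus_point k' ->
  k.2 = k'.2 /\
  [\/ k.1 = k'.1, k.1 = 0 /\ k'.1 = 1 | k.1 = 1 /\ k'.1 = 0].
Proof.
move=> /solid_cubeP[h1 _] /solid_cubeP[h2 _] [ec es er eh]; split.
  by case: k k' er eh {h1 h2 ec es} => [? [? ?]] [? [? ?]] /= -> ->.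
exact: circle_param_inj.
Qed.

End AnnulusPoint.

Lemma continuous_within_comp (X Y Z : topologicalType) (A : set X) (B : set Y)
    (f : X -> Y) (g : Y -> Z) :
  {within A, continuous f} -> {within B, continuous g} ->
  (forall x, A x -> B (f x)) -> {within A, continuous (fun x => g (f x))}.
Proof.
move=> /subspace_continuousP cf /subspace_continuousP cg fAB.
apply/subspace_continuousP => x Ax W Wgf.
have := cf x Ax _ (cg _ (fAB _ Ax) W Wgf).
move=> h; apply: (@filterS _ (nbhs x) _ _ _ _ h) => x' /= {}h Ax'.
by apply: h => //; exact: fAB.
Qed.

Lemma continuous_within_pair (X Y Z : topologicalType) (A : set X)
    (f : X -> Y) (g : X -> Z) :
  {within A, continuous f} -> {within A, continuous g} ->
  {within A, continuous (fun x => (f x, g x))}.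
Proof. by move=> cf cg x; apply: cvg_pair; [exact: cf|exact: cg]. Qed.

Lemma oriented_isotopic_trans (R : realType) (M : set (space4 R))
    (I J K : finType) (L1 : I -> R -> space4 R) (L2 : J -> R -> space4 R)
    (L3 : K -> R -> space4 R) :
  oriented_isotopic M L1 L2 -> oriented_isotopic M L2 L3 ->
  oriented_isotopic M L1 L3.
Proof.
move=> [H [[cH hH H0] iH oH]] [G [[cG hG G0] iG oG]].
exists (fun t x => G t (H t x)); split.
- split.
  + apply: (@continuous_within_comp _ _ _ _ _
      (fun tx : R * space4 R => (tx.1, H tx.1 tx.2)) _ _ cG).
      apply: continuous_within_pair => //; apply: continuous_subspaceT.
      by move=> x; exact: cvg_fst.
    move=> [t x] [/= t01 Mx]; split=> //=.
    by have [h [_ _ s _ _]] := hH t t01; exact: s.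
  + move=> t t01; have [h [ch1 ch2 s1 s2 i]] := hH t t01.
    have [g [cg1 cg2 s1' s2' i']] := hG t t01.
    exists (h \o g); split.
    * exact: continuous_within_comp ch1 cg1 s1.
    * exact: continuous_within_comp cg2 ch2 s2'.
    * by move=> x Mx /=; apply: s1'; exact: s1.
    * by move=> x Mx /=; apply: s2; exact: s2'.
    * move=> x Mx /=; have [e1 _] := i x Mx.
      have [-> _] := i' _ (s1 _ Mx); split=> //.
      by have [_ ->] := i _ (s2' _ Mx); have [_ ->] := i' x Mx.
  + by move=> x Mx; rewrite H0// G0.
- by rewrite -iG -iH -image_comp.
- move=> i; have [j [rho [crho rho0 mrho erho]]] := oH i.
  have [k [tau [ctau tau0 mtau etau]]] := oG j.
  have rhop u : 0 <= u -> 0 <= rho u.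
    rewrite le_eqVlt => /orP[/eqP <-//|u0].
    by apply: le_trans rho0 _; apply/ltW; exact: mrho.
  exists k, (tau \o rho); split => /=.
  + exact: continuous_within_comp crho ctau rhop.
  + have [<-//|] := eqVneq 0 (rho 0).
    move=> n; apply: le_trans tau0 _; apply/ltW/mtau => //.
    by rewrite lt_neqAle n.
  + by move=> u u' u0 uu'; apply: mtau; [exact: rhop|exact: mrho].
  + by move=> u u0; rewrite erho// etau//; exact: rhop.
Qed.

(** * Isotopies that move the strands a little *)

Section SmallMove.
Variables (R : realType) (I : finType) (gam del : I -> R -> R * R).
Variables (nxt : I -> I) (e d : R).
Hypotheses (e_gt0 : 0 < e) (d_ge0 : 0 <= d).
Hypotheses (gam_cont : forall p, continuous (gam p))
  (del_cont : forall p, continuous (del p)).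
Hypothesis gam_sep : forall (u : R) p q, 0 <= u <= 1 -> p != q ->
  e <= `|gam p u - gam q u|.
Hypothesis gam_in : forall (u : R) p x, 0 <= u <= 1 -> `|x - gam p u| < e ->
  unit_square x.
Hypothesis gam_del : forall (u : R) p, 0 <= u <= 1 -> `|del p u - gam p u| <= d.
Hypothesis d_small : #|I|%:R * d <= 2^-1 * e.
Hypotheses (gam_loop : forall p, gam p 1 = gam (nxt p) 0)
  (del_loop : forall p, del p 1 = del (nxt p) 0).

(* Each point of the configuration drags along a cone of radius e. *)
Definition bump (c x : R * R) : R := Num.max 0 (1 - `|x - c| / e).

Definition drag (t u : R) (x : R * R) : R * R :=
  \sum_p (t * bump (gam p u) x) *: (del p u - gam p u).

Lemma bump_lip c x y : `|bump c x - bump c y| <= `|x - y| / e.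
Proof.
have h : `| `|x - c| / e - `|y - c| / e | <= `|x - y| / e.
  rewrite -mulrBl normrM [`|e^-1|]gtr0_norm ?invr_gt0// ler_pM2r ?invr_gt0//.
  by apply: le_trans (ler_dist_dist _ _) _; rewrite opprB addrA subrK.
move: h; rewrite /bump.
set a := _ / e; set b := _ / e; set m := _ / e.
rewrite ler_norml => /andP[h1 h2]; rewrite ler_norml.
by rewrite /Num.max; case: ifP; case: ifP; lra.
Qed.

Lemma nxt_inj : injective nxt.
Proof.
move=> p q pq; apply/eqP; apply: contraT => npq.
have := @gam_sep 1 p q; rewrite ler01 lexx => /(_ isT npq).
by rewrite !gam_loop pq subrr normr0 leNgt e_gt0.
Qed.

Lemma drag_loop t x : drag t 0 x = drag t 1 x.
Proof.
rewrite /drag (reindex_inj nxt_inj) /=; apply: eq_bigr => p _.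
by rewrite gam_loop del_loop.
Qed.

(** Each cone has slope [1 / e] and displaces by at most [d]; [d_small] bounds the sum over all
    strands. *)
Lemma drag_lip (t u : R) x y : 0 <= t <= 1 -> 0 <= u <= 1 ->
  `|drag t u x - drag t u y| <= 2^-1 * `|x - y|.
Proof.
move=> t01 u01; rewrite /drag -sumrB.
apply: le_trans (ler_norm_sum _ _ _) _.
apply: (@le_trans _ _ (\sum_(p : I) `|x - y| / e * d)).
  apply: ler_sum => p _; rewrite -scalerBl -mulrBr normrZ normrM.
  apply: ler_pM => //; last exact: gam_del.
  apply: le_trans (bump_lip (gam p u) x y).
  by rewrite ger0_norm ?ler_piMl//; lra.
rewrite sumr_const -[leLHS]mulr_natl mulrCA.
apply: le_trans (ler_wpM2l _ d_small) _; first by rewrite divr_ge0// ltW.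
by rewrite mulrCA divfK// gt_eqF.
Qed.

Lemma drag_outside (t u : R) x : 0 <= u <= 1 -> ~ unit_square x -> drag t u x = 0.
Proof.
move=> u01 nx; apply: big1 => p _; rewrite (_ : bump _ _ = 0) ?mulr0 ?scale0r//.
apply/max_idPl; rewrite subr_le0 ler_pdivlMr// mul1r leNgt.
by apply/negP => h; apply: nx; apply: gam_in h.
Qed.

(** At the apex of one cone the others vanish, since distinct strands are at distance at least
    [e]. *)
Lemma drag_at (u : R) p : 0 <= u <= 1 -> gam p u + drag 1 u (gam p u) = del p u.
Proof.
move=> u01; rewrite /drag (bigD1 p)//= big1 => [|q qp].
  rewrite addr0 /bump subrr normr0 mul0r subr0 (max_idPr _)//.
  by rewrite mulr1 scale1r addrC subrK.
rewrite (_ : bump _ _ = 0) ?mulr0 ?scale0r//.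
apply/max_idPl; rewrite subr_le0 ler_pdivlMr// mul1r.
by apply: gam_sep => //; rewrite eq_sym.
Qed.

Lemma drag_continuous :
  continuous (fun k : R * (R * (R * R)) => drag k.1 k.2.1 k.2.2).
Proof.
have id_cont (T : topologicalType) : continuous (fun x : T => x).
  by move=> x; exact: cvg_id.
have cu : continuous (fun k : R * (R * (R * R)) => k.2.1).
  by apply: continuous_fstf; exact: continuous_sndf.
have cg p : continuous (fun k : R * (R * (R * R)) => gam p k.2.1).
  exact: continuous_compf.
apply: continuous_sumf => p; apply: continuous_scalef; last first.
  by apply: continuous_subf => //; exact: continuous_compf.
apply: continuous_mulf; first exact: continuous_fstf.
apply: continuous_maxf; first exact: cst_continuous.
apply: continuous_subf; first exact: cst_continuous.
apply: continuous_mulf; last exact: cst_continuous.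
apply: continuous_normf; apply: continuous_subf => //.
by apply: continuous_sndf; exact: continuous_sndf.
Qed.

Definition move (t : R) (k : R * (R * R)) : R * (R * R) :=
  (k.1, k.2 + drag t k.1 k.2).

Lemma move_in (t : R) k : 0 <= t <= 1 -> solid_cube k -> solid_cube (move t k).
Proof.
move=> t01 /solid_cubeP[k1 k2]; apply/solid_cubeP; split => //=.
apply: (@perturbation_stable R (drag t k.1) (@unit_square R)) => //.
- by move=> x y; exact: drag_lip.
- by move=> x; exact: drag_outside.
Qed.

(** The displacements on the faces [u = 0] and [u = 1] agree by [drag_loop]; so [move] descends to
    the annulus, whatever preimage [chart] chooses. *)
Lemma move_eq t k k' : solid_cube k -> solid_cube k' ->
  annulus_point k = annulus_point k' ->
  annulus_point (move t k) = annulus_point (move t k').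
Proof.
move=> Kk Kk' /[dup] ek /(annulus_point_inj Kk Kk')[].
case: k k' ek {Kk Kk'} => [u x] [u' x'] /= [ec es _ _] <-.
move=> E; rewrite /annulus_point /= ec es.
suff -> : drag t u x = drag t u' x by [].
by case: E => [->//|[-> ->]|[-> ->]]; rewrite drag_loop.
Qed.

Definition chart (P : space4 R) : R * (R * R) :=
  xget (0, (0, 0)) [set k | solid_cube k /\ annulus_point k = P].

Lemma chartP P : thickened_annulus R P ->
  solid_cube (chart P) /\ annulus_point (chart P) = P.
Proof.
move=> /annulus_point_onto[k Kk kP]; rewrite /chart.
by case: xgetP => [k' _ []//|/(_ k)]; case.
Qed.

Definition move_isotopy (t : R) (P : space4 R) : space4 R :=
  annulus_point (move t (chart P)).

Lemma move_isotopyE t k : solid_cube k ->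
  move_isotopy t (annulus_point k) = annulus_point (move t k).
Proof.
move=> Kk; have [Kc cE] := chartP (annulus_point_in Kk).
exact: move_eq.
Qed.

Lemma move_continuous :
  continuous (fun tk : R * (R * (R * R)) => move tk.1 tk.2).
Proof.
have id_cont (T : topologicalType) : continuous (fun x : T => x).
  by move=> x; exact: cvg_id.
apply: continuous_pairf; first by apply: continuous_fstf; exact: continuous_sndf.
apply: continuous_addf; last exact: drag_continuous.
by apply: continuous_sndf; exact: continuous_sndf.
Qed.

Lemma move_continuous_at t : continuous (move t).
Proof.
have id_cont (T : topologicalType) : continuous (fun x : T => x).
  by move=> x; exact: cvg_id.
apply: (@continuous_compf _ _ _ (fun k => (t, k))
  (fun tk : R * (R * (R * R)) => move tk.1 tk.2)); last exact: move_continuous.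
by apply: continuous_pairf => //; exact: cst_continuous.
Qed.

Lemma move_isotopy_homeo (t : R) : 0 <= t <= 1 ->
  self_homeomorphism (thickened_annulus R) (move_isotopy t).
Proof.
move=> t01.
have lip u x y : 0 <= u <= 1 ->
    `|drag t u x - drag t u y| <= 2^-1 * `|x - y|.
  by move=> u01; exact: drag_lip.
have stable P : thickened_annulus R P -> thickened_annulus R (move_isotopy t P).
  move=> /chartP[Kc _]; apply: annulus_point_in; exact: move_in.
have onto P : thickened_annulus R P -> exists Q,
    thickened_annulus R Q /\ move_isotopy t Q = P.
  move=> /annulus_point_onto[[u x] Kk <-]; have [/= u01 Sx] := (solid_cubeP _).1 Kk.
  have [y Sy yE] := perturbation_onto (fun x y => lip u x y u01)
    (fun x => @drag_outside t u x u01) Sx.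
  have Ky : solid_cube (u, y) by exact/solid_cubeP.
  exists (annulus_point (u, y)); split; first exact: annulus_point_in.
  by rewrite move_isotopyE// /move /= yE.
have inj P Q : thickened_annulus R P -> thickened_annulus R Q ->
    move_isotopy t P = move_isotopy t Q -> P = Q.
  move=> /annulus_point_onto[[u x] Kx <-] /annulus_point_onto[[u' y] Ky <-].
  rewrite !move_isotopyE// => eE.
  have [/= exy eu] := annulus_point_inj (move_in t01 Kx) (move_in t01 Ky) eE.
  have [/= u01 _] := (solid_cubeP _).1 Kx.
  have exy' : x + drag t u x = y + drag t u y.
    rewrite exy; congr (_ + _).
    by case: eu => [->//|[-> ->]|[-> ->]]; rewrite drag_loop.
  have {exy exy'} := perturbation_inj (fun x y => lip u x y u01) exy' => exy.
  by case: eE => ec es _ _; rewrite /annulus_point /= ec es exy.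
pose g P := xget P [set Q | thickened_annulus R Q /\ move_isotopy t Q = P].
have gP P : thickened_annulus R P ->
    thickened_annulus R (g P) /\ move_isotopy t (g P) = P.
  move=> /onto[Q QP]; rewrite /g.
  by case: xgetP => [Q' _ []//|/(_ Q)]; case.
have g_inv P : thickened_annulus R P -> g (move_isotopy t P) = P.
  by move=> MP; have [MQ e1] := gP _ (stable _ MP); apply: inj.
have hd : hausdorff_space (space4 R) by exact: norm_hausdorff.
have mc : continuous (fun k => annulus_point (move t k)).
  apply: continuous_compf; first exact: move_continuous_at.
  exact: annulus_point_continuous.
exists g; split => //.
- rewrite -annulus_point_image.
  apply: (@continuous_within_quotient _ _ _ _ _ _
    (fun k => annulus_point (move t k)) (@solid_cube_compact R)) => //.
    exact: annulus_point_continuous.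
  by move=> k Kk; exact: move_isotopyE.
(* [annulus_point] after [move t] is again a quotient map of the cube onto the annulus, and the
   inverse composed with it is [annulus_point]; hence the inverse is continuous. *)
- rewrite (_ : thickened_annulus R =
    (fun k => annulus_point (move t k)) @` (@solid_cube R)).
    apply: (@continuous_within_quotient _ _ _ _ _ _
      (@annulus_point R) (@solid_cube_compact R)) => //.
      exact: annulus_point_continuous.
    by move=> k Kk; rewrite -move_isotopyE// g_inv//; exact: annulus_point_in.
  apply/seteqP; split => [P /onto[Q [/annulus_point_onto[k Kk <-] <-]]|_ [k Kk <-]].
    by exists k => //; rewrite move_isotopyE.
  by apply: annulus_point_in; exact: move_in.
- by move=> P MP; have [] := gP P MP.
- by move=> P MP; split; [exact: g_inv|have [] := gP P MP].
Qed.

Lemma small_move_isotopic :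
  oriented_isotopic (thickened_annulus R) (loop_link gam nxt) (loop_link del nxt).
Proof.
have E p u : 0 <= u ->
    move_isotopy 1 (loop_link gam nxt p u) = loop_link del nxt p u.
  move=> u0; set m := Num.truncn u; set q := iter m nxt p.
  have /andP[mu um] := truncn_itv u0.
  have v01 : 0 <= u - m%:R <= 1.
    by move: um; rewrite subr_ge0 mu -natr1 => um; lra.
  have red (x : R * R) : annulus_point (u, x) = annulus_point (u - m%:R, x).
    by rewrite /annulus_point /= -{1 2}(subrK m%:R u) cos_addn sin_addn.
  rewrite /loop_link -/m -/q red move_isotopyE.
    by rewrite /move /= drag_at// red.
  apply/solid_cubeP; split=> //=; apply: (gam_in v01 (p := q)).
  by rewrite subrr normr0.
exists move_isotopy; split.
- split.
  + pose f (tk : R * (R * (R * R))) : R * space4 R := (tk.1, annulus_point tk.2).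
    have cid (T : topologicalType) : continuous (fun x : T => x).
      by move=> x; exact: cvg_id.
    rewrite (_ : [set tx | _] = f @` ([set` `[0, 1]] `*` @solid_cube R)).
      apply: (@continuous_within_quotient _ _ _ _ _ _
          (fun tk : R * (R * (R * R)) => annulus_point (move tk.1 tk.2))).
      * by apply: compact_setX; [exact: segment_compact|exact: solid_cube_compact].
      * exact: norm_hausdorff.
      * apply: continuous_pairf; first exact: continuous_fstf.
        apply: continuous_compf; last exact: annulus_point_continuous.
        exact: continuous_sndf.
      * apply: continuous_compf; first exact: move_continuous.
        exact: annulus_point_continuous.
      * by move=> [t k] [_ Kk]; exact: move_isotopyE.
    apply/seteqP; split => [[t P] /= [t01 /annulus_point_onto[k Kk <-]]|].
      by exists (t, k) => //; split; rewrite //= in_itv.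
    move=> _ [[t k] [/= + Kk] <-]; rewrite in_itv /= => t01.
    by split => //; exact: annulus_point_in.
  + by move=> t t01; exact: move_isotopy_homeo.
  + move=> P /chartP[Kc cE]; rewrite /move_isotopy -[RHS]cE; congr annulus_point.
    rewrite /move /drag big1 => [|p _]; last by rewrite mul0r scale0r.
    by rewrite addr0; case: (chart P).
- apply/seteqP; split => [_ [_ [p [u [u0 <-]]] <-]|_ [p [u [u0 <-]]]].
    by exists p, u; rewrite E.
  by exists (loop_link gam nxt p u); [exists p, u|rewrite E].
- move=> p; exists p, id; split => //.
  + by apply: continuous_subspaceT => x; exact: cvg_id.
  + by move=> u u0; exact: E.
Qed.

End SmallMove.

Lemma finite_positive_bound (R : realType) (J : finType) (P : J -> R -> Prop) :
  (forall j, exists2 e, 0 < e & P j e) ->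
  (forall j e e', 0 < e' -> e' <= e -> P j e -> P j e') ->
  exists2 e, 0 < e & forall j, P j e.
Proof.
move=> ex mono.
have /choice[f fP] : forall j, exists e, 0 < e /\ P j e.
  by move=> j; have [e] := ex j; exists e.
have m0 : 0 < \big[Order.min/1]_j f j by apply: lt_bigmin => // j _; have [] := fP j.
exists (\big[Order.min/1]_j f j) => // j.
by apply: mono (fP j).2 => //; exact: bigmin_le.
Qed.

(** * Homotopies cut into small moves *)

Section Homotopy.
Variables (R : realType) (I : finType) (G : R -> I -> R -> R * R).
Variable nxt : I -> I.
Hypothesis G_cont : forall p, continuous (fun tu : R * R => G tu.1 p tu.2).
Hypothesis G_disj : forall (t u : R) p q, 0 <= t <= 1 -> 0 <= u <= 1 -> p != q ->
  G t p u != G t q u.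
Hypothesis G_in : forall (t u : R) p, 0 <= t <= 1 -> 0 <= u <= 1 ->
  0 < (G t p u).1 < 1 /\ 0 < (G t p u).2 < 1.
Hypothesis G_loop : forall (t : R) p, 0 <= t <= 1 -> G t p 1 = G t (nxt p) 0.

Let K : set (R * R) := [set` `[0, 1]] `*` [set` `[0, 1]].

Let K_compact : compact K.
Proof. by apply: compact_setX; exact: segment_compact. Qed.

Let KP (t u : R) : K (t, u) <-> 0 <= t <= 1 /\ 0 <= u <= 1.
Proof. by rewrite /K /setX /= !in_itv. Qed.

Let positive_bound (f : R * R -> R) : continuous f ->
  (forall t u, 0 <= t <= 1 -> 0 <= u <= 1 -> 0 < f (t, u)) ->
  exists2 e, 0 < e &
    forall t u, 0 <= t <= 1 -> 0 <= u <= 1 -> e <= f (t, u).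
Proof.
move=> cf f0.
have K0 : K !=set0 by exists (0, 0); apply/KP; rewrite lexx ler01.
have [[t u] + min] := compact_EVT_min K0 K_compact (continuous_subspaceT cf).
rewrite inE => /KP[t01 u01]; exists (f (t, u)); first exact: f0.
by move=> t' u' t01' u01'; apply: min; rewrite inE; exact/KP.
Qed.

Let separation : exists2 e, 0 < e &
  forall t u p q, 0 <= t <= 1 -> 0 <= u <= 1 -> p != q ->
    e <= `|G t p u - G t q u|.
Proof.
pose P (pq : I * I) e := forall t u, 0 <= t <= 1 -> 0 <= u <= 1 ->
  pq.1 != pq.2 -> e <= `|G t pq.1 u - G t pq.2 u|.
have [|pq x y _ xy h t u t01 u01 npq|e e0 he] := @finite_positive_bound R _ P.
- move=> [p q]; have [->|npq] := eqVneq p q.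
    by exists 1 => // t u _ _ /=; rewrite eqxx.
  have [||e e0 he] := @positive_bound (fun tu => `|G tu.1 p tu.2 - G tu.1 q tu.2|).
  + by apply: continuous_normf; exact: continuous_subf.
  + by move=> t u t01 u01 /=; rewrite normr_gt0 subr_eq0; exact: G_disj.
  + by exists e => // t u t01 u01 _; exact: he.
- exact: le_trans xy (h _ _ t01 u01 npq).
- by exists e => // t u p q t01 u01 npq; exact: (he (p, q)).
Qed.

Let margin : exists2 e, 0 < e & forall t u p, 0 <= t <= 1 -> 0 <= u <= 1 ->
  [/\ e <= (G t p u).1, e <= 1 - (G t p u).1,
      e <= (G t p u).2 & e <= 1 - (G t p u).2].
Proof.
pose P p e := forall t u, 0 <= t <= 1 -> 0 <= u <= 1 ->
  [/\ e <= (G t p u).1, e <= 1 - (G t p u).1,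
      e <= (G t p u).2 & e <= 1 - (G t p u).2].
have [|p x y _ xy h t u t01 u01|e e0 he] := @finite_positive_bound R _ P.
- move=> p.
  have c1 : continuous (fun tu : R * R => (G tu.1 p tu.2).1).
    exact: continuous_fstf.
  have c2 : continuous (fun tu : R * R => (G tu.1 p tu.2).2).
    exact: continuous_sndf.
  have cc : continuous (fun tu : R * R => 1 : R) by exact: cst_continuous.
  have [|e1 e10 h1] := positive_bound c1.
    by move=> t u t01 u01; have [/andP[]] := @G_in t u p t01 u01.
  have [|e2 e20 h2] := positive_bound (continuous_subf cc c1).
    by move=> t u t01 u01; have [] := @G_in t u p t01 u01; rewrite /=; lra.
  have [|e3 e30 h3] := positive_bound c2.
    by move=> t u t01 u01; have [_ /andP[]] := @G_in t u p t01 u01.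
  have [|e4 e40 h4] := positive_bound (continuous_subf cc c2).
    by move=> t u t01 u01; have [] := @G_in t u p t01 u01; rewrite /=; lra.
  exists (Num.min (Num.min e1 e2) (Num.min e3 e4)).
    by rewrite !lt_min e10 e20 e30 e40.
  move=> t u t01 u01; rewrite !ge_min.
  move: (h1 _ _ t01 u01) (h2 _ _ t01 u01) (h3 _ _ t01 u01) (h4 _ _ t01 u01).
  by move=> /= -> -> -> ->; rewrite !orbT.
- by have [] := h _ _ t01 u01; split; exact: le_trans xy _.
- by exists e => // t u p t01 u01; exact: he.
Qed.

Let uniform (d : R) : 0 < d -> exists n : nat, forall t u (s : R) p,
  0 <= t <= 1 -> 0 <= u <= 1 -> `|s| <= n.+1%:R^-1 ->
  `|G (t + s) p u - G t p u| <= d.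
Proof.
move=> d0.
pose P (s : R) (tu : R * R) :=
  forall p, `|G (tu.1 + s) p tu.2 - G tu.1 p tu.2| < d.
have /compact_near_coveringP cK := K_compact.
have : \forall s \near (0 : R), K `<=` P s.
  apply: (cK R (nbhs 0) P) => -[t u] Ktu.
  have Pp p : \forall x \near ((t, u), 0 : R),
      `|G (x.1.1 + x.2) p x.1.2 - G x.1.1 p x.1.2| < d.
    pose h (x : R * R * R) := `|G (x.1.1 + x.2) p x.1.2 - G x.1.1 p x.1.2|.
    have cid (T : topologicalType) : continuous (fun x : T => x).
      by move=> x; exact: cvg_id.
    have ch : continuous h.
      have c11 : continuous (fun x : R * R * R => x.1.1).
        by apply: continuous_fstf; exact: continuous_fstf.
      have c12 : continuous (fun x : R * R * R => x.1.2).
        by apply: continuous_sndf; exact: continuous_fstf.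
      apply: continuous_normf; apply: continuous_subf.
        apply: (@continuous_compf _ _ _ (fun x : R * R * R => (x.1.1 + x.2, x.1.2))
          (fun tu : R * R => G tu.1 p tu.2)) => //.
        apply: continuous_pairf => //; apply: continuous_addf => //.
        exact: continuous_sndf.
      apply: (@continuous_compf _ _ _ (fun x : R * R * R => x.1)
        (fun tu : R * R => G tu.1 p tu.2)) => //.
      exact: continuous_fstf.
    have := ch ((t, u), 0).
    rewrite /continuous_at {2}/h /= addr0 subrr normr0 => /cvgr_lt; exact.
  have : \forall x \near ((t, u), 0 : R), forall p,
      `|G (x.1.1 + x.2) p x.1.2 - G x.1.1 p x.1.2| < d.
    pose f p (x : R * R * R) := `|G (x.1.1 + x.2) p x.1.2 - G x.1.1 p x.1.2| < d.
    exact: (@filter_forall _ I f _ (nbhs_filter ((t, u), 0 : R)) Pp).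
  by [].
move=> /nbhs_ballP[r /= r0 hr].
exists (Num.truncn r^-1) => t u s p t01 u01 hs; apply/ltW.
have Bs : ball (0 : R) r s.
  rewrite /ball /= sub0r normrN; apply: le_lt_trans hs _.
  rewrite invf_plt ?posrE//.
  have ri : 0 <= r^-1 by rewrite invr_ge0 ltW.
  by have /andP[] := truncn_itv ri.
by have := hr s Bs (t, u) ((KP t u).2 (conj t01 u01)) p.
Qed.

Theorem homotopic_isotopic :
  oriented_isotopic (thickened_annulus R)
    (loop_link (G 0) nxt) (loop_link (G 1) nxt).
Proof.
have [e1 e10 h1] := separation; have [e2 e20 h2] := margin.
pose e := Num.min e1 e2.
have e0 : 0 < e by rewrite lt_min e10.
(* Makes [#|I| * d] at most [e / 2], as [d_small] asks; the successor keeps the denominator nonzero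
   for an empty [I]. *)
pose d := (2 * #|I|.+1%:R)^-1 * e.
have d0 : 0 < d by rewrite mulr_gt0// invr_gt0 mulr_gt0.
have [n hn] := uniform d0.
have Gc t p : continuous (G t p).
  apply: (@continuous_compf _ _ _ (fun u => (t, u)) (fun tu : R * R => G tu.1 p tu.2)) => //.
  apply: continuous_pairf; first exact: cst_continuous.
  by move=> x; exact: cvg_id.
have step (t s : R) : 0 <= t <= 1 -> 0 <= t + s <= 1 -> `|s| <= n.+1%:R^-1 ->
    oriented_isotopic (thickened_annulus R)
      (loop_link (G t) nxt) (loop_link (G (t + s)) nxt).
  move=> t01 ts01 hs; apply: (@small_move_isotopic R I (G t) (G (t + s)) nxt e d) => //.
  - move=> u p q u01 npq; apply: le_trans (h1 _ _ _ _ t01 u01 npq).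
    by rewrite ge_min lexx.
  - move=> u p x u01 hx; have [] := h2 t u p t01 u01.
    have : e <= e2 by rewrite ge_min lexx orbT.
    move: hx; rewrite prod_normE gt_max !ltr_norml /= => /andP[/andP[? ?] /andP[? ?]].
    by move=> ? ? ? ? ?; split; apply/andP; split; lra.
  - by move=> u p u01; exact: hn.
  - have -> : #|I|%:R * d = 2^-1 * e * (#|I|%:R / #|I|.+1%:R).
      by rewrite /d invfM; ring.
    rewrite ler_piMr//; first by rewrite mulr_ge0 ?invr_ge0 ?ltW.
    by rewrite ler_pdivrMr// mul1r ler_nat.
  - by move=> p; exact: G_loop.
  - by move=> p; exact: G_loop.
have main k : (k <= n.+1)%N -> oriented_isotopic (thickened_annulus R)
    (loop_link (G 0) nxt) (loop_link (G (k%:R / n.+1%:R)) nxt).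
  elim: k => [_|k IH kn].
    rewrite mul0r -{2}(addr0 0); apply: step; rewrite ?addr0 ?normr0 ?lexx ?ler01//.
  have b (m : nat) : (m <= n.+1)%N -> 0 <= (m%:R / n.+1%:R : R) <= 1.
    move=> mn; apply/andP; split; first by rewrite divr_ge0.
    by rewrite ler_pdivrMr// mul1r ler_nat.
  apply: oriented_isotopic_trans (IH (ltnW kn)) _.
  have -> : k.+1%:R / n.+1%:R = k%:R / n.+1%:R + n.+1%:R^-1 :> R.
    by rewrite -natr1 mulrDl mul1r.
  apply: step; [exact/b/ltnW| |by rewrite ger0_norm ?invr_ge0].
  by have := b _ kn; rewrite -[k.+1%:R]natr1 mulrDl mul1r.
by have := main n.+1 (leqnn _); rewrite divff// pnatr_eq0.
Qed.

End Homotopy.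

(** * Isotopies of braid closures *)

Lemma continuous_glue (R : realType) (V : topologicalType) (c : R) (f g : R -> V) :
  continuous f -> continuous g -> f c = g c ->
  continuous (fun u => if u <= c then f u else g u).
Proof.
move=> cf cg fg; set h := fun u : R => _.
have : {within [set` `]-oo, c]] `|` [set` `[c, +oo[], continuous h}.
  apply: withinU_continuous; [exact: lray_closed|exact: rray_closed| |].
    apply: subspace_eq_continuous (continuous_subspaceT cf) => u.
    by rewrite inE /= in_itv /h /from_subspace /= => ->.
  apply: subspace_eq_continuous (continuous_subspaceT cg) => u.
  rewrite inE /= in_itv /= andbT /h /from_subspace /= => cu; case: ifP => // uc.
  by have -> : u = c by apply/eqP; rewrite eq_le uc cu.
have -> : [set` `]-oo, c]] `|` [set` `[c, +oo[] = [set: R].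
  apply/seteqP; split => // u _ /=; rewrite !in_itv /= andbT.
  by have [] := leP u c => h'; [left|right; exact: ltW].
exact: (continuous_subspace_setT _).2.
Qed.

Section StrandPath.
Variables (R : realType) (n : nat).
Local Notation sector := (option (braid_letter n)).
Implicit Types (a : sector) (l : seq sector) (p q : 'I_n) (u : R).

Definition base_point p : R * R := (strand_radius R p, 1 / 2).

(** Each sector takes one unit of time, and after the last one the strand rests. *)
Fixpoint strand_path l p u : R * R :=
  if l is a :: l' then
    if u <= 1 then strand_arc a p u
    else strand_path l' (next_position a p) (u - 1)
  else base_point p.

Definition final_position l p : 'I_n :=
  foldl (fun q a => next_position a q) p l.

Lemma strand_arc0 a p : strand_arc a p 0 = base_point p.
Proof.
rewrite /strand_arc /base_point mulr0 cos0 sin0 mulr0 addr0 mulr1.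
by congr pair; field.
Qed.

Lemma strand_arc1 a p : strand_arc a p 1 = base_point (next_position a p).
Proof.
rewrite /strand_arc /base_point mulr1 cospi sinpi mulr0 addr0 mulrN1 opprK.
by congr pair; field.
Qed.

Lemma strand_arc_None p u : strand_arc None p u = base_point p.
Proof.
by rewrite /strand_arc /base_point /= subrr !mul0r mulr0 mul0r addr0 subr0; congr pair; field.
Qed.

Lemma strand_path_le0 l p u : u = 0 -> strand_path l p u = base_point p.
Proof. by move=> ->; case: l => //= a l; rewrite ler01 strand_arc0. Qed.

Lemma strand_arc_continuous a p : continuous (@strand_arc R n a p).
Proof.
have cp : continuous (fun u : R => pi * u).
  apply: continuous_mulf; first exact: cst_continuous.
  by move=> x; exact: cvg_id.
have cc (k : R) : continuous (fun _ : R => k) by exact: cst_continuous.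
apply: continuous_pairf.
  apply: continuous_subf => //; apply: continuous_mulf => //.
  by apply: continuous_compf => //; exact: continuous_cos.
apply: continuous_addf => //; apply: continuous_mulf => //.
by apply: continuous_compf => //; exact: continuous_sin.
Qed.

Lemma strand_path_continuous l p : continuous (strand_path l p).
Proof.
elim: l p => [|a l IH] p; first exact: cst_continuous.
apply: continuous_glue; first exact: strand_arc_continuous.
  apply: (@continuous_compf _ _ _ (fun u => u - 1)); last exact: IH.
  by apply: continuous_subf; [move=> x; exact: cvg_id|exact: cst_continuous].
by rewrite -[RHS]/(strand_path l _ (1 - 1)) subrr strand_path_le0 ?strand_arc1.
Qed.

Lemma strand_path_catl l1 l2 p u : 0 <= u <= (size l1)%:R ->
  strand_path (l1 ++ l2) p u = strand_path l1 p u.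
Proof.
move=> /andP[]; elim: l1 p u => [|a l1 IH] p u u0 /= us.
  by rewrite strand_path_le0//; apply/eqP; rewrite eq_le u0 andbT.
case: lerP => // u1; rewrite IH//; first by rewrite subr_ge0 ltW.
by move: us; rewrite -natr1; lra.
Qed.

Lemma strand_path_catr l1 l2 p u : (size l1)%:R <= u ->
  strand_path (l1 ++ l2) p u =
  strand_path l2 (final_position l1 p) (u - (size l1)%:R).
Proof.
elim: l1 p u => [|a l1 IH] p u /= us; first by rewrite subr0.
have s0 : 0 <= (size l1)%:R :> R by [].
move: us; rewrite -natr1 => us; case: lerP => [u1|u1].
  have u1' : u = 1 by lra.
  rewrite u1' strand_arc1.
  have l0 : (size l1)%:R = 0 :> R by lra.
  rewrite strand_path_le0 ?l0; last by lra.
  congr base_point; move/eqP: l0; rewrite pnatr_eq0 size_eq0 => /eqP -> //.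
by rewrite IH; [congr strand_path; lra|lra].
Qed.

Lemma strand_path_ge l p u : (size l)%:R <= u ->
  strand_path l p u = base_point (final_position l p).
Proof. by move=> /(@strand_path_catr l [::] p); rewrite cats0. Qed.

Lemma strand_radius_inj : injective (@strand_radius R n).
Proof.
move=> p q; rewrite /strand_radius => /(mulIf _) h; apply/val_inj/eqP.
by rewrite -eqSS -(eqr_nat R); apply/eqP/h; rewrite invr_eq0 pnatr_eq0.
Qed.

Lemma strand_radius_bound p : 0 < strand_radius R p < 1.
Proof.
rewrite /strand_radius divr_gt0//= ltr_pdivrMr// mul1r ltr_nat.
by rewrite ltnS ltn_ord.
Qed.

Lemma strand_arc_bound a p u :
  0 < (strand_arc a p u).1 < 1 /\ 0 < (strand_arc a p u).2 < 1.
Proof.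
rewrite /strand_arc /=; set p' := next_position a p.
have := strand_radius_bound p; have := strand_radius_bound p'.
set x := strand_radius R p; set y := strand_radius R p'.
move=> /andP[y0 y1] /andP[x0 x1]; split.
  have := cos_geN1 (pi * u); have := cos_le1 (pi * u).
  move: (cos _) => c c1 cN1.
  have -> : (x + y) / 2 - (y - x) / 2 * c = x * ((1 + c) / 2) + y * ((1 - c) / 2).
    by field.
  have [xy|xy] := lerP x y.
    have h1 : 0 <= (y - x) * ((1 - c) / 2) by apply: mulr_ge0; lra.
    have h2 : 0 <= (y - x) * ((1 + c) / 2) by apply: mulr_ge0; lra.
    by apply/andP; split; lra.
  have h1 : 0 <= (x - y) * ((1 - c) / 2) by apply: mulr_ge0; lra.
  have h2 : 0 <= (x - y) * ((1 + c) / 2) by apply: mulr_ge0; lra.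
  by apply/andP; split; lra.
have g1 (b : sector) : `|letter_sign R b| = 1.
  by case: b => [[i []]|]; rewrite /= ?normrN normr1.
have h : `|letter_sign R a * ((y - x) / 2) * sin (pi * u)| < 2^-1.
  rewrite -mulrA normrM g1 mul1r normrM.
  apply: (le_lt_trans (ler_piMr _ (sin_max _))) => //.
  by rewrite ltr_norml; apply/andP; split; lra.
move: h; move: (_ * sin _) => z.
rewrite ltr_norml => /andP[h1 h2].
by apply/andP; split; lra.
Qed.

Lemma strand_path_bound l p u :
  0 < (strand_path l p u).1 < 1 /\ 0 < (strand_path l p u).2 < 1.
Proof.
elim: l p u => [|a l IH] p u /=; last by case: ifP => _; [exact: strand_arc_bound|].
by split; [exact: strand_radius_bound|lra].
Qed.

Lemma next_position_inj a : injective (next_position a).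
Proof. by case: a => [[i b]|] p q //= /perm_inj. Qed.

Lemma half_difference (i : 'I_n.-1) :
  strand_radius R (right_strand i) - strand_radius R (left_strand i) = n.+1%:R^-1.
Proof.
by rewrite /strand_radius -mulrBl /= -[i.+2%:R]natr1 addrAC subrr add0r mul1r.
Qed.

(** Two crossing strands could only meet where both cosine and sine of the half turn vanish. A third
    strand stays at height 1/2, which a crossing strand has only at the ends of its half turn, at
    the radius of one of the two crossing positions. *)
Lemma strand_arc_disj a p q u : p != q -> strand_arc a p u != strand_arc a q u.
Proof.
case: a => [[i b]|] npq; last first.
  rewrite !strand_arc_None; apply/negP => /eqP[/strand_radius_inj/eqP].
  by rewrite (negPf npq).
apply/negP => /eqP; rewrite /strand_arc.
set L := left_strand i; set Q := right_strand i.
have hd := half_difference i; rewrite -/L -/Q in hd.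
have d0 : 0 < n.+1%:R^-1 :> R by rewrite invr_gt0.
have lQ : L != Q by apply/eqP => e; move: hd d0; rewrite e subrr => <-; rewrite ltxx.
have sg : letter_sign R (Some (i, b)) != 0 by case: (b); rewrite /= ?oppr_eq0 oner_eq0.
have cs := cos2Dsin2 (pi * u).
have sin0c : sin (pi * u) = 0 -> cos (pi * u) = 1 \/ cos (pi * u) = -1.
  move=> s0; move/eqP: cs; rewrite s0 expr0n /= addr0 sqrf_eq1.
  by case/orP => /eqP ->; [left|right].
have rn p' q' : p' != q' -> strand_radius R p' != strand_radius R q'.
  by apply: contraNneq => /strand_radius_inj ->.
move: cs sin0c; move: (cos _) (sin _) (letter_sign _ _) sg => c s g g0 cs sin0c.
have cross x y : x = L -> y = Q ->
  ((strand_radius R x + strand_radius R y) / 2 - (strand_radius R y - strand_radius R x) / 2 * c,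
    1 / 2 + g * ((strand_radius R y - strand_radius R x) / 2) * s) <>
  ((strand_radius R y + strand_radius R x) / 2 - (strand_radius R x - strand_radius R y) / 2 * c,
    1 / 2 + g * ((strand_radius R x - strand_radius R y) / 2) * s).
  move=> -> -> [e1 e2]; move: hd d0 => <- d0.
  have c0 : c = 0 by apply: (mulfI (lt0r_neq0 d0)); lra.
  have s0 : s = 0.
    apply: (mulfI (mulf_neq0 g0 (lt0r_neq0 d0))); rewrite mulr0.
    by lra.
  by move: cs; rewrite c0 s0 !expr0n /= addr0 => /eqP; rewrite eq_sym oner_eq0.
have away x y z : x = L /\ y = Q \/ x = Q /\ y = L -> z != L -> z != Q ->
  ((strand_radius R x + strand_radius R y) / 2 - (strand_radius R y - strand_radius R x) / 2 * c,
    1 / 2 + g * ((strand_radius R y - strand_radius R x) / 2) * s) <>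
  ((strand_radius R z + strand_radius R z) / 2 - (strand_radius R z - strand_radius R z) / 2 * c,
    1 / 2 + g * ((strand_radius R z - strand_radius R z) / 2) * s).
  move=> xy zL zQ [].
  have xyn : strand_radius R y - strand_radius R x != 0.
    rewrite subr_eq0; apply: rn; case: xy => -[-> ->] //; by rewrite eq_sym.
  rewrite subrr mul0r mulr0 mul0r mul0r => e1 e2.
  have s0 : s = 0.
    apply: (mulfI (mulf_neq0 g0 xyn)); rewrite mulr0.
    by lra.
  have [c1|c1] := sin0c s0; move: e1; rewrite c1 => e1.
    have : strand_radius R x = strand_radius R z by lra.
    move/strand_radius_inj => e; move: zL zQ; rewrite -e.
    by case: xy => -[-> _]; rewrite eqxx.
  have : strand_radius R y = strand_radius R z by lra.
  move/strand_radius_inj => e; move: zL zQ; rewrite -e.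
  by case: xy => -[_ ->]; rewrite eqxx.
rewrite /next_position -/L -/Q.
case: tpermP => [pL|pQ|/eqP pL /eqP pQ]; case: tpermP => [qL|qQ|/eqP qL /eqP qQ].
- by move: npq; rewrite pL qL eqxx.
- by rewrite pL qQ; apply: cross.
- by apply: away => //; left.
- by rewrite pQ qL => /esym; apply: cross.
- by move: npq; rewrite pQ qQ eqxx.
- by apply: away => //; right.
- by move/esym; apply: away => //; left.
- by move/esym; apply: away => //; right.
- case=> e _; have : strand_radius R p = strand_radius R q by lra.
  by move/eqP; rewrite (negPf (rn _ _ npq)).
Qed.

Lemma strand_path_disj l p q u : p != q -> strand_path l p u != strand_path l q u.
Proof.
elim: l p q u => [|a l IH] p q u npq /=.
  by apply/negP => /eqP[/strand_radius_inj/eqP]; rewrite (negPf npq).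
case: ifP => _; first exact: strand_arc_disj.
by apply: IH; apply: contra npq => /eqP/next_position_inj ->.
Qed.

Lemma final_position_inj l : injective (final_position l).
Proof.
elim: l => [//|a l IH] p q /IH; exact: next_position_inj.
Qed.

Lemma final_position_cat l1 l2 p :
  final_position (l1 ++ l2) p = final_position l2 (final_position l1 p).
Proof. exact: foldl_cat. Qed.

Definition sector_link l : 'I_n -> R -> space4 R :=
  loop_link (fun p s => strand_path l p (s * (size l)%:R)) (final_position l).

Definition link_equiv l1 l2 : Prop :=
  oriented_isotopic (thickened_annulus R) (sector_link l1) (sector_link l2).

End StrandPath.

(** The reversed homotopy gives the reverse isotopy, which takes the place of the symmetry of
    [oriented_isotopic]. *)
Lemma homotopic_isotopic_sym (R : realType) (I : finType)
    (G : R -> I -> R -> R * R) (nxt : I -> I) :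
  (forall p, continuous (fun tu : R * R => G tu.1 p tu.2)) ->
  (forall (t u : R) p q, 0 <= t <= 1 -> 0 <= u <= 1 -> p != q ->
    G t p u != G t q u) ->
  (forall (t u : R) p, 0 <= t <= 1 -> 0 <= u <= 1 ->
    0 < (G t p u).1 < 1 /\ 0 < (G t p u).2 < 1) ->
  (forall (t : R) p, 0 <= t <= 1 -> G t p 1 = G t (nxt p) 0) ->
  oriented_isotopic (thickened_annulus R)
    (loop_link (G 0) nxt) (loop_link (G 1) nxt) /\
  oriented_isotopic (thickened_annulus R)
    (loop_link (G 1) nxt) (loop_link (G 0) nxt).
Proof.
move=> c d b l; split; first exact: homotopic_isotopic.
have r (t : R) : 0 <= t <= 1 -> 0 <= 1 - t <= 1 by lra.
have := @homotopic_isotopic R I (fun t => G (1 - t)) nxt.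
rewrite subr0 subrr; apply.
- move=> p; apply: (@continuous_compf _ _ _ (fun tu : R * R => (1 - tu.1, tu.2))
    (fun tu : R * R => G tu.1 p tu.2)) => //.
  apply: continuous_pairf; last by move=> x; exact: cvg_snd.
  apply: continuous_subf; first exact: cst_continuous.
  by move=> x; exact: cvg_fst.
- by move=> t u p q /r; exact: d.
- by move=> t u p /r; exact: b.
- by move=> t p /r; exact: l.
Qed.

(** The ambient isotopy is constant: only the speed and the names of the strands change. *)
Lemma reparam_isotopic (R : realType) (I J : finType) (L : I -> R -> space4 R)
    (L' : J -> R -> space4 R) (sigma : I -> J) (c : R) :
  0 < c -> (forall j, exists i, sigma i = j) ->
  (forall i u, 0 <= u -> L i u = L' (sigma i) (c * u)) ->
  oriented_isotopic (thickened_annulus R) L L'.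
Proof.
move=> c0 sS LE; exists (fun _ x => x); split.
- split => //.
  + by apply: continuous_subspaceT => x; exact: cvg_snd.
  + move=> t _; exists id; split => //;
      by apply: continuous_subspaceT => x; exact: cvg_id.
- apply/seteqP; split => [_ [_ [i [u [u0 <-]]] <-]|_ [j [u [u0 <-]]]].
    by exists (sigma i), (c * u); rewrite LE// mulr_ge0// ltW.
  have [i <-] := sS j; exists (L i (u / c)); last first.
    by rewrite LE ?divr_ge0 ?(ltW c0)// mulrC divfK// gt_eqF.
  by exists i, (u / c); rewrite divr_ge0// ltW.
- move=> i; exists (sigma i), (fun u => c * u); split.
  + apply: continuous_subspaceT; apply: continuous_mulf; first exact: cst_continuous.
    by move=> x; exact: cvg_id.
  + by rewrite mulr0.
  + by move=> u u' _ uu'; rewrite ltr_pM2l.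
  + by move=> u u0; exact: LE.
Qed.

Lemma loop_link_relabel (R : realType) (I : finType) (G G' : I -> R -> R * R)
    (nxt nxt' sigma : I -> I) :
  (forall p (s : R), 0 <= s <= 1 -> G p s = G' (sigma p) s) ->
  (forall p, sigma (nxt p) = nxt' (sigma p)) -> injective sigma ->
  oriented_isotopic (thickened_annulus R) (loop_link G nxt) (loop_link G' nxt') /\
  oriented_isotopic (thickened_annulus R) (loop_link G' nxt') (loop_link G nxt).
Proof.
move=> GG ns si.
have E p u : 0 <= u -> loop_link G nxt p u = loop_link G' nxt' (sigma p) u.
  move=> u0; rewrite /loop_link; set m := Num.truncn u.
  have /andP[mu um] := truncn_itv u0.
  rewrite GG; last first.
    by move: um; rewrite -/m -natr1 subr_ge0 mu => um; lra.
  have -> : sigma (iter m nxt p) = iter m nxt' (sigma p).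
    by elim: m {mu um} => //= m IH; rewrite ns IH.
  by [].
split.
  apply: (@reparam_isotopic _ _ _ _ _ sigma 1) => //.
    by move=> j; exists (invF si j); exact: f_invF.
  by move=> i u u0; rewrite mul1r; exact: E.
apply: (@reparam_isotopic _ _ _ _ _ (invF si) 1) => //.
  by move=> j; exists (sigma j); exact: invF_f.
by move=> i u u0; rewrite mul1r E// f_invF.
Qed.

Lemma oriented_isotopic_refl (R : realType) (I : finType) (L : I -> R -> space4 R) :
  oriented_isotopic (thickened_annulus R) L L.
Proof.
apply: (@reparam_isotopic _ _ _ _ _ id 1) => //; first by move=> j; exists j.
by move=> i u _; rewrite mul1r.
Qed.

(** * Rotating a closure and removing a trivial sector *)

Section SectorMoves.
Variables (R : realType) (n : nat).
Local Notation sector := (option (braid_letter n)).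
Implicit Types (a : sector) (l : seq sector) (p q : 'I_n).
Local Notation equiv := (@link_equiv R n).
Local Notation path := (@strand_path R n).

Lemma link_equiv_trans l1 l2 l3 : equiv l1 l2 -> equiv l2 l3 -> equiv l1 l3.
Proof. exact: oriented_isotopic_trans. Qed.

(** [phi (t, _)] is a time window on one long path, traversed once per turn; the hypothesis says
    that the window closes up throughout. *)
Lemma reparam_homotopy (l : seq sector) (nxt : 'I_n -> 'I_n) (phi : R * R -> R) :
  continuous phi ->
  (forall t p, 0 <= t <= 1 -> path l p (phi (t, 1)) = path l (nxt p) (phi (t, 0))) ->
  let link t := loop_link (fun p s => path l p (phi (t, s))) nxt in
  oriented_isotopic (thickened_annulus R) (link 0) (link 1) /\
  oriented_isotopic (thickened_annulus R) (link 1) (link 0).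
Proof.
move=> cphi lp link.
apply: (@homotopic_isotopic_sym _ _ (fun t p s => path l p (phi (t, s)))) => //.
- move=> p.
  have -> : (fun tu : R * R => path l p (phi (tu.1, tu.2))) =
            (fun tu => path l p (phi tu)) by apply/funext => -[].
  by apply: continuous_compf => //; exact: strand_path_continuous.
- by move=> t u p q _ _; exact: strand_path_disj.
- by move=> t u p _ _; exact: strand_path_bound.
Qed.

(** A window of length [T] slides by one unit along the path of [a :: l] followed by another [a]; at
    the end the strands are renamed by the permutation of [a]. *)
Lemma rotate_sector a l : equiv (a :: l) (rcons l a).
Proof.
pose T : R := (size l).+1%:R; have T0 : 0 <= T by [].
have [L LE] : exists L, L = (a :: l) ++ [:: a] by eexists.
pose phi (x : R * R) := x.2 * T + x.1.
have cphi : continuous phi.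
  apply: continuous_addf; last by move=> x; exact: cvg_fst.
  apply: continuous_mulf; last exact: cst_continuous.
  by move=> x; exact: cvg_snd.
have [] := @reparam_homotopy L (final_position (a :: l)) phi cphi.
  move=> t p t01; rewrite /phi /= mul1r mul0r add0r LE strand_path_catr /=; last first.
    by rewrite -/T; lra.
  by case/andP: t01 => _ t1; rewrite -/T addrAC subrr add0r t1.
move=> h _; apply: oriented_isotopic_trans (oriented_isotopic_trans h _).
  apply: (proj1 (@loop_link_relabel _ _ _ _ _ _ id _ _ _)) => //.
  move=> p s s01; rewrite /phi /= addr0 LE strand_path_catl//.
  by rewrite -/T mulr_ge0 ?ler_piMl//; lra.
apply: (proj1 (@loop_link_relabel _ _ _ _ _ _ (next_position a) _ _ _)).
- move=> p s s01; rewrite /phi /= size_rcons -/T.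
  have -> : L = [:: a] ++ rcons l a by rewrite LE -cats1.
  rewrite strand_path_catr /= ?addrK//.
  by rewrite lerDr mulr_ge0//; lra.
- by move=> p; rewrite -cats1 final_position_cat.
- exact: next_position_inj.
Qed.

Lemma rotate_sectors l1 l2 : equiv (l1 ++ l2) (l2 ++ l1).
Proof.
elim: l1 l2 => [|a l1 IH] l2; first by rewrite cats0; exact: oriented_isotopic_refl.
apply: link_equiv_trans (rotate_sector a _) _.
by rewrite rcons_cat -cat_rcons.
Qed.

(** The window from [t] to [T + 1] loses the first sector as [t] grows to 1. The strands are at rest
    there, so the ends keep matching. *)
Lemma trivial_sector l : equiv (None :: l) l /\ equiv l (None :: l).
Proof.
pose T : R := (size l)%:R; have T0 : 0 <= T by [].
pose phi (x : R * R) := x.1 + x.2 * (T + 1 - x.1).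
have cphi : continuous phi.
  have c1 : continuous (fun x : R * R => x.1) by move=> x; exact: cvg_fst.
  have c2 : continuous (fun x : R * R => x.2) by move=> x; exact: cvg_snd.
  apply: continuous_addf => //; apply: continuous_mulf => //.
  by apply: continuous_subf => //; exact: cst_continuous.
have [] := @reparam_homotopy (None :: l) (final_position l) phi cphi.
  move=> t p t01; rewrite /phi /= mul1r mul0r addr0 addrC subrK.
  rewrite -[LHS]/(path (None :: l) p (T + 1)) strand_path_ge; last first.
    by rewrite /= -natr1.
  by case/andP: t01 => _ t1; rewrite /= strand_arc_None t1.
have [e1 e2] : let G := (fun p s => path (None :: l) p (phi (0, s))) in
  oriented_isotopic (thickened_annulus R)
    (loop_link G (final_position l)) (sector_link (None :: l)) /\
  oriented_isotopic (thickened_annulus R)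
    (sector_link (None :: l)) (loop_link G (final_position l)).
  apply: (@loop_link_relabel _ _ _ _ _ _ id) => // p s s01.
  by rewrite /phi /= add0r subr0 -natr1.
have [e3 e4] : let G := (fun p s => path (None :: l) p (phi (1, s))) in
  oriented_isotopic (thickened_annulus R)
    (loop_link G (final_position l)) (sector_link l) /\
  oriented_isotopic (thickened_annulus R)
    (sector_link l) (loop_link G (final_position l)).
  apply: (@loop_link_relabel _ _ _ _ _ _ id) => // p s s01.
  rewrite /phi /= addrK -/T.
  have := @strand_path_catr R n [:: None] l p (1 + s * T).
  rewrite /= => ->; first by rewrite addrAC subrr add0r.
  by rewrite lerDl mulr_ge0//; lra.
move=> h1 h2; split.
  exact: oriented_isotopic_trans e2 (oriented_isotopic_trans h1 e3).
exact: oriented_isotopic_trans e4 (oriented_isotopic_trans h2 e1).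
Qed.

End SectorMoves.

Lemma straight_isotopic (R : realType) (I : finType) (F F' : I -> R -> R * R)
    (T : R) (nxt : I -> I) :
  0 <= T ->
  (forall p, continuous (F p)) -> (forall p, continuous (F' p)) ->
  (forall p, F p T = F (nxt p) 0) -> (forall p, F' p T = F' (nxt p) 0) ->
  (forall p u, 0 <= u <= T -> 0 < (F p u).1 < 1 /\ 0 < (F p u).2 < 1) ->
  (forall p u, 0 <= u <= T -> 0 < (F' p u).1 < 1 /\ 0 < (F' p u).2 < 1) ->
  (forall p q u (t : R), 0 <= u <= T -> 0 <= t <= 1 -> p != q ->
     (1 - t) *: F p u + t *: F' p u != (1 - t) *: F q u + t *: F' q u) ->
  let link H := loop_link (fun p s => H p (s * T)) nxt in
  oriented_isotopic (thickened_annulus R) (link F) (link F') /\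
  oriented_isotopic (thickened_annulus R) (link F') (link F).
Proof.
move=> T0 cF cF' lF lF' bF bF' dFF' link.
pose G t p (s : R) := (1 - t) *: F p (s * T) + t *: F' p (s * T).
have sT (s : R) : 0 <= s <= 1 -> 0 <= s * T <= T.
  by move=> s01; rewrite mulr_ge0 ?ler_piMl//; lra.
have [| | | |] := @homotopic_isotopic_sym R I G nxt.
- move=> p.
  have cs : continuous (fun tu : R * R => tu.2 * T).
    apply: continuous_mulf; last exact: cst_continuous.
    by move=> x; exact: cvg_snd.
  have ct : continuous (fun tu : R * R => tu.1) by move=> x; exact: cvg_fst.
  apply: continuous_addf; apply: continuous_scalef => //.
  + by apply: continuous_subf => //; exact: cst_continuous.
  + exact: continuous_compf.
  + exact: continuous_compf.
- by move=> t u p q t01 u01; apply: dFF' => //; exact: sT.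
- move=> t u p t01 u01; have [/andP[a1 a2] /andP[a3 a4]] := bF p _ (sT _ u01).
  have [/andP[b1 b2] /andP[b3 b4]] := bF' p _ (sT _ u01).
  case/andP: t01 => t0 t1.
  have comb (x y : R) : 0 < x -> x < 1 -> 0 < y -> y < 1 -> 0 < (1 - t) * x + t * y < 1.
    move=> x0 x1 y0 y1; have [xy|xy] := lerP x y.
      have h1 : 0 <= t * (y - x) by apply: mulr_ge0; lra.
      have h2 : 0 <= (1 - t) * (y - x) by apply: mulr_ge0; lra.
      by apply/andP; split; lra.
    have h1 : 0 <= t * (x - y) by apply: mulr_ge0; lra.
    have h2 : 0 <= (1 - t) * (x - y) by apply: mulr_ge0; lra.
    by apply/andP; split; lra.
  by split; apply: comb.
- by move=> t p t01; rewrite /G mul1r mul0r lF lF'.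
have e0 : G 0 = fun p s => F p (s * T).
  by apply/funext => p; apply/funext => s; rewrite /G subr0 scale1r scale0r addr0.
have e1 : G 1 = fun p s => F' p (s * T).
  by apply/funext => p; apply/funext => s; rewrite /G subrr scale1r scale0r add0r.
by rewrite e0 e1.
Qed.

(** * Braids whose strands lie in separate layers *)

Section Layers.
Variables (R : realType) (n : nat).
Local Notation sector := (option (braid_letter n)).
Implicit Types (a : sector) (l : seq sector) (p q : 'I_n) (b : bool).
Local Notation equiv := (@link_equiv R n).
Local Notation path := (@strand_path R n).

(* At each crossing the strand that starts at the smaller position passes over
   (if [b]) or under (otherwise). *)
Definition layered b l : Prop :=
  forall p q (u : R), (p < q)%N -> 0 <= u <= (size l)%:R ->
    (path l p u).1 = (path l q u).1 ->
    if b then (path l q u).2 < (path l p u).2 else (path l p u).2 < (path l q u).2.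

Section Level.
Variables (b : bool) (l1 l : seq sector).
Let K : R := (size l1)%:R.
(** Since [u (K - u)] is at most [K^2 / 4], this factor keeps the lift within 1/4; the added 1
    covers [K = 0]. *)
Let c : R := (K ^+ 2 + 1)^-1.

(** Inside the layered part the strands get distinct heights in the order prescribed by [b]; at both
    ends they return to 1/2. *)
Definition layer_height p (u : R) : R :=
  1 / 2 + (if b then -1 else 1) * (c * (u * (K - u))) * strand_radius R p.

Definition level_path p (u : R) : R * R :=
  ((path (l1 ++ l) p u).1,
   if u <= K then layer_height p u else (path (l1 ++ l) p u).2).

Let K_ge0 : 0 <= K. Proof. by []. Qed.

Let c_gt0 : 0 < c.
Proof. by rewrite invr_gt0; have := sqr_ge0 K; lra. Qed.

Let lift_bound (u : R) : 0 <= u <= K -> 0 <= c * (u * (K - u)) <= 1 / 4.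
Proof.
move=> u01; rewrite mulr_ge0 ?(ltW c_gt0)//=; last by apply: mulr_ge0; lra.
rewrite /c mulrC ler_pdivrMr; last by have := sqr_ge0 K; lra.
by have := sqr_ge0 (K - 2 * u); lra.
Qed.

Lemma layer_height_end p : layer_height p 0 = 1 / 2 /\ layer_height p K = 1 / 2.
Proof. by rewrite /layer_height subrr !(mulr0, mul0r, addr0). Qed.

Let path_size p (u : R) : u = K -> path (l1 ++ l) p u = base_point R (final_position l1 p).
Proof. by move=> ->; rewrite strand_path_catr ?subrr// strand_path_le0. Qed.

Lemma level_path_continuous p : continuous (level_path p).
Proof.
have ci : continuous (fun u : R => u) by move=> x; exact: cvg_id.
have cc (k : R) : continuous (fun _ : R => k) by exact: cst_continuous.
have cp := @strand_path_continuous R n (l1 ++ l) p.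
apply: continuous_pairf; first exact: continuous_fstf.
apply: continuous_glue.
- apply: continuous_addf => //; apply: continuous_mulf => //.
  apply: continuous_mulf => //; apply: continuous_mulf => //.
  by apply: continuous_mulf => //; exact: continuous_subf.
- exact: continuous_sndf.
- by rewrite path_size//; have [_ ->] := layer_height_end p.
Qed.

Lemma level_path_bound p (u : R) : 0 <= u ->
  0 < (level_path p u).1 < 1 /\ 0 < (level_path p u).2 < 1.
Proof.
move=> u0; have [h1 h2] := @strand_path_bound R n (l1 ++ l) p u; split => //=.
case: (lerP u K) => // uK; have /lift_bound : 0 <= u <= K by rewrite u0 uK.
rewrite /layer_height; move: (c * _) => z /andP[z0 z1].
have /andP[r0 r1] := strand_radius_bound R p.
have zr : z * strand_radius R p <= z by rewrite ler_piMr// ltW.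
have zr0 : 0 <= z * strand_radius R p by rewrite mulr_ge0// ltW.
by case: (b); apply/andP; split; lra.
Qed.

Lemma layer_height_lt p q (u : R) : (p < q)%N -> 0 < u < K ->
  if b then layer_height q u < layer_height p u
  else layer_height p u < layer_height q u.
Proof.
move=> pq /andP[u0 uK]; rewrite /layer_height.
have z0 : 0 < c * (u * (K - u)).
  by apply: mulr_gt0 => //; apply: mulr_gt0 => //; lra.
have pqr : strand_radius R p < strand_radius R q.
  by rewrite /strand_radius ltr_pM2r ?invr_gt0// ltr_nat.
move: (c * _) z0 => z z0.
have : z * strand_radius R p < z * strand_radius R q by rewrite ltr_pM2l.
by case: (b); lra.
Qed.

(** The radii are kept, and where two of them agree the heights are in the same order before and
    after, so the linear homotopy keeps strands apart. At the ends of the layered part the heights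
    coincide but the radii differ. *)
Lemma level_isotopic : layered b l1 ->
  let nxt := final_position (l1 ++ l) in
  let link H := loop_link (fun p s => H p (s * (size (l1 ++ l))%:R)) nxt in
  oriented_isotopic (thickened_annulus R) (link (path (l1 ++ l))) (link level_path) /\
  oriented_isotopic (thickened_annulus R) (link level_path) (link (path (l1 ++ l))).
Proof.
move=> lay nxt; set T : R := (size (l1 ++ l))%:R.
have KT : K <= T by rewrite /T size_cat natrD lerDl.
have T0 : 0 <= T by [].
have level0 p : level_path p 0 = base_point R p.
  rewrite /level_path strand_path_le0// K_ge0 /=.
  by have [-> _] := layer_height_end p.
apply: straight_isotopic => //.
- by move=> p; exact: strand_path_continuous.
- exact: level_path_continuous.
- by move=> p; rewrite strand_path_ge// strand_path_le0.
- move=> p; rewrite level0.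
  have -> : level_path p T = path (l1 ++ l) p T.
    rewrite /level_path; case: (lerP T K) => [TK|_]; last by case: (path _ _ _).
    have -> : T = K by apply/eqP; rewrite eq_le TK KT.
    have [_ ->] := layer_height_end p.
    by rewrite path_size.
  by rewrite strand_path_ge.
- by move=> p u _; exact: strand_path_bound.
- by move=> p u /andP[u0 _]; exact: level_path_bound.
move=> p q u t /andP[u0 _] t01 npq.
wlog pq : p q npq / (p < q)%N => [hw|].
  have [pq|qp|/val_inj pq] := ltngtP p q; first exact: hw.
    by rewrite eq_sym; apply: hw; rewrite // eq_sym.
  by rewrite pq eqxx in npq.
apply/negP => /eqP; rewrite /level_path => -[].
have dis := @strand_path_disj R n (l1 ++ l) p q u npq.
case: (lerP u K) => uK; last first.
  case: (path _ p u) (path _ q u) dis => [x y] [x' y'] /= dis e1 e2.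
  by case/negP: dis; apply/eqP; congr pair; rewrite /GRing.scale /= in e1 e2; lra.
rewrite /= /GRing.scale /= => e1 e2.
have {}e1 : (path (l1 ++ l) p u).1 = (path (l1 ++ l) q u).1 by lra.
have [u00|un0] := eqVneq u 0.
  move: e1; rewrite !strand_path_le0// => /strand_radius_inj/eqP.
  by rewrite (negPf npq).
have [uKK|unK] := eqVneq u K.
  move: e1; rewrite !path_size// => /strand_radius_inj/final_position_inj/eqP.
  by rewrite (negPf npq).
have uI : 0 < u < K by rewrite !lt_neqAle eq_sym un0 unK u0.
have uI' : 0 <= u <= K by rewrite u0 uK.
have h1 := layer_height_lt pq uI.
have := lay p q u pq uI'.
move: e1 e2; rewrite !strand_path_catl// => e1 e2 /(_ e1) h2.
move: e2 h1 h2; case/andP: t01 => t0 t1.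
move: (path _ _ _).2 (path _ _ _).2 (layer_height _ _) (layer_height _ _).
move=> y x w z e2; have [t00|tn0] := eqVneq t 0.
  by move: e2; rewrite t00; case: (b); lra.
have tt0 : 0 < t by rewrite lt_neqAle eq_sym tn0.
case: (b) => h1 h2.
  have : 0 < t * (z - w) by apply: mulr_gt0; lra.
  have : 0 <= (1 - t) * (x - y) by apply: mulr_ge0; lra.
  by lra.
have : 0 < t * (w - z) by apply: mulr_gt0; lra.
have : 0 <= (1 - t) * (y - x) by apply: mulr_ge0; lra.
by lra.
Qed.

End Level.

(** Once levelled, both braids have the same distinct heights, and their radii can be deformed
    linearly. Both relations of the braid group are instances. *)
Lemma layered_equiv b l1 l2 l : size l1 = size l2 ->
  (forall p, final_position l1 p = final_position l2 p) ->
  layered b l1 -> layered b l2 -> equiv (l1 ++ l) (l2 ++ l).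
Proof.
move=> s12 f12 lay1 lay2.
have [h1 _] := level_isotopic l lay1; have [_ h2] := level_isotopic l lay2.
apply: oriented_isotopic_trans h1 (oriented_isotopic_trans _ h2).
set T : R := (size (l1 ++ l))%:R.
have -> : (size (l2 ++ l))%:R = T :> R by rewrite /T !size_cat s12.
have -> : final_position (l2 ++ l) = final_position (l1 ++ l).
  by apply/funext => p; rewrite !final_position_cat f12.
pose K : R := (size l1)%:R.
have KT : K <= T by rewrite /T size_cat natrD lerDl.
have far p (u : R) : K <= u -> path (l1 ++ l) p u = path (l2 ++ l) p u.
  by move=> Ku; rewrite !strand_path_catr -?s12// f12.
have lvl0 l' p : level_path b l' l p 0 = base_point R p.
  rewrite /level_path strand_path_le0// ler0n /=.
  by have [-> _] := layer_height_end b l' p.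
have lvlT l' p : size l' = size l1 -> (forall p, final_position l' p = final_position l1 p) ->
    level_path b l' l p T = base_point R (final_position (l1 ++ l) p).
  move=> sl' fl'.
  have eT : path (l' ++ l) p T = base_point R (final_position (l1 ++ l) p).
    rewrite strand_path_ge /T ?size_cat ?sl'//.
    by rewrite !final_position_cat fl'.
  rewrite /level_path sl' -/K; case: (lerP T K) => [TK|_]; last by rewrite eT.
  have -> : layer_height b l' p T = 1 / 2.
    have -> : T = (size l')%:R by apply/eqP; rewrite eq_le sl' TK KT.
    by have [_ ->] := layer_height_end b l' p.
  by rewrite eT.
apply: (proj1 (@straight_isotopic _ _ _ _ _ _ _ _ _ _ _ _ _ _)) => //.
- exact: level_path_continuous.
- exact: level_path_continuous.
- by move=> p; rewrite lvl0 lvlT.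
- by move=> p; rewrite lvl0 lvlT.
- by move=> p u /andP[u0 _]; exact: level_path_bound.
- by move=> p u /andP[u0 _]; exact: level_path_bound.
move=> p q u t /andP[u0 _] t01 npq.
wlog pq : p q npq / (p < q)%N => [hw|].
  have [pq|qp|/val_inj pq] := ltngtP p q; first exact: hw.
    by rewrite eq_sym; apply: hw; rewrite // eq_sym.
  by rewrite pq eqxx in npq.
apply/negP => /eqP; rewrite /level_path -s12 -/K => -[].
have lh p' : layer_height b l2 p' u = layer_height b l1 p' u.
  by rewrite /layer_height s12.
have edge : path (l1 ++ l) p u = path (l2 ++ l) p u ->
  path (l1 ++ l) q u = path (l2 ++ l) q u ->
  (1 - t) * (path (l1 ++ l) p u).1 + t * (path (l2 ++ l) p u).1 =
  (1 - t) * (path (l1 ++ l) q u).1 + t * (path (l2 ++ l) q u).1 ->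
  (path (l1 ++ l) p u).1 = (path (l1 ++ l) q u).1.
  by move=> <- <-; lra.
case: (lerP u K) => uK; last first.
  rewrite /GRing.scale /= => e1 e2.
  have {}e1 := edge (far _ _ (ltW uK)) (far _ _ (ltW uK)) e1.
  have := @strand_path_disj R n (l1 ++ l) p q u npq.
  move: e1 e2; rewrite -!far ?(ltW uK)//.
  case: (path _ p u) (path _ q u) => [x y] [x' y'] /= -> e2 /eqP; apply.
  by congr pair; lra.
rewrite /= /GRing.scale /= !lh => e1 e2.
have [u00|un0] := eqVneq u 0.
  move: (edge); rewrite !strand_path_le0// => /(_ erefl erefl).
  move: e1; rewrite !strand_path_le0// => e1 /(_ e1)/strand_radius_inj/eqP.
  by rewrite (negPf npq).
have [uKK|unK] := eqVneq u K.
  have {edge} := edge (far _ _ _) (far _ _ _) e1; rewrite uKK => /(_ (lexx _) (lexx _)).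
  rewrite !strand_path_catr// subrr !strand_path_le0//.
  by move=> /strand_radius_inj/final_position_inj/eqP; rewrite (negPf npq).
have uI : 0 < u < K by rewrite !lt_neqAle eq_sym un0 unK u0.
by have := layer_height_lt b pq uI; move: e2; clear; case: b; lra.
Qed.

End Layers.

Definition word_sectors (n : nat) (w : braid_word n) : seq (option (braid_letter n)) :=
  rcons (map Some w) None.

(** * The closure of a word as a sequence of sectors *)

Section ClosureSectors.
Variables (R : realType) (n : nat) (w : braid_word n).
Local Notation l := (word_sectors w).

Lemma size_word_sectors : size l = sectors w.
Proof. by rewrite size_rcons size_map. Qed.

Lemma nth_word_sectors m : (m < sectors w)%N -> nth None l m = onth w m.
Proof.
by rewrite /sectors /word_sectors; elim: w m => [[]//|a w' IH] [//|m] /IH.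
Qed.

Lemma position_mod p k m : (m <= sectors w)%N ->
  position w p (k * sectors w + m) =
  final_position (take m l) (position w p (k * sectors w)).
Proof.
elim: m => [_|m IH mT]; first by rewrite addn0 take0.
rewrite addnS /= IH ?(ltnW mT)// /sector_letter modnMDl modn_small//.
rewrite (take_nth None) ?size_word_sectors// -cats1 final_position_cat /=.
by rewrite nth_word_sectors.
Qed.

Lemma position_mul p k :
  position w p (k * sectors w) = iter k (final_position l) p.
Proof.
elim: k => [|k IH]; first by rewrite mul0n.
by rewrite iterS -IH mulSn addnC position_mod// take_oversize// size_word_sectors.
Qed.

Lemma strand_path_nth (l' : seq (option (braid_letter n))) q m (x : R) :
  (m < size l')%N -> m%:R <= x <= m.+1%:R ->
  strand_path l' q x =
  strand_arc (nth None l' m) (final_position (take m l') q) (x - m%:R).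
Proof.
move=> ml /andP[mx xm].
have s : size (take m l') = m by rewrite size_take ml.
rewrite -{1}(cat_take_drop m l') strand_path_catr s// (drop_nth None ml) /=.
by rewrite ifT// lerBlDl natr1.
Qed.

(** [braid_closure] measures time in sectors and [sector_link] in turns. Time is divided into [k]
    full turns, [m] full sectors and a remainder. *)
Lemma braid_closureE p (u : R) : 0 <= u ->
  braid_closure R w p u = sector_link l p ((sectors w)%:R^-1 * u).
Proof.
move=> u0; set T : R := (sectors w)%:R.
have T0 : 0 < T by rewrite ltr0n.
rewrite [T^-1 * u]mulrC; set v := u / T; set k := Num.truncn v.
have v0 : 0 <= v by rewrite divr_ge0// ltW.
have /andP[kv vk] := truncn_itv v0; rewrite -/k in kv vk.
pose x := (v - k%:R) * T.
have xE : x = u - (k * sectors w)%:R.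
  by rewrite /x mulrBl divfK ?gt_eqF// natrM.
have x0 : 0 <= x by rewrite mulr_ge0 ?subr_ge0// ltW.
have xT : x < T.
  by rewrite /x -{2}[T]mul1r ltr_pM2r// ltrBlDl natr1.
have /andP[mx xm] := truncn_itv x0; set m := Num.truncn x in mx xm.
have mT : (m < sectors w)%N by rewrite -(ltr_nat R); apply: le_lt_trans mx xT.
have uE : Num.truncn u = (k * sectors w + m)%N.
  apply: truncn_def; rewrite -[u](subrK (k * sectors w)%:R) -xE.
  by rewrite natrD -addnS natrD [X in X <= _]addrC lerD2r mx [X in _ < X]addrC ltrD2r.
rewrite /braid_closure /sector_link /loop_link /annulus_point uE -/v -/k.
rewrite size_word_sectors -/T -/x /= (@strand_path_nth l _ m); first last.
- by rewrite mx ltW.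
- by rewrite size_word_sectors.
rewrite nth_word_sectors// /sector_letter modnMDl modn_small//.
rewrite position_mod ?(ltnW mT)// position_mul.
have -> : u - (k * sectors w + m)%:R = x - m%:R.
  by rewrite xE natrD opprD addrA.
by have -> : 2 * pi * v = 2 * pi * u / T by rewrite /v mulrA.
Qed.

Lemma braid_closure_sector_link :
  oriented_isotopic (thickened_annulus R) (braid_closure R w) (sector_link l) /\
  oriented_isotopic (thickened_annulus R) (sector_link l) (braid_closure R w).
Proof.
have T0 : 0 < (sectors w)%:R :> R by rewrite ltr0n.
split.
  apply: (@reparam_isotopic _ _ _ _ _ id (sectors w)%:R^-1).
  - by rewrite invr_gt0.
  - by move=> j; exists j.
  - exact: braid_closureE.
apply: (@reparam_isotopic _ _ _ _ _ id (sectors w)%:R) => //.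
  by move=> j; exists j.
move=> p u u0; rewrite braid_closureE ?mulr_ge0 ?(ltW T0)//.
by rewrite mulKf// gt_eqF.
Qed.

End ClosureSectors.

Section CrossingOrder.
Variables (R : realType) (n : nat).
Local Notation sector := (option (braid_letter n)).
Implicit Types (a : sector) (l : seq sector) (p q : 'I_n) (b : bool).
Local Notation rad := (@strand_radius R n).

Lemma strand_radius_lt p q : (rad p < rad q) = (p < q)%N.
Proof. by rewrite /strand_radius ltr_pM2r ?invr_gt0// ltr_nat. Qed.

(** Radii agree only in the middle of the half turn, where the cosine is 0 and the sine 1; the sign
    of the letter then decides which strand is above. *)
Lemma strand_arc_meet i (b' : bool) p q (u : R) : 0 <= u <= 1 -> p != q ->
  (strand_arc (Some (i, b')) p u).1 = (strand_arc (Some (i, b')) q u).1 ->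
  [/\ p = left_strand i, q = right_strand i &
      if b' then (strand_arc (Some (i, b')) q u).2 < (strand_arc (Some (i, b')) p u).2
      else (strand_arc (Some (i, b')) p u).2 < (strand_arc (Some (i, b')) q u).2] \/
  [/\ p = right_strand i, q = left_strand i &
      if b' then (strand_arc (Some (i, b')) p u).2 < (strand_arc (Some (i, b')) q u).2
      else (strand_arc (Some (i, b')) q u).2 < (strand_arc (Some (i, b')) p u).2].
Proof.
move=> u01 npq; rewrite /strand_arc.
set L := left_strand i; set Q := right_strand i.
have LQ : rad L < rad Q by rewrite strand_radius_lt /=.
have away z : z != L -> z != Q -> rad z < rad L \/ rad Q < rad z.
  move=> zL zQ; rewrite !strand_radius_lt /=.
  have : (z != i :> nat) by move: zL; apply: contraNneq => e; apply/eqP/val_inj.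
  have : (z != i.+1 :> nat) by move: zQ; apply: contraNneq => e; apply/eqP/val_inj.
  move=> h1 h2; case: (ltngtP z i) h2 => // zi _; [by left|right].
  by rewrite ltn_neqAle eq_sym h1.
have pi0 := pi_gt0 R.
have s0 : 0 <= sin (pi * u).
  by apply: sin_ge0_pi; rewrite mulr_ge0 ?ler_piMr ?(ltW pi0)//; lra.
have cN1 := cos_geN1 (pi * u); have c1 := cos_le1 (pi * u).
have cs := cos2Dsin2 (pi * u).
move: (cos _) (sin _) s0 cN1 c1 cs => c s s0 cN1 c1 cs.
have between : rad L <= (rad L + rad Q) / 2 - (rad Q - rad L) / 2 * c <= rad Q.
  have h1 : 0 <= (rad Q - rad L) * (1 - c) by apply: mulr_ge0; lra.
  have h2 : 0 <= (rad Q - rad L) * (1 + c) by apply: mulr_ge0; lra.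
  by apply/andP; split; lra.
have between' : rad L <= (rad Q + rad L) / 2 - (rad L - rad Q) / 2 * c <= rad Q.
  have h1 : 0 <= (rad Q - rad L) * (1 - c) by apply: mulr_ge0; lra.
  have h2 : 0 <= (rad Q - rad L) * (1 + c) by apply: mulr_ge0; lra.
  by apply/andP; split; lra.
have s1 : (rad Q - rad L) * c = 0 -> s = 1.
  move=> /eqP; rewrite mulf_eq0 subr_eq0 gt_eqF//= => /eqP c0.
  move: cs; rewrite c0 expr0n /= add0r => /eqP; rewrite sqrf_eq1.
  by case/orP => /eqP // sN; move: s0; rewrite sN; lra.
rewrite /next_position -/L -/Q.
case: tpermP => [pL|pQ|/eqP pL /eqP pQ]; case: tpermP => [qL|qQ|/eqP qL /eqP qQ].
- by move: npq; rewrite pL qL eqxx.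
- rewrite pL qQ /= => e; left; split => //.
  have -> : s = 1 by apply: s1; lra.
  by case: b' => /=; lra.
- by rewrite pL /=; have [] := away q qL qQ; lra.
- rewrite pQ qL /= => e; right; split => //.
  have -> : s = 1 by apply: s1; lra.
  by case: b' => /=; lra.
- by move: npq; rewrite pQ qQ eqxx.
- by rewrite pQ /=; have [] := away q qL qQ; lra.
- by rewrite qL /=; have [] := away p pL pQ; lra.
- by rewrite qQ /=; have [] := away p pL pQ; lra.
- rewrite /= => e; have {}e : rad p = rad q by lra.
  by move: npq; rewrite (strand_radius_inj e) eqxx.
Qed.

(** Decidable criterion for [layered]: where the two strands cross, the sign that keeps their order
    depends on which of them arrives on the left. *)
Fixpoint crossings_ordered b l p q : bool :=
  if l is a :: l' then
    (if a is Some (i, b') then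
       ((p == left_strand i) && (q == right_strand i) ==> (b' == b)) &&
       ((p == right_strand i) && (q == left_strand i) ==> (b' == ~~ b))
     else true) && crossings_ordered b l' (next_position a p) (next_position a q)
  else true.

Lemma crossings_layered b l :
  (forall p q, (p < q)%N -> crossings_ordered b l p q) -> layered R b l.
Proof.
move=> ok p q u pq; have {ok} := ok p q pq.
have : p != q by rewrite neq_ltn pq.
elim: l p q u {pq} => [|a l IH] p q u npq /= ok /andP[u0 us].
  by move/strand_radius_inj => e; rewrite e eqxx in npq.
case/andP: ok => oka okl; case: (lerP u 1) => u1; last first.
  apply: IH => //; first by apply: contra npq => /eqP/next_position_inj ->.
  by move: us; rewrite -natr1; lra.
case: a oka {okl IH} => [[i b']|_].
  move=> /andP[ok1 ok2] /strand_arc_meet => /(_ _ npq)[|[pL qQ h]|[pQ qL h]].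
  - by rewrite u0 u1.
  - have bb : b' = b by move: ok1; rewrite pL qQ !eqxx => /eqP.
    by rewrite -bb.
  - have bb : b' = ~~ b by move: ok2; rewrite pQ qL !eqxx => /eqP.
    by move: h; rewrite bb; case: (b).
rewrite !strand_arc_None => /strand_radius_inj e.
by rewrite e eqxx in npq.
Qed.

End CrossingOrder.

(** * Braid relations and conjugation as isotopies *)

Section WordMoves.
Variables (R : realType) (n : nat).
Implicit Types (w x y z : braid_word n) (i : 'I_n.-1) (b : bool).
Local Notation equiv := (@link_equiv R n).
Local Notation sec := (map (@Some (braid_letter n))).

(** Since closures can be rotated, the suffix stands for an arbitrary context, and the relation is a
    congruence. *)
Definition word_equiv x y : Prop := forall u, equiv (sec (x ++ u)) (sec (y ++ u)).

Lemma equiv_rotate x y : equiv (sec (x ++ y)) (sec (y ++ x)).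
Proof. by rewrite !map_cat; exact: rotate_sectors. Qed.

Lemma equiv_isotopic x y : equiv (sec x) (sec y) ->
  oriented_isotopic (thickened_annulus R) (braid_closure R x) (braid_closure R y).
Proof.
move=> xy.
have wsE w : equiv (word_sectors w) (sec w) /\ equiv (sec w) (word_sectors w).
  have [t1 t2] := trivial_sector R (sec w).
  rewrite /word_sectors -cats1; split.
    exact: link_equiv_trans (rotate_sectors R (sec w) [:: None]) t1.
  exact: link_equiv_trans t2 (rotate_sectors R [:: None] (sec w)).
have [h1 _] := braid_closure_sector_link R x.
have [_ h2] := braid_closure_sector_link R y.
apply: oriented_isotopic_trans h1 (oriented_isotopic_trans _ h2).
have [h3 _] := wsE x; have [_ h4] := wsE y.
exact: link_equiv_trans h3 (link_equiv_trans xy h4).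
Qed.

Lemma word_equiv_refl x : word_equiv x x.
Proof. by move=> u; exact: oriented_isotopic_refl. Qed.

Lemma word_equiv_trans x y z : word_equiv x y -> word_equiv y z -> word_equiv x z.
Proof. by move=> xy yz u; exact: link_equiv_trans (xy u) (yz u). Qed.

Lemma word_equiv_cat x y x' y' :
  word_equiv x y -> word_equiv x' y' -> word_equiv (x ++ x') (y ++ y').
Proof.
move=> xy xy' u; rewrite -!catA.
apply: link_equiv_trans (xy _) _.
apply: link_equiv_trans (equiv_rotate _ _) _; rewrite -catA.
apply: link_equiv_trans (xy' _) _; rewrite catA.
by apply: link_equiv_trans (equiv_rotate _ _) _; exact: oriented_isotopic_refl.
Qed.

Lemma word_equiv_cancel i b :
  word_equiv [:: (i, b); (i, ~~ b)] [::] /\ word_equiv [::] [:: (i, b); (i, ~~ b)].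
Proof.
pose l1 : seq (option (braid_letter n)) := [:: Some (i, b); Some (i, ~~ b)].
(* Two trivial sectors stand in for the empty word, because [layered_equiv] compares sequences of
   equal length. *)
pose l2 : seq (option (braid_letter n)) := [:: None; None].
have fE p : final_position l1 p = final_position l2 p.
  by rewrite /l1 /l2 /final_position /= tpermK.
have lay1 : layered R b l1.
  apply: crossings_layered => p q pq; rewrite /l1 /crossings_ordered.
  have nQL : (p == right_strand i) && (q == left_strand i) = false.
    apply/negP => /andP[/eqP pQ /eqP qL]; move: pq.
    by rewrite pQ qL /= ltnNge leqnSn.
  have eL r : (next_position (Some (i, b)) r == left_strand i) = (r == right_strand i).
    by rewrite /next_position -[X in _ == X](tpermR (left_strand i) (right_strand i)) (inj_eq perm_inj).
  have eR r : (next_position (Some (i, b)) r == right_strand i) = (r == left_strand i).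
    by rewrite /next_position -[X in _ == X](tpermL (left_strand i) (right_strand i)) (inj_eq perm_inj).
  by rewrite !eL !eR nQL !eqxx !implybT.
have lay2 : layered R b l2 by apply: crossings_layered => p q _.
have t1 l : equiv (None :: None :: l) l.
  have [h1 _] := trivial_sector R (None :: l); have [h2 _] := trivial_sector R l.
  exact: link_equiv_trans h1 h2.
have t2 l : equiv l (None :: None :: l).
  have [_ h1] := trivial_sector R (None :: l); have [_ h2] := trivial_sector R l.
  exact: link_equiv_trans h2 h1.
split => u.
  apply: link_equiv_trans (t1 _).
  exact: (@layered_equiv R n b l1 l2 (sec u)).
apply: link_equiv_trans (t2 _) _.
exact: (@layered_equiv R n b l2 l1 (sec u)).
Qed.

End WordMoves.

Lemma tperm_strand_val (n : nat) (i : 'I_n.-1) p :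
  tperm (left_strand i) (right_strand i) p =
    (if p == i :> nat then i.+1 else if p == i.+1 :> nat then i : nat else p) :> nat.
Proof. by rewrite permE /= -!val_eqE /=; case: ifP => //; case: ifP. Qed.

Lemma word_equiv_braid (R : realType) (i j : 'I_2) :
  let s k : braid_letter 3 := (k, true) in
  word_equiv R [:: s i; s j; s i] [:: s j; s i; s j].
Proof.
move=> s; have [->|nij] := eqVneq i j; first exact: word_equiv_refl.
(* In a positive triple each strand passes over all those that start further out. *)
move=> u; have lay (i' j' : 'I_2) : i' != j' -> layered R true (map Some [:: s i'; s j'; s i']).
  move=> nij'; apply: crossings_layered => p q; move: nij'.
  rewrite /s /= -!val_eqE /= !tperm_strand_val.
  by case: i' j' p q => [[|[|//]] hi] [[|[|//]] hj] [[|[|[|//]]] hp] [[|[|[|//]]] hq].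
rewrite !map_cat; apply: (@layered_equiv R 3 true (map Some [:: s i; s j; s i])
  (map Some [:: s j; s i; s j]) (map Some u)) => //; first last.
- by apply: lay; rewrite eq_sym.
- exact: lay.
move=> p; apply: val_inj; rewrite /final_position /= !tperm_strand_val.
by case: i j nij p => [[|[|//]] hi] [[|[|//]] hj] // _ [[|[|[|//]]] hp].
Qed.

Local Close Scope classical_set_scope.

Lemma braid_word_equiv (R : realType) (u v : braid_word 3) :
  braid_eq u v -> word_equiv R u v /\ word_equiv R v u.
Proof.
elim=> [w|x y _ [] //|x y z _ [xy yx] _ [yz zy]|x x' y y' _ [xx' x'x] _ [yy' y'y]|i b|i j].
- by split; exact: word_equiv_refl.
- by split; [exact: word_equiv_trans xy yz | exact: word_equiv_trans zy yx].
- by split; exact: word_equiv_cat.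
- exact: word_equiv_cancel.
- by split; exact: word_equiv_braid.
Qed.

(** [u] is replaced by [g^-1 v g], whose closure rotates to that of [g g^-1 v]. *)
Lemma conj_isotopic (R : realType) (u v g : braid_word 3) : braid_eq (g ++ u) (v ++ g) ->
  oriented_isotopic (thickened_annulus R) (braid_closure R u) (braid_closure R v).
Proof.
move=> e; apply: equiv_isotopic.
have e1 : braid_eq u ((inv_word g ++ v) ++ g).
  apply: braid_trans (braid_cat (braid_sym (inv_wordl g)) (braid_refl u)) _.
  by rewrite -!catA; exact: braid_cat (braid_refl _) e.
have e2 : braid_eq (g ++ inv_word g ++ v) v.
  by rewrite catA; exact: braid_cat (inv_wordr g) (braid_refl v).
have [h1 _] := braid_word_equiv R e1; have [h2 _] := braid_word_equiv R e2.
have := h1 [::]; have := h2 [::]; rewrite !cats0 => k2 k1.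
exact: link_equiv_trans k1 (link_equiv_trans (equiv_rotate R _ _) k2).
Qed.

Theorem corollary1p3 (R : realType) (N n : nat) (alpha : braid_word n) :
  (1 <= N)%N -> (1 <= n)%N ->
  (forall j k : int,
      annular_jones alpha j k = annular_jones (KN_word N) j k) ->
  oriented_isotopic (thickened_annulus R)
    (braid_closure R alpha) (braid_closure R (KN_word N)).
Proof.
move=> N_gt0 _ jones; have [n3 wr] := jones_strands_writhe jones; subst n.
have alpha0 : exp_sum alpha = 0.
  rewrite -writhe_exp_sum wr writhe_exp_sum.
  have := congr1 exp_sum (alternating_KN N).
  by rewrite -cat1s !exp_sum_cat exp_sum_alternating => /eqP; rewrite addrC (inj_eq (addIr _)) => /eqP.
have [q q0|g e] := detection N_gt0 alpha0; last exact: conj_isotopic e.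
exact: (jones_burau q0 jones wr).
Qed.
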